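(* Let $\mathfrak{k},\mathfrak{k}_1,\mathfrak{k}_2$ be quadratic Lie algebras, let $A_1\to N_1$, $A_2\to N_2$ be Lie algebroids, and let $(\varphi_1,\varphi):A_1\to\mathfrak{k}_1\times\mathfrak{k}$ and $(\psi_2,\psi):A_2\to\mathfrak{k}_2\times\mathfrak{k}$ be Lie algebroid morphisms. Let $(\lambda_1,\eta_1)$ be a lagrangian structure on $(\varphi_1,\varphi)$ into $\mathfrak{k}_1\times\mathfrak{k}$, and $(\lambda_2,\eta_2)$ a lagrangian structure on $(\psi_2,\psi)$ into $\mathfrak{k}_2\times\overline{\mathfrak{k}}$. Suppose that the map $A_1\times A_2\to\mathfrak{k}$, $(u,v)\mapsto\varphi(u)-\psi(v)$, is onto (fibrewise over $N_1\times N_2$). Then $$(\lambda,\eta):=(\mathrm{pr}_1^*\lambda_1+\mathrm{pr}_2^*\lambda_2,\ \mathrm{pr}_1^*\eta_1+\mathrm{pr}_2^*\eta_2)$$ is a lagrangian structure on the Lie algebroid morphism $(\varphi_1,\psi_2):A_1\times_{\mathfrak{k}}A_2\to\mathfrak{k}_1\times\mathfrak{k}_2$.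
   Context: Everything is real and $C^\infty$. A quadratic Lie algebra is a Lie algebra with a nondegenerate, symmetric, ad-invariant pairing; $\overline{\mathfrak{k}}$ denotes $\mathfrak{k}$ with the opposite pairing; products carry the sum pairing. $A_1\times_{\mathfrak{k}}A_2=\{(u,v)\in A_1\times A_2: \varphi(u)=\psi(v)\}$; under the surjectivity hypothesis this is a vector bundle over $N_1\times N_2$ and a Lie subalgebroid of the product Lie algebroid $A_1\times A_2\to N_1\times N_2$. $\lambda$ is given by $\lambda(u,v)=\lambda_1(u)+\lambda_2(v)\in T^*N_1\times T^*N_2=T^*(N_1\times N_2)$. Let $(\mathfrak{k},\langle\cdot,\cdot\rangle)$ be a quadratic Lie algebra and $\varphi:A\to\mathfrak{k}$ a morphism from a Lie algebroid $A\to N$ with anchor $\mathtt{a}$. An isotropic structure on $\varphi$ is a pair $(\lambda,\eta)$, with $\lambda:A\to T^*N$ a vector bundle map over $\mathrm{id}_N$ and $\eta\in\Omega^3(N)$ closed, such that for all $u,v\in\Gamma(A)$: $\lambda([u,v])=\mathcal{L}_{\mathtt{a}(u)}\lambda(v)-i_{\mathtt{a}(v)}d\lambda(u)+i_{\mathtt{a}(v)}i_{\mathtt{a}(u)}\eta+\langle d\varphi(u),\varphi(v)\rangle$ and $-\langle\varphi(u),\varphi(v)\rangle=i_{\mathtt{a}(u)}\lambda(v)+i_{\mathtt{a}(v)}\lambda(u)$. It is lagrangian if the map $(\mathtt{a},\lambda,\varphi):A\to(TN\oplus T^*N)\oplus\mathfrak{k}_N$ ($\mathfrak{k}_N=N\times\mathfrak{k}$)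 is injective with image a Dirac structure (lagrangian subbundle with sections closed under the bracket) in the Courant algebroid $\mathbb{T}_\eta N\times\mathfrak{k}$, which has anchor the projection to $TN$, pairing $(X_1+\alpha_1+w_1,X_2+\alpha_2+w_2)\mapsto i_{X_2}\alpha_1+i_{X_1}\alpha_2+\langle w_1,w_2\rangle$, and bracket $[\![X_1+\alpha_1+w_1,X_2+\alpha_2+w_2]\!]=[X_1,X_2]+(\mathcal{L}_{X_1}\alpha_2-i_{X_2}d\alpha_1+i_{X_2}i_{X_1}\eta+\langle dw_1,w_2\rangle)+(\mathcal{L}_{X_1}w_2-\mathcal{L}_{X_2}w_1+[w_1,w_2])$. *)

(* Defs.v *)
From HB Require Import structures.
From mathcomp Require Import all_boot all_order all_algebra.
From mathcomp Require Import all_classical all_reals all_analysis.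

Set Implicit Arguments.
Unset Strict Implicit.
Unset Printing Implicit Defensive.

Import Order.TTheory GRing.Theory Num.Theory.
Import numFieldNormedType.Exports.

Local Open Scope classical_set_scope.
Local Open Scope ring_scope.

(* To be used with [U] open: all iterated directional derivatives up to order
   [k] exist and are continuous on [U]. *)
Fixpoint Ck (R : realType) (n k : nat) (U : set 'rV[R]_n) (f : 'rV[R]_n -> R)
    : Prop :=
  (forall z, U z -> {for z, continuous f}) /\
  match k with
  | 0 => True
  | k'.+1 => forall v : 'rV[R]_n,
      (forall z, U z -> derivable f z v) /\ Ck k' U ('D_v f)
  end.

Definition smooth_on (R : realType) (n : nat) (U : set 'rV[R]_n)
    (f : 'rV[R]_n -> R) : Prop :=
  forall k, Ck k U f.

(* An n-dimensional (Hausdorff, second countable) manifold with a smooth atlas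
   [chart p : dom p -> R^n] indexed by the points, [p] being in [dom p];
   [chinv p] is the inverse of [chart p] on the open set [chart p @` dom p].
   The values of [chart p] outside [dom p], and of [chinv p] outside of
   [chart p @` dom p], are irrelevant. *)
Record manifold (R : realType) (n : nat) := Manifold {
  mpt :> topologicalType;
  dom : mpt -> set mpt;
  chart : mpt -> mpt -> 'rV[R]_n;
  chinv : mpt -> 'rV[R]_n -> mpt;
  manifold_hausdorff : hausdorff_space mpt;
  manifold_second_countable : @second_countable mpt;
  dom_open : forall p, open (dom p);
  dom_refl : forall p, dom p p;
  chart_open : forall p, open (chart p @` dom p);
  chartK : forall p q, dom p q -> chinv p (chart p q) = q;
  chart_continuous : forall p q, dom p q -> {for q, continuous (chart p)};
  chinv_continuous : forall p z, (chart p @` dom p) z ->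
    {for z, continuous (chinv p)};
  chart_compatible : forall p q i,
    smooth_on (chart p @` (dom p `&` dom q))
      (fun z => chart q (chinv p z) ord0 i) }.

Arguments Manifold {R n mpt dom chart chinv}.
Arguments dom {R n m}.
Arguments chart {R n m}.
Arguments chinv {R n m}.

Section Calculus.
Context {R : realType} {n : nat} {N : manifold R n}.

Definition smooth_at (f : N -> R) (x : N) : Prop :=
  exists U : set 'rV[R]_n,
    [/\ open U, U (chart x x) & smooth_on U (f \o chinv x)].

Definition smoothv_at (V : vectType R) (f : N -> V) (x : N) : Prop :=
  forall l : 'Hom(V, R^o), smooth_at (fun y => l (f y)) x.

(* T_x N is R^n, identified through the chart [chart x] indexed by [x]. *)
Definition TS (x : N) : vectType R := 'rV[R]_n.

(* the derivative of a function along v in T_x N *)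
Definition dd (f : N -> R) (x : N) (v : TS x) : R :=
  'D_v (f \o chinv x) (chart x x).
Arguments dd f x v : clear implicits.

Definition ddv (V : vectType R) (f : N -> V) (x : N) (v : TS x) : V :=
  \sum_(i < \dim {:V})
    dd (fun y => coord (vbasis {:V}) i (f y)) x v *: (vbasis {:V})`_i.

(* the components of v in T_y N in the chart [chart x], for y in [dom x] *)
Definition chart_comp (x y : N) (v : TS y) : 'rV[R]_n :=
  \row_i dd (fun q => chart x q ord0 i) y v.

(* the vector field on [dom x] with constant components [v] in [chart x];
   [coordf x v x = v] *)
Definition coordf (x : N) (v : TS x) (y : N) : TS y :=
  \row_i 'D_(v : 'rV[R]_n) (fun z => chart y (chinv x z) ord0 i) (chart x y).
Arguments coordf x v y : clear implicits.

Definition vfield := forall x : N, TS x.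
Definition form1 := forall x : N, 'Hom(TS x, R^o).
Definition form3 := forall x : N, TS x -> TS x -> TS x -> R.

Definition vfield_smooth_at (X : vfield) (x : N) : Prop :=
  forall i, smooth_at (fun y => chart_comp x (X y) ord0 i) x.

Definition form1_smooth_at (a : form1) (x : N) : Prop :=
  forall v : TS x, smooth_at (fun y => a y (coordf x v y)) x.

(* the Lie bracket [X, Y] = X(Y^i) - Y(X^i) in the chart [chart x] *)
Definition vfield_br (X Y : vfield) : vfield := fun x =>
  \row_i (dd (fun y => chart_comp x (Y y) ord0 i) x (X x)
          - dd (fun y => chart_comp x (X y) ord0 i) x (Y x)).

(* the exterior derivative of a 1-form, evaluated on (v, w); the coordinate
   fields extending v and w commute *)
Definition ext_d1 (a : form1) (x : N) (v w : TS x) : R :=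
  dd (fun y => a y (coordf x w y)) x v - dd (fun y => a y (coordf x v y)) x w.

(* (L_X a)(V) = X (a V) - a [X, V], with V the coordinate field extending v *)
Definition lie_der1 (X : vfield) (a : form1) (x : N) (v : TS x) : R :=
  dd (fun y => a y (coordf x v y)) x (X x) - a x (vfield_br X (coordf x v) x).

Definition is_form3 (h : form3) : Prop :=
  [/\ forall x (c : R) (u u' v w : TS x),
        h x (c *: u + u') v w = c * h x u v w + h x u' v w,
      forall x (u v w : TS x), h x v u w = - h x u v w,
      forall x (u v w : TS x), h x u w v = - h x u v w
    & forall x (u v w : TS x),
        smooth_at (fun y => h y (coordf x u y) (coordf x v y) (coordf x w y)) x].

Definition closed3 (h : form3) : Prop :=
  forall x (v0 v1 v2 v3 : TS x),
    dd (fun y => h y (coordf x v1 y) (coordf x v2 y) (coordf x v3 y)) x v0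
    - dd (fun y => h y (coordf x v0 y) (coordf x v2 y) (coordf x v3 y)) x v1
    + dd (fun y => h y (coordf x v0 y) (coordf x v1 y) (coordf x v3 y)) x v2
    - dd (fun y => h y (coordf x v0 y) (coordf x v1 y) (coordf x v2 y)) x v3 = 0.

End Calculus.

Arguments dd {R n N} f x v.
Arguments ddv {R n N V} f x v.
Arguments coordf {R n N} x v y.
Arguments ext_d1 {R n N} a x v w.
Arguments lie_der1 {R n N} X a x v.

Arguments TS {R n N} x.
Arguments vfield {R n} N.
Arguments form1 {R n} N.
Arguments form3 {R n} N.

(* A family of finite-dimensional vector spaces, together with the predicate
   [smooth_sec s x]: the section [s] is smooth on a neighbourhood of [x]. *)
Record bundle (R : realType) (n : nat) (N : manifold R n) := Bundle {
  fib :> N -> vectType R;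
  smooth_sec : (forall x, fib x) -> N -> Prop }.

Arguments smooth_sec {R n N b}.

Section Bundles.
Context {R : realType} {n : nat} {N : manifold R n}.

Definition sect (B : bundle N) : Type := forall x, B x.

Definition Gamma (B : bundle N) (s : sect B) : Prop :=
  forall x, smooth_sec s x.

Definition sec_frame (B : bundle N) (r : nat) (e : 'I_r -> sect B) (x : N)
    : r.-tuple (B x) := [tuple e i x | i < r].

(* Local triviality: around every point there is a frame such that a section
   is smooth if and only if its components in the frame are. *)
Definition is_vector_bundle (B : bundle N) : Prop :=
  forall x, exists (U : set N) (r : nat) (e : 'I_r -> sect B),
    [/\ open U, U x,
        forall y, U y -> basis_of {:B y} (sec_frame e y)
      & forall (s : sect B) y, U y ->
          smooth_sec s y <->
          forall i, smooth_at (fun z => coord (sec_frame e z) i (s z)) y].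

Definition is_subbundle (B : bundle N) (D : forall x, {vspace B x}) : Prop :=
  forall x, exists (U : set N) (r : nat) (e : 'I_r -> sect B),
    [/\ open U, U x,
        forall y, U y -> forall i, smooth_sec (e i) y
      & forall y, U y -> basis_of (D y) (sec_frame e y)].

Definition in_sub (B : bundle N) (D : forall x, {vspace B x}) (s : sect B)
    : Prop := forall x, s x \in D x.

Definition bundle_map (B C : bundle N) := forall x, 'Hom(B x, C x).

Definition map_sect (B C : bundle N) (F : bundle_map B C) (s : sect B)
    : sect C := fun x => F x (s x).

Definition bundle_map_smooth (B C : bundle N) (F : bundle_map B C) : Prop :=
  forall (s : sect B) x, smooth_sec s x -> smooth_sec (map_sect F s) x.

Definition tangent_bundle : bundle N :=
  @Bundle R n N TS vfield_smooth_at.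

Definition cotangent_bundle : bundle N :=
  @Bundle R n N (fun x => 'Hom(TS x, R^o)) form1_smooth_at.

Definition trivial_bundle (V : vectType R) : bundle N :=
  @Bundle R n N (fun=> V) (@smoothv_at R n N V).

Definition sum_bundle (B C : bundle N) : bundle N :=
  @Bundle R n N (fun x => (B x * C x)%type : vectType R)
    (fun s x => smooth_sec (b := B) (fun y => (s y).1) x /\
                smooth_sec (b := C) (fun y => (s y).2) x).

Definition subbundle (B : bundle N) (D : forall x, {vspace B x}) : bundle N :=
  @Bundle R n N (fun x => subvs_of (D x))
    (fun s x => smooth_sec (b := B) (fun y => vsval (s y)) x).

End Bundles.

Arguments tangent_bundle {R n} N.
Arguments cotangent_bundle {R n} N.
Arguments trivial_bundle {R n} N V.

(* The pullback g^* B: the smooth sections are locally the combinations, with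
   smooth coefficients, of pullbacks of smooth sections of B. *)
Definition pullback_bundle (R : realType) (m n : nat) (M : manifold R m)
    (N : manifold R n) (g : M -> N) (B : bundle N) : bundle M :=
  @Bundle R m M (fun q => B (g q))
    (fun s q => exists (r : nat) (e : 'I_r -> sect B) (c : 'I_r -> M -> R),
      [/\ forall i, smooth_sec (e i) (g q),
          forall i, smooth_at (c i) q
        & \forall p \near q, s p = \sum_(i < r) c i p *: e i (g p)]).

Record quadratic_lie_algebra (R : realType) := QuadraticLieAlgebra {
  qla :> vectType R;
  lbr : qla -> qla -> qla;
  ipair : qla -> qla -> R;
  lbr_linear : forall (c : R) x y z, lbr (c *: x + y) z = c *: lbr x z + lbr y z;
  lbr_alternating : forall x, lbr x x = 0;
  lbr_jacobi : forall x y z,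
    lbr x (lbr y z) + lbr y (lbr z x) + lbr z (lbr x y) = 0;
  ipair_linear : forall (c : R) x y z,
    ipair (c *: x + y) z = c * ipair x z + ipair y z;
  ipair_sym : forall x y, ipair x y = ipair y x;
  ipair_nondegenerate : forall x, (forall y, ipair x y = 0) -> x = 0;
  ipair_invariant : forall x y z,
    ipair (lbr x y) z + ipair y (lbr x z) = 0 }.

Arguments lbr {R q}.
Arguments ipair {R q}.

Section QuadraticLieAlgebras.
Context {R : realType}.

Section Opposite.
Variable k : quadratic_lie_algebra R.

Let opair (x y : k) : R := - ipair x y.

Fact opair_linear (c : R) x y z :
  opair (c *: x + y) z = c * opair x z + opair y z.
Proof. by rewrite /opair ipair_linear opprD mulrN. Qed.

Fact opair_sym x y : opair x y = opair y x.
Proof. by rewrite /opair ipair_sym. Qed.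

Fact opair_nondegenerate x : (forall y, opair x y = 0) -> x = 0.
Proof.
by move=> h; apply: ipair_nondegenerate => y; apply/eqP; rewrite -oppr_eq0; apply/eqP/h.
Qed.

Fact opair_invariant x y z : opair (lbr x y) z + opair y (lbr x z) = 0.
Proof. by rewrite /opair -opprD ipair_invariant oppr0. Qed.

Definition opposite : quadratic_lie_algebra R :=
  QuadraticLieAlgebra (@lbr_linear R k) (@lbr_alternating R k)
    (@lbr_jacobi R k) opair_linear opair_sym opair_nondegenerate
    opair_invariant.

End Opposite.

Section Product.
Variables k1 k2 : quadratic_lie_algebra R.

Let V : vectType R := (k1 * k2)%type.
Let pbr (x y : V) : V := (lbr x.1 y.1, lbr x.2 y.2).
Let ppair (x y : V) : R := ipair x.1 y.1 + ipair x.2 y.2.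

Fact ipair0r (k : quadratic_lie_algebra R) (x : k) : ipair x 0 = 0.
Proof.
rewrite ipair_sym; have := ipair_linear 1 0 0 x.
by rewrite scaler0 addr0 mul1r => /eqP; rewrite -subr_eq0 opprD addNKr oppr_eq0 => /eqP.
Qed.

Fact pbr_linear (c : R) x y z : pbr (c *: x + y) z = c *: pbr x z + pbr y z.
Proof. by rewrite /pbr /= !lbr_linear. Qed.

Fact pbr_alternating x : pbr x x = 0.
Proof. by rewrite /pbr !lbr_alternating. Qed.

Fact pbr_jacobi x y z :
  pbr x (pbr y z) + pbr y (pbr z x) + pbr z (pbr x y) = 0.
Proof.
have -> : pbr x (pbr y z) + pbr y (pbr z x) + pbr z (pbr x y) =
  (lbr x.1 (lbr y.1 z.1) + lbr y.1 (lbr z.1 x.1) + lbr z.1 (lbr x.1 y.1),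
   lbr x.2 (lbr y.2 z.2) + lbr y.2 (lbr z.2 x.2) + lbr z.2 (lbr x.2 y.2)) by [].
by rewrite !lbr_jacobi.
Qed.

Fact ppair_linear (c : R) x y z :
  ppair (c *: x + y) z = c * ppair x z + ppair y z.
Proof. by rewrite /ppair /= !ipair_linear mulrDr addrACA. Qed.

Fact ppair_sym x y : ppair x y = ppair y x.
Proof. by rewrite /ppair ipair_sym [ipair x.2 _]ipair_sym. Qed.

Fact ppair_nondegenerate x : (forall y, ppair x y = 0) -> x = 0.
Proof.
move=> h; rewrite [x]surjective_pairing; congr pair.
  by apply: ipair_nondegenerate => y; have := h (y, 0); rewrite /ppair ipair0r addr0.
by apply: ipair_nondegenerate => y; have := h (0, y); rewrite /ppair ipair0r add0r.
Qed.

Fact ppair_invariant x y z : ppair (pbr x y) z + ppair y (pbr x z) = 0.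
Proof. by rewrite /ppair /= addrACA !ipair_invariant addr0. Qed.

Definition qla_prod : quadratic_lie_algebra R :=
  QuadraticLieAlgebra pbr_linear pbr_alternating pbr_jacobi
    ppair_linear ppair_sym ppair_nondegenerate ppair_invariant.

End Product.

End QuadraticLieAlgebras.

(* [abr] is only meaningful on smooth sections. *)
Record algebroid_data (R : realType) (n : nat) (N : manifold R n) :=
  AlgebroidData {
    abundle :> bundle N;
    anchor : bundle_map abundle (tangent_bundle N);
    abr : sect abundle -> sect abundle -> sect abundle }.

Arguments anchor {R n N a}.
Arguments abr {R n N a}.

Section Algebroids.
Context {R : realType} {n : nat} {N : manifold R n}.

Definition is_lie_algebroid (A : algebroid_data N) : Prop :=
  is_vector_bundle A /\ bundle_map_smooth (@anchor R n N A) /\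
  (forall u v : sect A, Gamma u -> Gamma v -> Gamma (abr u v)) /\
  (forall (c : R) (u u' v : sect A), Gamma u -> Gamma u' -> Gamma v ->
     forall x, abr (fun y => c *: u y + u' y) v x
               = c *: abr u v x + abr u' v x) /\
  (forall u v : sect A, Gamma u -> Gamma v ->
     forall x, abr u v x = - abr v u x) /\
  (forall u v w : sect A, Gamma u -> Gamma v -> Gamma w ->
     forall x, abr u (abr v w) x + abr v (abr w u) x + abr w (abr u v) x = 0) /\
  (forall (f : N -> R) (u v : sect A), (forall x, smooth_at f x) ->
     Gamma u -> Gamma v ->
     forall x, abr u (fun y => f y *: v y) x
               = f x *: abr u v x + dd f x (anchor x (u x)) *: v x) /\
  (forall u v : sect A, Gamma u -> Gamma v ->
     forall x, anchor x (abr u v x)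
               = vfield_br (map_sect anchor u) (map_sect anchor v) x).

(* a morphism from A to the Lie algebra k, as a Lie algebroid over a point *)
Definition is_lie_morphism (A : algebroid_data N) (k : quadratic_lie_algebra R)
    (phi : bundle_map A (trivial_bundle N k)) : Prop :=
  bundle_map_smooth phi /\
  forall u v : sect A, Gamma u -> Gamma v -> forall x,
    phi x (abr u v x)
    = ddv (map_sect phi v) x (anchor x (u x))
      - ddv (map_sect phi u) x (anchor x (v x))
      + lbr (phi x (u x)) (phi x (v x)).

Definition is_lie_subalgebroid (A : algebroid_data N)
    (D : forall x, {vspace A x}) : Prop :=
  is_subbundle D /\
  forall u v : sect A, Gamma u -> Gamma v -> in_sub D u -> in_sub D v ->
    in_sub D (abr u v).

(* the algebroid structure induced on a Lie subalgebroid; [vsproj] only serves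
   to see a vector of [D x] as an element of the type [subvs_of (D x)] *)
Definition sub_algebroid (A : algebroid_data N) (D : forall x, {vspace A x})
    : algebroid_data N :=
  @AlgebroidData R n N (subbundle D)
    (fun x => linfun (fun u : subvs_of (D x) => anchor x (vsval u)))
    (fun u v x => vsproj (D x)
       (@abr R n N A (fun y => vsval (u y)) (fun y => vsval (v y)) x)).

End Algebroids.

Section LagrangianStructures.
Context {R : realType} {n : nat} {N : manifold R n}.
Variable k : quadratic_lie_algebra R.

(* The T^*N-component of the Courant bracket of X1 + a1 + w1 and X2 + a2 + w2:
   L_X1 a2 - i_X2 d a1 + i_X2 i_X1 eta + <d w1, w2>. *)
Definition courant_form (eta : form3 N) (X1 : vfield N) (a1 : form1 N)
    (w1 : N -> k) (X2 : vfield N) (a2 : form1 N) (w2 : N -> k) : form1 N :=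
  fun x => linfun (fun v : TS x =>
    lie_der1 X1 a2 x v - ext_d1 a1 x (X2 x) v + eta x (X1 x) (X2 x) v
    + ipair (ddv w1 x v) (w2 x) : R^o).

Definition courant_bundle : bundle N :=
  sum_bundle (sum_bundle (tangent_bundle N) (cotangent_bundle N))
    (trivial_bundle N k).

Definition courant_pair (x : N) (e1 e2 : courant_bundle x) : R :=
  (e1.1.2 e2.1.1 : R) + (e2.1.2 e1.1.1 : R) + ipair e1.2 e2.2.

Definition courant_br (eta : form3 N) (s1 s2 : sect courant_bundle)
    : sect courant_bundle :=
  let X1 : vfield N := fun y => (s1 y).1.1 in
  let X2 : vfield N := fun y => (s2 y).1.1 in
  let a1 : form1 N := fun y => (s1 y).1.2 in
  let a2 : form1 N := fun y => (s2 y).1.2 in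
  let w1 := fun y => (s1 y).2 in
  let w2 := fun y => (s2 y).2 in
  fun x => ((vfield_br X1 X2 x, courant_form eta X1 a1 w1 X2 a2 w2 x),
            ddv w2 x (X1 x) - ddv w1 x (X2 x) + lbr (w1 x) (w2 x)).

Definition is_dirac (eta : form3 N) (L : forall x, {vspace courant_bundle x})
    : Prop :=
  [/\ is_subbundle L,
      forall x (e : courant_bundle x),
        e \in L x <-> (forall e', e' \in L x -> courant_pair e e' = 0)
    & forall s1 s2 : sect courant_bundle, Gamma s1 -> Gamma s2 ->
        in_sub L s1 -> in_sub L s2 -> in_sub L (courant_br eta s1 s2)].

Section Structures.
Variables (A : algebroid_data N) (phi : bundle_map A (trivial_bundle N k)).
Variables (lambda : bundle_map A (cotangent_bundle N)) (eta : form3 N).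

Definition is_isotropic_structure : Prop :=
  [/\ bundle_map_smooth lambda,
      is_form3 eta,
      closed3 eta,
      forall u v : sect A, Gamma u -> Gamma v -> forall x,
        lambda x (abr u v x)
        = courant_form eta (map_sect anchor u) (map_sect lambda u)
            (map_sect phi u) (map_sect anchor v) (map_sect lambda v)
            (map_sect phi v) x
    & forall u v : sect A, Gamma u -> Gamma v -> forall x,
        - ipair (phi x (u x)) (phi x (v x))
        = (lambda x (v x) (anchor x (u x)) : R)
          + (lambda x (u x) (anchor x (v x)) : R)].

Definition courant_map (x : N) : 'Hom(A x, courant_bundle x) :=
  linfun (fun u : A x =>
    ((anchor x u, lambda x u), phi x u) : courant_bundle x).

Definition is_lagrangian_structure : Prop :=
  [/\ is_isotropic_structure,
      forall x, injective (courant_map x)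
    & is_dirac eta (fun x => limg (courant_map x))].

End Structures.

End LagrangianStructures.

Section ProductManifold.
Context {R : realType} {n1 n2 : nat}.

Lemma lsubmx_continuous : continuous (lsubmx : 'rV[R]_(n1 + n2) -> 'rV[R]_n1).
Proof.
move=> z A [P zP PA]; exists (fun (i : 'I_1) (j : 'I_(n1 + n2)) =>
  if fintype.split j is inl j' then P i j' else setT).
  move=> i j; case: splitP => [j' jj'|? _]; last exact: filterT.
  by have := zP i j'; rewrite mxE; congr nbhs; congr (z _ _); apply: val_inj.
move=> w wP; apply: PA => i j; have := wP i (lshift n2 j).
by rewrite mxE; have -> : fintype.split (lshift n2 j) = inl j by apply: (@unsplitK n1 n2 (inl j)).
Qed.

Lemma rsubmx_continuous : continuous (rsubmx : 'rV[R]_(n1 + n2) -> 'rV[R]_n2).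
Proof.
move=> z A [P zP PA]; exists (fun (i : 'I_1) (j : 'I_(n1 + n2)) =>
  if fintype.split j is inr j' then P i j' else setT).
  move=> i j; case: splitP => [? _|j' jj']; first exact: filterT.
  by have := zP i j'; rewrite mxE; congr nbhs; congr (z _ _); apply: val_inj.
move=> w wP; apply: PA => i j; have := wP i (rshift n1 j).
by rewrite mxE; have -> : fintype.split (rshift n1 j) = inr j by apply: (@unsplitK n1 n2 (inr j)).
Qed.

Lemma row_mx_continuous (T : topologicalType) (f : T -> 'rV[R]_n1)
    (g : T -> 'rV[R]_n2) (x : T) :
  {for x, continuous f} -> {for x, continuous g} ->
  {for x, continuous (fun y => row_mx (f y) (g y))}.
Proof.
move=> fx gx A [P xP PA].
have f' : nbhs (f x) [set w | forall i j, P i (lshift n2 j) (w i j)].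
  by exists (fun i j => P i (lshift n2 j)) => // i j; have := xP i (lshift n2 j);
    rewrite row_mxEl.
have g' : nbhs (g x) [set w | forall i j, P i (rshift n1 j) (w i j)].
  by exists (fun i j => P i (rshift n1 j)) => // i j; have := xP i (rshift n1 j);
    rewrite row_mxEr.
change (nbhs x [set y | A (row_mx (f y) (g y))]).
apply: (filterS _ (@filterI T (nbhs x) _ _ _ (fx _ f') (gx _ g'))).
move=> y [/= fy gy].
apply: PA => i j; rewrite -(splitK j); case: (fintype.split j) => j' /=.
  by rewrite row_mxEl.
by rewrite row_mxEr.
Qed.

Lemma Ck_proj (n m k : nat) (p : 'rV[R]_m -> 'rV[R]_n) (U : set 'rV[R]_m)
    (V : set 'rV[R]_n) (f : 'rV[R]_n -> R) :
  linear p -> continuous p -> (forall z, U z -> V (p z)) ->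
  Ck k V f -> Ck k U (f \o p).
Proof.
move=> lp cp UV; elim: k f => [|k IH] f [cf df]; (split;
  first by move=> z Uz; apply: continuous_comp; [exact: cp|exact/cf/UV]) => // v.
have E z : (fun h : R => h^-1 *: ((f \o p \o shift z) (h *: v) - (f \o p) z))
         = (fun h : R => h^-1 *: ((f \o shift (p z)) (h *: p v) - f (p z))).
  by apply/funext => h /=; rewrite lp.
have [dv Cv] := df (p v); split.
  by move=> z Uz; rewrite /derivable E; exact/dv/UV.
have -> : 'D_v (f \o p) = 'D_(p v) f \o p.
  by apply/funext => z; rewrite /derive E.
exact: IH.
Qed.

Lemma Ck_ext (n k : nat) (U : set 'rV[R]_n) (f g : 'rV[R]_n -> R) :
  f = g -> Ck k U f -> Ck k U g.
Proof. by move=> ->. Qed.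

Variables (N1 : manifold R n1) (N2 : manifold R n2).

Let pdom (p : N1 * N2) : set (N1 * N2) := dom p.1 `*` dom p.2.
Let pchart (p q : N1 * N2) : 'rV[R]_(n1 + n2) :=
  row_mx (chart p.1 q.1) (chart p.2 q.2).
Let pchinv (p : N1 * N2) (z : 'rV[R]_(n1 + n2)) : N1 * N2 :=
  (chinv p.1 (lsubmx z), chinv p.2 (rsubmx z)).

Fact prod_hausdorff : hausdorff_space (N1 * N2)%type.
Proof.
move=> [x1 x2] [y1 y2] cl; congr pair.
- apply: manifold_hausdorff => A B xA yB.
  have [[z1 z2] [/= Az Bz]] := cl (fst @^-1` A) (fst @^-1` B)
    (cvg_fst xA) (cvg_fst yB).
  by exists z1.
- apply: manifold_hausdorff => A B xA yB.
  have [[z1 z2] [/= Az Bz]] := cl (snd @^-1` A) (snd @^-1` B)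
    (cvg_snd xA) (cvg_snd yB).
  by exists z2.
Qed.

Fact prod_second_countable : @second_countable (N1 * N2)%type.
Proof.
have [B1 cB1 [oB1 bB1]] := @manifold_second_countable _ _ N1.
have [B2 cB2 [oB2 bB2]] := @manifold_second_countable _ _ N2.
exists [set A.1 `*` A.2 | A in B1 `*` B2].
  apply: (card_le_trans (card_image_le _ _)).
  exact: countableX.
split=> [_ [[A1 A2] [/= /oB1 oA1 /oB2 oA2] <-]|].
  rewrite openE => -[z1 z2] [/= A1z A2z]; rewrite /interior.
  by exists (A1, A2) => //; split; apply: open_nbhs_nbhs.
move=> [x1 x2] A [[A1 A2] [/= xA1 xA2] AA].
have [C1 [B1C1 C1x] C1A] := bB1 x1 A1 xA1.
have [C2 [B2C2 C2x] C2A] := bB2 x2 A2 xA2.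
exists (C1 `*` C2); first by split => //; exists (C1, C2).
by move=> [z1 z2] [/= /C1A ? /C2A ?]; apply: AA.
Qed.

Fact pdom_open p : open (pdom p).
Proof.
rewrite openE => -[z1 z2] [/= d1 d2]; exists (dom p.1, dom p.2) => //.
by split; apply: open_nbhs_nbhs; split => //; exact: dom_open.
Qed.

Fact pdom_refl p : pdom p p.
Proof. by split; exact: dom_refl. Qed.

Fact pchart_image p (D1 : set N1) (D2 : set N2) :
  pchart p @` (D1 `*` D2) =
  (lsubmx @^-1` (chart p.1 @` D1)) `&` (rsubmx @^-1` (chart p.2 @` D2)).
Proof.
apply/seteqP; split=> [_ [[q1 q2] [/= d1 d2] <-]|z [[q1 d1 e1] [q2 d2 e2]]].
  by split => /=; rewrite ?row_mxKl ?row_mxKr; [exists q1|exists q2].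
by exists (q1, q2) => //; rewrite /pchart /= e1 e2 hsubmxK.
Qed.

Fact pchart_open p : open (pchart p @` pdom p).
Proof.
rewrite pchart_image; apply: openI; apply: open_comp; try exact: chart_open.
  by move=> z _; exact: lsubmx_continuous.
by move=> z _; exact: rsubmx_continuous.
Qed.

Fact pchartK p q : pdom p q -> pchinv p (pchart p q) = q.
Proof.
case: q => q1 q2 [/= d1 d2]; rewrite /pchinv /pchart row_mxKl row_mxKr /=.
by rewrite !chartK.
Qed.

Fact pchart_continuous p q : pdom p q -> {for q, continuous (pchart p)}.
Proof.
case: q => q1 q2 [/= d1 d2].
apply: row_mx_continuous; apply: (@continuous_comp _ _ _ _ (chart _)) => /=.
- exact: cvg_fst.
- exact: chart_continuous.
- exact: cvg_snd.
- exact: chart_continuous.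
Qed.

Fact pchinv_continuous p z : (pchart p @` pdom p) z ->
  {for z, continuous (pchinv p)}.
Proof.
rewrite pchart_image => -[/= z1 z2].
have c1 : {for z, continuous (chinv p.1 \o lsubmx)}.
  by apply: continuous_comp; [exact: lsubmx_continuous|exact: chinv_continuous].
have c2 : {for z, continuous (chinv p.2 \o rsubmx)}.
  by apply: continuous_comp; [exact: rsubmx_continuous|exact: chinv_continuous].
exact: (@cvg_pair _ _ _ (nbhs z) (nbhs _) (nbhs _) _ _ _ _ _ c1 c2).
Qed.

Fact pchart_compatible p q i :
  smooth_on (pchart p @` (pdom p `&` pdom q))
    (fun z => pchart q (pchinv p z) ord0 i).
Proof.
have -> : pdom p `&` pdom q =
    (dom p.1 `&` dom q.1) `*` (dom p.2 `&` dom q.2).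
  by apply/seteqP; split=> [[x y] [[? ?] [? ?]]|[x y] [[? ?] [? ?]]].
rewrite pchart_image => k; rewrite -(splitK i); case: (fintype.split i) => j /=.
  apply: (@Ck_ext _ _ _
    ((fun z => chart q.1 (chinv p.1 z) ord0 j) \o lsubmx)).
    by apply/funext => z; rewrite /pchart row_mxEl.
  apply: (@Ck_proj _ _ _ _ _ (chart p.1 @` (dom p.1 `&` dom q.1))).
  - exact: linearP.
  - exact: lsubmx_continuous.
  - by move=> z [].
  - exact: chart_compatible.
apply: (@Ck_ext _ _ _
  ((fun z => chart q.2 (chinv p.2 z) ord0 j) \o rsubmx)).
  by apply/funext => z; rewrite /pchart row_mxEr.
apply: (@Ck_proj _ _ _ _ _ (chart p.2 @` (dom p.2 `&` dom q.2))).
- exact: linearP.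
- exact: rsubmx_continuous.
- by move=> z [].
- exact: chart_compatible.
Qed.

Definition prod_manifold : manifold R (n1 + n2) :=
  Manifold prod_hausdorff prod_second_countable pdom_open pdom_refl
    pchart_open pchartK pchart_continuous pchinv_continuous pchart_compatible.

End ProductManifold.

Section ProductAlgebroids.
Context {R : realType} {n1 n2 : nat}.
Context {N1 : manifold R n1} {N2 : manifold R n2}.

Local Notation N := (prod_manifold N1 N2).

(* T_p (N1 x N2) = T_p.1 N1 x T_p.2 N2: the chart indexed by p is the product
   of the charts indexed by p.1 and p.2, hence these are the differentials of
   the two projections. *)
Definition dpr1 (p : N) : 'Hom(TS p, TS p.1) :=
  linfun (lsubmx : 'rV[R]_(n1 + n2) -> 'rV[R]_n1).

Definition dpr2 (p : N) : 'Hom(TS p, TS p.2) :=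
  linfun (rsubmx : 'rV[R]_(n1 + n2) -> 'rV[R]_n2).

Definition form3_sum (h1 : form3 N1) (h2 : form3 N2) : form3 N :=
  fun p u v w => h1 p.1 (dpr1 p u) (dpr1 p v) (dpr1 p w)
                 + h2 p.2 (dpr2 p u) (dpr2 p v) (dpr2 p w).

Definition prod_bundle (B1 : bundle N1) (B2 : bundle N2) : bundle N :=
  sum_bundle (@pullback_bundle R _ _ N N1 (fun p => p.1) B1)
             (@pullback_bundle R _ _ N N2 (fun p => p.2) B2).

Variables (A1 : algebroid_data N1) (A2 : algebroid_data N2).

Definition prod_anchor :
    bundle_map (prod_bundle A1 A2) (tangent_bundle N) := fun p =>
  linfun (fun e : prod_bundle A1 A2 p =>
    row_mx (anchor p.1 e.1 : 'rV[R]_n1) (anchor p.2 e.2 : 'rV[R]_n2)).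

(* The bracket of the product Lie algebroid. The first component of a section
   of A1 x A2 is a family, parametrized by N2, of sections of A1, and likewise
   for the second one: take the bracket of A1 for each value of the parameter
   y, and differentiate the dependence on y in the fixed vector space A1 x
   along the anchor of the other component. This is the only bracket obeying
   the Leibniz rule which extends the brackets of A1 and A2 on sections pulled
   back along the projections, and for which sections pulled back from A1
   commute with sections pulled back from A2. *)
Definition prod_br (s t : sect (prod_bundle A1 A2)) :
    sect (prod_bundle A1 A2) := fun p =>
  (abr (fun x => (s (x, p.2)).1 : A1 x) (fun x => (t (x, p.2)).1 : A1 x) p.1
   + ddv (fun y => (t (p.1, y)).1 : A1 p.1) p.2 (anchor p.2 (s p).2)
   - ddv (fun y => (s (p.1, y)).1 : A1 p.1) p.2 (anchor p.2 (t p).2),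
   abr (fun y => (s (p.1, y)).2 : A2 y) (fun y => (t (p.1, y)).2 : A2 y) p.2
   + ddv (fun x => (t (x, p.2)).2 : A2 p.2) p.1 (anchor p.1 (s p).1)
   - ddv (fun x => (s (x, p.2)).2 : A2 p.2) p.1 (anchor p.1 (t p).1)).

Definition prod_algebroid : algebroid_data N :=
  @AlgebroidData R _ N (prod_bundle A1 A2) prod_anchor prod_br.

Variable k : quadratic_lie_algebra R.
Variables (phi : bundle_map A1 (trivial_bundle N1 k))
  (psi : bundle_map A2 (trivial_bundle N2 k)).

Definition diff_map (p : N) : 'Hom(prod_algebroid p, k) :=
  linfun (fun e : prod_algebroid p => phi p.1 e.1 - psi p.2 e.2 : k).

Definition fibre_prod (p : N) : {vspace prod_algebroid p} := lker (diff_map p).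

Definition fibre_prod_algebroid : algebroid_data N :=
  sub_algebroid (A := prod_algebroid) fibre_prod.

Definition fibre_prod_map (k1 k2 : quadratic_lie_algebra R)
    (phi1 : bundle_map A1 (trivial_bundle N1 k1))
    (psi2 : bundle_map A2 (trivial_bundle N2 k2)) :
    bundle_map fibre_prod_algebroid (trivial_bundle N (qla_prod k1 k2)) :=
  fun p => linfun (fun e : subvs_of (fibre_prod p) =>
    (phi1 p.1 (vsval e).1, psi2 p.2 (vsval e).2) : qla_prod k1 k2).

Definition fibre_prod_form (lambda1 : bundle_map A1 (cotangent_bundle N1))
    (lambda2 : bundle_map A2 (cotangent_bundle N2)) :
    bundle_map fibre_prod_algebroid (cotangent_bundle N) :=
  fun p => linfun (fun e : subvs_of (fibre_prod p) =>
    ((lambda1 p.1 (vsval e).1 : 'Hom(TS p.1, R^o)) \o dpr1 p)%VF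
    + ((lambda2 p.2 (vsval e).2 : 'Hom(TS p.2, R^o)) \o dpr2 p)%VF).

End ProductAlgebroids.

Definition pair_map (R : realType) (n : nat) (N : manifold R n) (A : bundle N)
    (k1 k2 : quadratic_lie_algebra R) (f : bundle_map A (trivial_bundle N k1))
    (g : bundle_map A (trivial_bundle N k2)) :
    bundle_map A (trivial_bundle N (qla_prod k1 k2)) :=
  fun x => linfun (fun u : A x => (f x u, g x u) : qla_prod k1 k2).

(* Main.v *)
(* The image of the map (anchor, lambda, Phi) of the fibre product is isotropic
   because on the fibre product the two k-components agree while k and its
   opposite carry opposite pairings, so that the two isotropy relations add up.
   For maximality, a vector (X, al, w) orthogonal to the image defines the linear
   functional (u, v) |-> al(a(u, v)) + <lambda(u, v), X> + <w, (phi1 u, psi2 v)> on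
   the fibres of A1 x A2, which vanishes on the kernel of the surjection
   (u, v) |-> phi u - psi v, hence is the pairing of that difference with some
   kap in k.  Then (X1, al1, (w1, - kap)) and (X2, al2, (w2, - kap)) are orthogonal
   to the two given lagrangian images, hence lie in them, and their preimages form
   an element of the fibre product.  Injectivity is the same argument with zero
   data.  The bracket condition on the form follows by adding up those of the two
   factors, the derivatives in the direction of the other factor being handled by
   pointwise isotropy.  That the product and the fibre product are Lie algebroids
   is checked on local spanning families of sections, pulled back from the factors
   and cut off by bump functions. *)

Require Import Defs.
From HB Require Import structures.
From mathcomp Require Import all_boot all_order all_algebra.
From mathcomp Require Import all_classical all_reals all_analysis.
From mathcomp Require Import ring lra.

Set Implicit Arguments.
Unset Strict Implicit.
Unset Printing Implicit Defensive.

Import Order.TTheory GRing.Theory Num.Theory.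
Import numFieldNormedType.Exports.

Local Open Scope classical_set_scope.
Local Open Scope ring_scope.

Arguments TS {R n N} x.
Arguments dd {R n N} f x v.
Arguments ddv {R n N V} f x v.
Arguments coordf {R n N} x v y.
Arguments ext_d1 {R n N} a x v w.
Arguments lie_der1 {R n N} X a x v.
Arguments tangent_bundle {R n} N.
Arguments cotangent_bundle {R n} N.
Arguments trivial_bundle {R n} N V.
Arguments lbr {R q}.
Arguments ipair {R q}.
#[local] Hint Resolve dom_refl : core.

(** * Smooth functions on R^n *)

(** Smoothness is given by iterated directional derivatives only, so total differentiability, the
    chain rule and the symmetry of second derivatives must first be drawn from the continuity of the
    directional ones. Moreover T_x N is read in the chart indexed by x, so the identification with
    R^n changes with the point; before [dd f y (X y)] is differentiated in y, it is moved to one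
    fixed chart. Finally [abr] takes global sections and its Leibniz rule global functions, so a
    bracket cannot simply be computed in a local frame: frames are multiplied by bump functions, and
    conclusions at x are recovered by dividing by a function that is nonzero at x. The orthogonality
    argument is pointwise. It yields a Dirac structure because the map into the Courant bundle is
    smooth and injective: smooth sections of its image lift to smooth sections of the fibre product,
    and closure under the Courant bracket becomes the compatibility of the anchor, the form and the
    morphism with the bracket of the fibre product. *)

Lemma near_eq_continuous (S T : topologicalType) (f g : S -> T) z : {near z, f =1 g} ->
  {for z, continuous f} -> {for z, continuous g}.
Proof.
move=> e cf; have fz : f x @[x --> z] --> f z := cf.
suff : g x @[x --> z] --> g z by [].
rewrite -(nbhs_singleton e); apply: cvg_trans fz; exact: (near_eq_cvg e).
Qed.

Section CkClosure.
Context {R : realType} {n : nat}.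
Implicit Types (U W : set 'rV[R]_n) (f g : 'rV[R]_n -> R) (v z : 'rV[R]_n).

Lemma CkW k U f : Ck k.+1 U f -> Ck k U f.
Proof.
elim: k f => [|k IH] f [cf df]; split=> // v.
by have [dv /IH Cv] := df v; split.
Qed.

Lemma Ck_sub k U W f : W `<=` U -> Ck k U f -> Ck k W f.
Proof.
move=> WU; elim: k f => [|k IH] f [cf df]; split.
- by move=> z /WU; exact: cf.
- by [].
- by move=> z /WU; exact: cf.
- move=> v; have [dv /IH Cv] := df v; split => // z /WU; exact: dv.
Qed.

Lemma open_near_eq U f g z : open U -> U z -> (forall w, U w -> f w = g w) ->
  {near z, f =1 g}.
Proof. by move=> oU Uz fg; near do apply: fg; exact: open_nbhs_nbhs.
Unshelve. all: by end_near. Qed.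

Lemma Ck_congr k U f g : open U -> (forall z, U z -> f z = g z) ->
  Ck k U f -> Ck k U g.
Proof.
move=> oU; elim: k f g => [|k IH] f g fg [cf df].
- by split=> // z Uz; apply: near_eq_continuous (cf z Uz); exact: open_near_eq oU Uz fg.
- split=> [z Uz|v].
    by apply: near_eq_continuous (cf z Uz); exact: open_near_eq oU Uz fg.
  have [dv Cv] := df v; split.
    move=> z Uz; exact: near_eq_derivable (open_near_eq oU Uz fg) (dv z Uz).
  apply: IH Cv => z Uz; apply: near_eq_derive; exact: (open_near_eq oU Uz fg).
Qed.

Lemma Ck_cst k U (c : R) : Ck k U (cst c).
Proof.
elim: k c => [|k IH] c; split=> //; try (by move=> z _; exact: cst_continuous).
move=> v.
split=> [z _|]; first exact: derivable_cst.
by rewrite (_ : 'D_v (cst c) = cst 0) //; apply/funext => z; rewrite derive_cst.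
Qed.

Lemma CkD k U f g : open U -> Ck k U f -> Ck k U g -> Ck k U (fun z => f z + g z).
Proof.
move=> oU; elim: k f g => [|k IH] f g [cf df] [cg dg].
  by split=> // z Uz; apply: continuousD; [exact: cf|exact: cg].
split=> [z Uz|v]; first by apply: continuousD; [exact: cf|exact: cg].
have [fv Cf] := df v; have [gv Cg] := dg v; split.
  by move=> z Uz; apply: derivableD; [exact: fv|exact: gv].
apply: Ck_congr (IH _ _ Cf Cg) => // z Uz.
by rewrite -(deriveD (fv z Uz) (gv z Uz)).
Qed.

Lemma CkM k U f g : open U -> Ck k U f -> Ck k U g -> Ck k U (fun z => f z * g z).
Proof.
move=> oU; elim: k f g => [|k IH] f g Cf Cg.
  by split=> // z Uz; apply: continuousM; [exact: Cf.1|exact: Cg.1].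
have [cf df] := Cf; have [cg dg] := Cg.
split=> [z Uz|v]; first by apply: continuousM; [exact: cf|exact: cg].
have [fv Cfv] := df v; have [gv Cgv] := dg v; split.
  by move=> z Uz; apply: derivableM; [exact: fv|exact: gv].
(* The derivative of the product still contains [f] and [g] themselves; [CkW] lowers them to the
   order of the induction hypothesis. *)
apply: Ck_congr (CkD oU (IH _ _ (CkW Cf) Cgv) (IH _ _ (CkW Cg) Cfv)) => // z Uz.
by rewrite -[LHS]/(_ *: _ + _ *: _) -(deriveM (fv z Uz) (gv z Uz)).
Qed.

Lemma CkV k U f : open U -> (forall z, U z -> f z != 0) -> Ck k U f ->
  Ck k U (fun z => (f z)^-1).
Proof.
move=> oU f0; elim: k => [|k IH] Cf.
  by split=> // z Uz; apply: continuousV; [exact: f0|exact: Cf.1].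
have [cf df] := Cf; have CV := IH (CkW Cf).
split=> [z Uz|v]; first by apply: continuousV; [exact: f0|exact: cf].
have [fv Cfv] := df v; split.
  by move=> z Uz; apply: derivableV; [exact: f0|exact: fv].
(* The derivative is [- f^-2] times that of [f], and [f^-1] is of order [k] by induction. *)
apply: Ck_congr (CkM oU (Ck_cst k U (-1)) (CkM oU (CkM oU CV CV) Cfv)) => // z Uz.
rewrite [RHS](deriveV (f0 z Uz) (fv z Uz)) /= mulN1r /GRing.scale /= mulNr.
by rewrite -expr2 exprVn exprnN.
Qed.

Lemma Ck_sum (I : Type) (r : seq I) (P : pred I) k U (F : I -> 'rV[R]_n -> R) :
  open U -> (forall i, P i -> Ck k U (F i)) ->
  Ck k U (fun z => \sum_(i <- r | P i) F i z).
Proof.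
move=> oU CF; elim: r => [|i r IH].
  by apply: (Ck_ext _ (Ck_cst k U 0)); apply/funext => z; rewrite big_nil.
case Pi: (P i); last first.
  by apply: (Ck_ext _ IH); apply/funext => z; rewrite big_cons Pi.
apply: (Ck_ext _ (CkD oU (CF i Pi) IH)).
by apply/funext => z; rewrite big_cons Pi.
Qed.

Lemma is_derive_coord i (z v : 'rV[R]_n) :
  is_derive z v (fun w : 'rV[R]_n => w ord0 i) (v ord0 i).
Proof.
apply: DeriveDef; first by apply/diff_derivable/differentiable_coord.
rewrite deriveE; last exact: differentiable_coord.
have lin : linear (fun z : 'rV[R]_n => (z ord0 i : R^o)).
  by move=> a x y; rewrite !mxE.
pose F : {linear 'rV[R]_n -> R^o} := HB.pack (fun z : 'rV[R]_n => (z ord0 i : R^o))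
   (GRing.isLinear.Build _ _ _ _ _ lin).
by rewrite -[X in 'd X z](_ : (F : _ -> _) = _) // diff_lin //; exact: coord_continuous.
Qed.

Lemma Ck_coord k U i : Ck k U (fun z => z ord0 i).
Proof.
case: k => [|k]; split=> //; try (by move=> z _; exact: coord_continuous).
move=> v.
split=> [z _|]; first by have [] := is_derive_coord i z v.
rewrite (_ : 'D_v _ = cst (v ord0 i)); first exact: Ck_cst.
by apply/funext => z; have [] := is_derive_coord i z v.
Qed.

End CkClosure.

Lemma linfun_lin (R : nzRingType) (V W : vectType R) (f : V -> W) :
  linear f -> linfun f =1 f.
Proof.
move=> lf; pose F : {linear V -> W} := HB.pack f (GRing.isLinear.Build _ _ _ _ _ lf).
exact: (lfunE F).
Qed.

(** * Total differentiability, the chain rule and the symmetry of second derivatives *)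

Section Differentiability.
Context {R : realType}.

Lemma is_derive_line n (f : 'rV[R]_n -> R) z v (t : R) : derivable f (z + t *: v) v ->
  is_derive t 1 (fun s => f (z + s *: v)) ('D_v f (z + t *: v)).
Proof.
move=> df.
have E : (fun h : R => h^-1 *: (f (z + (h *: 1 + t) *: v) - f (z + t *: v))) =
         (fun h : R => h^-1 *: (f (h *: v + (z + t *: v)) - f (z + t *: v))).
  apply/funext => h; congr (_ *: (f _ - _)).
  by rewrite [h *: 1]mulr1 scalerDl addrCA.
by apply: DeriveDef; rewrite /derivable /derive /= E.
Qed.

(** The restriction to the line is a function of one variable with derivative ['D_v f]. A negative
    [t] is handled on [[t, 0]], because the increments used later are coordinates of arbitrary
    sign. *)
Lemma line_MVT n (f : 'rV[R]_n -> R) z v (t : R) :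
  (forall s : R, `|s| <= `|t| -> derivable f (z + s *: v) v) ->
  exists2 s : R, `|s| <= `|t| & f (z + t *: v) - f z = t * 'D_v f (z + s *: v).
Proof.
move=> df; pose phi (s : R) := f (z + s *: v).
have D (s : R) : `|s| <= `|t| -> is_derive s 1 phi ('D_v f (z + s *: v)).
  by move=> /df; exact: is_derive_line.
have [t0|t0] := leP 0 t.
  have It s : s \in `[0, t] -> `|s| <= `|t|.
    by rewrite in_itv /= => /andP[s0 st]; rewrite !ger0_norm.
  have [|||s sI E] := @MVT_segment R phi (fun s => 'D_v f (z + s *: v)) 0 t.
  - exact: t0.
  - by move=> s /subset_itv_oo_cc /It; exact: D.
  - by apply: derivable_within_continuous => s /It /D [].
  exists s; first exact: It.
  by move: E; rewrite /phi scale0r addr0 subr0 mulrC.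
have It s : s \in `[t, 0] -> `|s| <= `|t|.
  by rewrite in_itv /= => /andP[st s0]; rewrite !ler0_norm ?lerN2 // ltW.
have [|||s sI E] := @MVT_segment R phi (fun s => 'D_v f (z + s *: v)) t 0.
- exact: ltW.
- by move=> s /subset_itv_oo_cc /It; exact: D.
- by apply: derivable_within_continuous => s /It /D [].
exists s; first exact: It.
move: E; rewrite /phi scale0r addr0 sub0r mulrN => /(congr1 -%R).
by rewrite opprB opprK mulrC.
Qed.

Lemma open_ball_sub n (U : set 'rV[R]_n) z : open U -> U z ->
  exists2 r : R, 0 < r & forall w, `|w| < r -> U (z + w).
Proof.
move=> oU Uz; have /nbhs_normP[r /= r0 rU] := open_nbhs_nbhs (conj oU Uz).
by exists r => // w wr; apply: rU; rewrite /= opprD addNKr normrN.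
Qed.

Lemma continuous_ball n (f : 'rV[R]_n -> R) z (e : R) : 0 < e ->
  {for z, continuous f} ->
  exists2 r : R, 0 < r & forall w, `|w| < r -> `|f (z + w) - f z| < e.
Proof.
move=> e0 /cvgrPdist_lt/(_ e e0) /nbhs_normP[r /= r0 rU].
exists r => // w wr; rewrite distrC; apply: rU.
by rewrite /= opprD addNKr normrN.
Qed.

(** The increments are made one direction at a time: the last one costs a mean value of ['D_(v m) f]
    at a nearby point, which continuity brings within [e] of the value at [z]. Indexing by [nat]
    keeps ordinals out of the induction on [m]. *)
Lemma C1_expansion n (U : set 'rV[R]_n) (f : 'rV[R]_n -> R) z
    (v : nat -> 'rV[R]_n) m (e : R) :
  open U -> U z -> Ck 1 U f -> 0 < e ->
  exists2 d : R, 0 < d & forall t : nat -> R, (forall i, (i < m)%N -> `|t i| < d) ->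
    `|f (z + \sum_(i < m) t i *: v i) - f z - \sum_(i < m) t i * 'D_(v i) f z|
      <= e * \sum_(i < m) `|t i|.
Proof.
move=> oU Uz [_ df] e0; elim: m => [|m [d1 d10 IH]].
  exists 1 => // t _; rewrite !big_ord0 addr0 !subrr normr0 mulr0 //.
have [dm [cm _]] := df (v m).
have [r1 r10 r1U] := open_ball_sub oU Uz.
have [r2 r20 r2e] := continuous_ball e0 (cm z Uz).
(* When every [|t i|] is below [r / M], the whole broken path stays within [r] of [z]; the summand 1
   makes [M] positive and the estimate strict. *)
pose M := 1 + \sum_(i < m.+1) `|v i|.
have M0 : 0 < M by rewrite ltr_pwDl // sumr_ge0.
pose r := Num.min r1 r2.
have r0 : 0 < r by rewrite lt_min r10.
exists (Num.min d1 (r / M)); first by rewrite lt_min d10 divr_gt0.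
move=> t td.
have tr s : `|s| <= `|t m| -> `|\sum_(i < m) t i *: v i + s *: v m| < r.
  move=> st; apply: (@le_lt_trans _ _ (\sum_(i < m.+1) (r / M) * `|v i|)).
    rewrite big_ord_recr /=; apply: le_trans (ler_normD _ _) _; apply: lerD.
      apply: le_trans (ler_norm_sum _ _ _) _; apply: ler_sum => i _.
      rewrite normrZ ler_wpM2r //; apply: ltW.
      by have := td i (ltn_trans (ltn_ord i) (ltnSn m)); rewrite lt_min => /andP[].
    rewrite normrZ ler_wpM2r //; apply: le_trans st _; apply: ltW.
    by have := td m (ltnSn m); rewrite lt_min => /andP[].
  rewrite -mulr_sumr mulrAC ltr_pdivrMr // ltr_pM2l //.
  by rewrite /M ltr_pwDl.
rewrite !big_ord_recr /=.
set S := \sum_(i < m) t i *: v i; set D := \sum_(i < m) t i * _.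
have [s|s st Es] := @line_MVT n f (z + S) (v m) (t m).
  move=> st; apply: dm; rewrite -addrA; apply: r1U.
  by have := tr s st; rewrite lt_min => /andP[].
have Hs : `|'D_(v m) f (z + S + s *: v m) - 'D_(v m) f z| < e.
  by rewrite -addrA; apply: r2e; have := tr s st; rewrite lt_min => /andP[].
have H1 : `|f (z + S) - f z - D| <= e * \sum_(i < m) `|t i|.
  apply: IH => i im; have := td i (ltn_trans im (ltnSn m)).
  by rewrite lt_min => /andP[].
rewrite addrA.
have -> : f (z + S + t m *: v m) - f z - (D + t m * 'D_(v m) f z) =
  (f (z + S) - f z - D) + t m * ('D_(v m) f (z + S + s *: v m) - 'D_(v m) f z).
  rewrite mulrBr -Es; ring.
apply: le_trans (ler_normD _ _) _; rewrite [leRHS]mulrDr; apply: lerD => //.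
by rewrite normrM mulrC ler_wpM2r // ltW.
Qed.

Lemma sum_delta_mx n (h : 'rV[R]_n) : \sum_(i < n) h ord0 i *: delta_mx ord0 i = h.
Proof. by rewrite [RHS]row_sum_delta; apply: eq_bigr. Qed.

Lemma norm_coord_le n (h : 'rV[R]_n) i : `|h ord0 i| <= `|h|.
Proof.
rewrite [leRHS]/Num.Def.normr /= mx_normrE.
exact: (le_bigmax _ (fun ij : 'I_1 * 'I_n => `|h ij.1 ij.2|) (ord0, i)).
Qed.

Let total_diff n (f : 'rV[R]_n -> R) z (h : 'rV[R]_n) : R^o :=
  \sum_(i < n) h ord0 i * 'D_(delta_mx ord0 i) f z.

(** Turns an epsilon-delta estimate into the little-o definition of the differential, whose
    uniqueness then identifies it with [L]. *)
Lemma is_diff_eps (V W : normedModType R) (f : V -> W) (L : {linear V -> W}) z :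
  continuous L ->
  (forall e : R, 0 < e -> exists2 d : R, 0 < d & forall h : V, `|h| < d ->
     `|f (h + z) - (f z + L h)| <= e * `|h|) ->
  differentiable f z /\ ('d f z : _ -> _) = L.
Proof.
move=> cL H.
have D : f \o shift z = cst (f z) + L +o_ (0 : V) id.
  apply/eqaddoP => e e0; have [d d0 Hd] := H e e0.
  by near=> h; apply: Hd; near: h; exact: nbhs0_lt.
have E : ('d f z : _ -> _) = L by apply: diff_unique.
by split=> //; apply/diff_locallyP; rewrite E.
Unshelve. all: by end_near. Qed.

Lemma C1_is_diff n (U : set 'rV[R]_n) (f : 'rV[R]_n -> R) z :
  open U -> U z -> Ck 1 U f ->
  differentiable f z /\ ('d f z : _ -> _) = total_diff f z.
Proof.
move=> oU Uz Cf.
have lin : linear (total_diff f z).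
  move=> a x y; rewrite /total_diff scaler_sumr -big_split /=; apply: eq_bigr => i _.
  by rewrite !mxE mulrDl -mulrA.
pose L : {linear 'rV[R]_n -> R^o} :=
  HB.pack (total_diff f z) (GRing.isLinear.Build _ _ _ _ _ lin).
have cL : continuous L.
  move=> w.
  have : Ck 0 setT (fun h : 'rV[R]_n => \sum_(i < n) h ord0 i * 'D_(delta_mx ord0 i) f z).
    apply: Ck_sum; first exact: openT.
    move=> i _; apply: CkM; [exact: openT|exact: Ck_coord|exact: Ck_cst].
  by case=> /(_ w I).
apply: (@is_diff_eps _ _ (f : _ -> R^o) L z cL) => e e0.
  (* A sum of [n] coordinates is at most [n] times the sup norm; [n + 1] also covers [n = 0]. *)
  pose e' := e / (n%:R + 1).
  have n0 : 0 < n%:R + 1 :> R by rewrite ltr_wpDl.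
  have e'0 : 0 < e' by rewrite divr_gt0.
  pose v (i : nat) : 'rV[R]_n := \row_j ((j == i :> nat)%:R).
  have vE (i : 'I_n) : v i = delta_mx ord0 i.
    by apply/rowP => j; rewrite !mxE eqxx.
  have [d d0 Hd] := @C1_expansion n U f z v n e' oU Uz Cf e'0.
  exists d => // h hd.
  pose t (i : nat) : R := if insub i is Some j then h ord0 j else 0.
  have tE (i : 'I_n) : t i = h ord0 i by rewrite /t valK.
  have := Hd t; have -> : \sum_(i < n) t i *: v i = h.
    by rewrite -[RHS]sum_delta_mx; apply: eq_bigr => i _; rewrite tE vE.
  have -> : \sum_(i < n) t i * 'D_(v i) f z = total_diff f z h.
    by apply: eq_bigr => i _; rewrite tE vE.
  move=> Hh; apply: (@le_trans _ _ (e' * \sum_(i < n) `|t i|)).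
    rewrite -[X in `|X|]/(f (h + z) - (f z + total_diff f z h)).
    rewrite opprD addrA [h + z]addrC; apply: Hh => i lin'.
    by rewrite (tE (Ordinal lin')); apply: le_lt_trans hd; exact: norm_coord_le.
  rewrite /e' -mulrA ler_wpM2l ?(ltW e0) // mulrC ler_pdivrMr //.
  apply: (@le_trans _ _ (\sum_(i < n) `|h|)).
    by apply: ler_sum => i _; rewrite tE; exact: norm_coord_le.
  by rewrite sumr_const card_ord mulrDr mulr1 mulr_natr lerDl.
Qed.

Lemma C1_differentiable n (U : set 'rV[R]_n) (f : 'rV[R]_n -> R) z :
  open U -> U z -> Ck 1 U f -> differentiable f z.
Proof. by move=> oU Uz Cf; have [] := C1_is_diff oU Uz Cf. Qed.

Lemma derive_sum_coord n (f : 'rV[R]_n -> R) z v : differentiable f z ->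
  'D_v f z = \sum_(i < n) v ord0 i * 'D_(delta_mx ord0 i) f z.
Proof.
move=> df; rewrite deriveE // -{1}(sum_delta_mx v) linear_sum.
by apply: eq_bigr => i _; rewrite linearZ /= -deriveE.
Qed.

Lemma derive_linear n (f : 'rV[R]_n -> R) z (a : R) u v : differentiable f z ->
  'D_(a *: u + v) f z = a * 'D_u f z + 'D_v f z.
Proof. by move=> df; rewrite !deriveE // linearP. Qed.

Lemma derive_line0 (V W : normedModType R) (F : V -> W) z v :
  'D_1 (fun h : R => F (h *: v + z)) 0 = 'D_v F z.
Proof.
have E : (fun h : R => h^-1 *: (F ((h *: 1 + 0) *: v + z) - F (0 *: v + z))) =
         (fun h : R => h^-1 *: (F (h *: v + z) - F z)).
  by apply/funext => h; rewrite [h *: 1]mulr1 addr0 scale0r add0r.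
by rewrite /derive /= E.
Qed.

(** [F] is assumed derivable along [v] only, so the chain rule is applied to the curve [c], for
    which derivability and differentiability coincide. *)
Lemma is_derive_comp n m (g : 'rV[R]_m -> R) (F : 'rV[R]_n -> 'rV[R]_m) z v :
  differentiable g (F z) -> (forall i, derivable (fun w => F w ord0 i) z v) ->
  is_derive z v (g \o F) ('D_(\row_i 'D_v (fun w => F w ord0 i) z) g (F z)).
Proof.
move=> dg dF.
have dFz : derivable F z v by apply/derivable_mxP => i j; rewrite ord1.
pose c (h : R) := F (h *: v + z).
have c0 : c 0 = F z by rewrite /c scale0r add0r.
have dc : differentiable c 0.
  have /derivable1P dc := dFz.
  exact: (@derivable1_diffP _ _ c 0).1 dc.
have cD : 'd c 0 1 = \row_i 'D_v (fun w => F w ord0 i) z.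
  have -> : \row_i 'D_v (fun w => F w ord0 i) z = 'D_v F z.
    by rewrite derive_mx //; apply/rowP => i; rewrite !mxE.
  by rewrite -deriveE // derive_line0.
have dgc : differentiable g (c 0) by rewrite c0.
have dgF : differentiable (g \o c) 0 := differentiable_comp dc dgc.
apply: DeriveDef.
  by apply/derivable1P; exact: (@derivable1_diffP _ _ (g \o c) 0).2 dgF.
rewrite -derive_line0 -[fun h => _]/(g \o c).
by rewrite deriveE // diff_comp //= cD -deriveE ?c0.
Qed.

Lemma rV_continuous (T : topologicalType) m (F : T -> 'rV[R]_m) z :
  (forall i, {for z, continuous (fun w => F w ord0 i)}) -> {for z, continuous F}.
Proof.
move=> cF A [P zP PA].
suff : nbhs z [set w | forall i j, P i j (F w i j)].
  by apply: filterS => w wP; exact: PA.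
apply: filter_forall => i; apply: filter_forall => j.
by rewrite ord1; have := cF j _ (zP ord0 j); rewrite ord1.
Qed.

(** By the chain rule a derivative of the composite is a sum of products of derivatives of the
    components of [F] with partial derivatives of [g] composed with [F]; induction applies to these
    at one order less. *)
Lemma Ck_comp n m k (U : set 'rV[R]_n) (W : set 'rV[R]_m)
    (F : 'rV[R]_n -> 'rV[R]_m) (g : 'rV[R]_m -> R) :
  open U -> open W -> (forall z, U z -> W (F z)) ->
  (forall i, Ck k U (fun z => F z ord0 i)) -> Ck k W g -> Ck k U (g \o F).
Proof.
move=> oU oW UW; elim: k g => [|k IH] g CF Cg.
  split=> // z Uz; apply: continuous_comp; last exact/Cg.1/UW.
  by apply: rV_continuous => i; exact: (CF i).1.
have cc z : U z -> {for z, continuous (g \o F)}.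
  move=> Uz; apply: continuous_comp; last exact/Cg.1/UW.
  by apply: rV_continuous => i; exact: (CF i).1.
have dg w : W w -> differentiable g w.
  move=> Ww; apply: C1_differentiable oW Ww _.
  by elim: k {IH CF cc} Cg => // k IHk /CkW.
have dF z v : U z -> is_derive z v (g \o F)
    ('D_(\row_i 'D_v (fun w => F w ord0 i) z) g (F z)).
  move=> Uz; apply: is_derive_comp; first exact/dg/UW.
  by move=> i; exact: ((CF i).2 v).1.
split=> // v; split=> [z Uz|]; first by have [] := dF z v Uz.
apply: (@Ck_congr _ _ k U (fun z => \sum_(j < m)
  'D_v (fun w => F w ord0 j) z * ('D_(delta_mx ord0 j) g \o F) z)) => //.
  move=> z Uz; have [_ ->] := dF z v Uz.
  rewrite [RHS]derive_sum_coord; last exact/dg/UW.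
  by apply: eq_bigr => j _; rewrite mxE.
apply: Ck_sum => // j _; apply: CkM => //; first exact: ((CF j).2 v).2.
by apply: IH; [move=> i; exact: CkW|exact: (Cg.2 _).2].
Qed.

(** One mixed difference lies within a quarter of [t^2 |A - B|] of both [t^2 A] and [t^2 B], which
    forces [|A - B|] to be at most half of itself. *)
Let quotient_limits_eq (w w1 w2 f0 t A B : R) : 0 < t ->
  `|w - w1 - w2 + f0 - t ^+ 2 * B| <= t ^+ 2 * (`|A - B| / 4) ->
  `|w - w2 - w1 + f0 - t ^+ 2 * A| <= t ^+ 2 * (`|A - B| / 4) -> A = B.
Proof.
move=> t0 H1 H2; apply/eqP; rewrite -subr_eq0 -normr_le0.
have H : t ^+ 2 * `|A - B| <= t ^+ 2 * (`|A - B| / 2).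
  rewrite -[X in X * _ <= _]ger0_norm ?sqr_ge0 // -normrM.
  have -> : t ^+ 2 * (A - B) = (w - w1 - w2 + f0 - t ^+ 2 * B)
    - (w - w2 - w1 + f0 - t ^+ 2 * A) by ring.
  apply: le_trans (ler_normB _ _) _.
  have -> : t ^+ 2 * (`|A - B| / 2) = t ^+ 2 * (`|A - B| / 4) + t ^+ 2 * (`|A - B| / 4).
    by field.
  exact: lerD.
move: H; rewrite ler_pM2l ?exprn_gt0 //; lra.
Qed.

(** The mixed difference over the parallelogram with sides [t *: a] and [t *: b] is symmetric in [a]
    and [b], and two mean values turn it into [t^2] times a value of ['D_b ('D_a f)] close to
    [z]. *)
Lemma Schwarz n (U : set 'rV[R]_n) (f : 'rV[R]_n -> R) z u v :
  open U -> U z -> Ck 2 U f -> 'D_u ('D_v f) z = 'D_v ('D_u f) z.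
Proof.
suff main (a b : 'rV[R]_n) (e : R) : open U -> U z -> Ck 2 U f -> 0 < e ->
    exists2 d : R, 0 < d & forall t, 0 < t < d ->
      `|f (z + t *: a + t *: b) - f (z + t *: a) - f (z + t *: b) + f z
        - t ^+ 2 * 'D_b ('D_a f) z| <= t ^+ 2 * e.
  move=> oU Uz Cf; apply/eqP/negPn/negP => ne.
  set A := 'D_u ('D_v f) z in ne *; set B := 'D_v ('D_u f) z in ne *.
  have e0 : 0 < `|A - B| / 4 by rewrite divr_gt0 // normr_gt0 subr_eq0.
  have [d1 d10 H1] := main u v _ oU Uz Cf e0.
  have [d2 d20 H2] := main v u _ oU Uz Cf e0.
  pose t := Num.min d1 d2 / 2.
  have t0 : 0 < t by rewrite divr_gt0 // lt_min d10.
  have td1 : t < d1.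
    apply: (@lt_le_trans _ _ (Num.min d1 d2)); last by rewrite ge_min lexx.
    by rewrite /t ltr_pdivrMr // ltr_pMr ?ltr1n // lt_min d10.
  have td2 : t < d2.
    apply: (@lt_le_trans _ _ (Num.min d1 d2)); last by rewrite ge_min lexx orbT.
    by rewrite /t ltr_pdivrMr // ltr_pMr ?ltr1n // lt_min d10.
  have {}H1 := H1 t; have {}H2 := H2 t; move: H1 H2; rewrite t0 td1 td2 -/A -/B.
  rewrite -(addrA z (t *: v)) (addrC (t *: v)) addrA.
  move=> /(_ isT) H1 /(_ isT) H2.
  by move/eqP: ne; apply; exact: (quotient_limits_eq t0 H1 H2).
move=> oU Uz [cf df] e0.
have [da [ca dda]] := df a; have [dba [cba _]] := dda b.
have [r1 r10 r1U] := open_ball_sub oU Uz.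
have [r2 r20 r2e] := continuous_ball e0 (cba z Uz).
pose M := 1 + `|a| + `|b|.
have M0 : 0 < M by rewrite /M -addrA ltr_pwDl // addr_ge0.
pose r := Num.min r1 r2.
have r0 : 0 < r by rewrite lt_min r10.
exists (r / M); first by rewrite divr_gt0.
move=> t /andP[t0 td].
have tr s s' : `|s| <= t -> `|s'| <= t -> `|s *: a + s' *: b| < r.
  move=> st st'; apply: (@le_lt_trans _ _ (t * `|a| + t * `|b|)).
    by apply: le_trans (ler_normD _ _) _; rewrite !normrZ lerD // ler_wpM2r.
  rewrite -mulrDr; apply: (@lt_le_trans _ _ (t * M)).
    by rewrite ltr_pM2l // /M -addrA ltrDr.
  by rewrite -ler_pdivlMr // ltW.
have trU s s' : `|s| <= t -> `|s'| <= t -> U (z + s *: a + s' *: b).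
  move=> st st'; rewrite -addrA; apply: r1U.
  by have := tr s s' st st'; rewrite lt_min => /andP[].
have tt : `|t| = t by rewrite gtr0_norm.
(* The mean value theorem is applied to this difference along [a], then to ['D_a f] along [b]. *)
pose g (w : 'rV[R]_n) := f (w + t *: b) - f w.
have tr0 s : `|s| <= t -> U (z + s *: a).
  by move=> st; rewrite -[_ + _]addr0 -(scale0r b); apply: trU; rewrite // normr0 ltW.
have dg s : `|s| <= t -> is_derive (z + s *: a) a g
   ('D_a f (z + s *: a + t *: b) - 'D_a f (z + s *: a)).
  move=> st.
  have d1 : derivable f (z + s *: a + t *: b) a by apply/da/trU; rewrite ?tt.
  have d2 : derivable f (z + s *: a) a by apply/da/tr0.
  have d1' : is_derive (z + s *: a) a (fun w => f (w + t *: b))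
      ('D_a f (z + s *: a + t *: b)).
    have E : (fun h : R => h^-1 *: (f (h *: a + (z + s *: a) + t *: b) - f (z + s *: a + t *: b))) =
      (fun h : R => h^-1 *: (f (h *: a + (z + s *: a + t *: b)) - f (z + s *: a + t *: b))).
      by apply/funext => h; rewrite -(addrA (h *: a)).
    by apply: DeriveDef; rewrite /derivable /derive /= E.
  exact: (@is_deriveB _ _ _ (fun w => f (w + t *: b)) f _ _ _ _ d1' (DeriveDef d2 erefl)).
have [s|s st] := @line_MVT n g z a t; first by rewrite tt => /dg [].
rewrite tt in st; have [_ ->] := dg s st.
have [s'|s' st'] := @line_MVT n ('D_a f) (z + s *: a) b t.
  by rewrite tt => st'; apply: dba; exact: trU.
rewrite tt in st'; move=> -> Eg.
have -> : f (z + t *: a + t *: b) - f (z + t *: a) - f (z + t *: b) + f z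
  = t * (t * 'D_b ('D_a f) (z + s *: a + s' *: b)) by rewrite -Eg /g; ring.
rewrite mulrA -expr2 -mulrBr normrM gtr0_norm ?exprn_gt0 // ler_pM2l ?exprn_gt0 //.
by apply/ltW; rewrite -addrA; apply: r2e; have := tr s s' st st'; rewrite lt_min => /andP[].
Qed.

End Differentiability.

(** * A flat function *)

Section FlatFunction.
Context {R : realType}.
Implicit Types (p q : {poly R}) (t : R).

(** The polynomial factor makes the family stable under differentiation; [p = 1] is the classical
    function that is flat at 0. *)
Definition flat p t : R := if 0 < t then p.[t^-1] * expR (- t^-1) else 0.

Lemma flat_le0 p t : t <= 0 -> flat p t = 0.
Proof. by rewrite /flat leNgt => /negbTE ->. Qed.

Lemma flat1_gt0 t : 0 < t -> 0 < flat 1 t.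
Proof. by move=> t0; rewrite /flat t0 hornerC mul1r expR_gt0. Qed.

Lemma flatXM p t : flat ('X * p) t = t^-1 * flat p t.
Proof.
rewrite /flat; case: ifP => _; last by rewrite mulr0.
by rewrite hornerM hornerX mulrA.
Qed.

(* From e^s >= s^(i+1)/(i+1)! at s = 1/t. *)
Lemma flat_bound p : exists C : R, forall t, `|flat p t| <= C * `|t|.
Proof.
exists (\sum_(i < size p) `|p`_i| * (i.+1)`!%:R) => t.
have [t0|t0] := leP t 0.
  by rewrite flat_le0 // normr0 mulr_ge0 // sumr_ge0 // => i _; rewrite mulr_ge0.
rewrite (gtr0_norm t0) /flat t0 normrM (gtr0_norm (expR_gt0 _)) expRN.
rewrite ler_pdivrMr ?expR_gt0 //.
set s := t^-1; have s0 : 0 < s by rewrite invr_gt0.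
rewrite -[t]invrK -/s mulrAC ler_pdivlMr // horner_coef.
apply: (@le_trans _ _ (\sum_(i < size p) `|p`_i| * s ^+ i * s)).
  rewrite -mulr_suml ler_wpM2r ?(ltW s0) //.
  apply: le_trans (ler_norm_sum _ _ _) _; apply: ler_sum => i _.
  by rewrite normrM normrX (gtr0_norm s0).
rewrite mulr_suml; apply: ler_sum => i _.
rewrite -mulrA -exprSr -mulrA ler_wpM2l //.
rewrite -ler_pdivrMl ?ltr0n ?fact_gt0 // mulrC.
by apply: le_trans (expR_ge1Dxn i (ltW s0)); rewrite lerDr.
Qed.

(** For [t > 0] the derivative is [t^-2 (p - p')(t^-1) exp(- t^-1)], again in the family. At 0 the
    difference quotient is [flat ('X * p)], which [flat_bound] makes O(t). *)
Lemma is_derive_flat p t : is_derive t 1 (flat p) (flat ('X * ('X * (p - p^`()))) t).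
Proof.
have [t0|t0|t0] := ltrgtP t 0.
- rewrite flat_le0; last exact: ltW.
  apply: (near_eq_is_derive _ (is_derive_cst (0 : R) t 1)).
  by near=> s; rewrite flat_le0 //; apply: ltW; near: s; exact: lt_nbhsl.
- have ti : is_derive t 1 (fun s : R => s^-1) (- t ^- 2).
    apply: is_derive_eq (@is_deriveV R id t 1 1 (lt0r_neq0 t0) (is_derive_id t (1 : R))) _.
    by rewrite [LHS]mulr1.
  have D1 := is_derive1_comp (is_derive_poly p t^-1) ti.
  have tN : is_derive t 1 (fun s : R => - s^-1) (- - t ^- 2) := is_deriveN ti.
  have D2 := @is_derive1_comp _ expR (fun s : R => - s^-1) _ _ _
    (is_derive_expR (- t^-1)) tN.
  have D := is_deriveM D1 D2.
  apply: (near_eq_is_derive (f := (horner p \o GRing.inv) * (expR \o (fun s => - s^-1)))).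
    near=> s; rewrite /flat ifT //; near: s; exact: lt_nbhsr.
  apply: is_derive_eq D _.
  rewrite !flatXM /flat t0 hornerD hornerN /GRing.scale /=.
  by have tn0 := lt0r_neq0 t0; field.
- rewrite t0 flat_le0 //.
  have [C HC] := flat_bound ('X * p).
  have H : (fun h : R => h^-1 *: (flat p (h *: 1 + 0) - flat p 0)) @ 0^' --> (0 : R).
    have C0 : 0 < `|C| + 1 by rewrite ltr_wpDl.
    apply/cvgrPdist_le => e e0; near=> h.
    rewrite sub0r normrN [h *: 1]mulr1 addr0 (flat_le0 p (lexx 0)) subr0.
    rewrite -[_ *: _]/(h^-1 * flat p h) -flatXM.
    apply: le_trans (HC h) _; apply: (@le_trans _ _ ((`|C| + 1) * `|h|)).
      by rewrite ler_wpM2r // (le_trans (ler_norm C)) // lerDl.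
    rewrite -ler_pdivlMl // mulrC; near: h.
    by apply: dnbhs0_le; rewrite divr_gt0.
  apply: DeriveDef; first by apply/cvg_ex; exists 0.
  exact: cvg_lim H.
Unshelve. all: by end_near. Qed.

Lemma is_derive_comp1 n (g : R -> R) (f : 'rV[R]_n -> R) z v (a : R) :
  is_derive (f z) 1 g a -> derivable f z v ->
  is_derive z v (g \o f) (a * 'D_v f z).
Proof.
move=> dg df; pose c (h : R) := f (h *: v + z).
have c0 : c 0 = f z by rewrite /c scale0r add0r.
have dc : is_derive (0 : R) 1 c ('D_v f z).
  apply: DeriveDef; first by move/derivable1P: df.
  exact: derive_line0.
have dgc : is_derive (c 0) 1 g a by rewrite c0.
have D := is_derive1_comp dgc dc.
apply: DeriveDef; first by apply/derivable1P; case: D.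
by rewrite -derive_line0; case: D.
Qed.

(** The induction on the order runs over all [p] at once, since differentiating changes the
    polynomial. *)
Lemma Ck_flat n k (U : set 'rV[R]_n) p (f : 'rV[R]_n -> R) : open U ->
  Ck k U f -> Ck k U (flat p \o f).
Proof.
move=> oU; elim: k p => [|k IH] p Cf.
  split=> // z Uz; apply: continuous_comp; first exact: Cf.1.
  by apply/differentiable_continuous/derivable1_diffP; case: (is_derive_flat p (f z)).
split=> [z Uz|v].
  apply: continuous_comp; first exact: Cf.1.
  by apply/differentiable_continuous/derivable1_diffP; case: (is_derive_flat p (f z)).
have [dv Cv] := Cf.2 v.
have D z : U z -> is_derive z v (flat p \o f)
    (flat ('X * ('X * (p - p^`()))) (f z) * 'D_v f z).
  by move=> Uz; apply: is_derive_comp1 (is_derive_flat p (f z)) (dv z Uz).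
split=> [z Uz|]; first by case: (D z Uz).
apply: Ck_congr (CkM oU (IH ('X * ('X * (p - p^`()))) (CkW Cf)) Cv) => // z Uz.
by case: (D z Uz).
Qed.

End FlatFunction.

(** * Calculus on manifolds *)

Section ManifoldCalculus.
Context {R : realType} {n : nat} {N : manifold R n}.
Implicit Types (f g : N -> R) (p q x y : N).

Lemma chart_image_inv p z : (chart p @` dom p) z ->
  dom p (chinv p z) /\ chart p (chinv p z) = z.
Proof. by move=> [q dq <-]; rewrite chartK. Qed.

Lemma open_preimage_within (S T : topologicalType) (W : set S) (F : S -> T) (U : set T) :
  open W -> open U -> (forall z, W z -> {for z, continuous F}) ->
  open (W `&` F @^-1` U).
Proof.
move=> oW oU cF; rewrite openE => z [Wz UFz]; apply: filterI.
  exact: open_nbhs_nbhs.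
by apply: (cF z Wz); exact: open_nbhs_nbhs.
Qed.

Lemma transition_open p q : open (chart p @` (dom p `&` dom q)).
Proof.
suff -> : chart p @` (dom p `&` dom q) = chart p @` dom p `&` chinv p @^-1` dom q.
  apply: open_preimage_within; [exact: chart_open|exact: dom_open|].
  by move=> z; exact: chinv_continuous.
apply/seteqP; split=> [_ [y [py qy] <-]|_ [[y py <-] /=]].
  by split; [exists y|rewrite /= chartK].
by rewrite chartK // => qy; exists y.
Qed.

(** [smooth_at f y] is the case [p = y]; a free chart lets the point vary while the chart stays
    fixed. *)
Definition smooth_chart p f y : Prop :=
  exists U, [/\ open U, U (chart p y) & smooth_on U (f \o chinv p)].

Lemma smooth_chart_change p q f y : dom p y -> dom q y ->
  smooth_chart p f y -> smooth_chart q f y.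
Proof.
move=> py qy [U [oU Uy Cf]].
(* The part of the overlap that the transition map sends into [U]: there [f] read in [q] is [f] read
   in [p] composed with a smooth transition. *)
pose W := chart q @` (dom q `&` dom p) `&` (chart p \o chinv q) @^-1` U.
have oW : open W.
  apply: open_preimage_within => //; first exact: transition_open.
  move=> _ [w [qw pw] <-]; apply: continuous_comp.
    by apply: chinv_continuous; exists w.
  by rewrite chartK //; exact: chart_continuous.
exists W; split=> //.
  by split; [exists y|rewrite /= chartK].
move=> k; apply: (@Ck_congr _ _ k W ((f \o chinv p) \o (chart p \o chinv q))) => //.
  by move=> _ [[w [qw pw] <-] _] /=; rewrite !chartK.
apply: (Ck_comp oW oU) => //; first by move=> z [].
move=> i; apply: Ck_sub (chart_compatible q p i k) => z [].
by [].
Qed.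

Lemma smooth_atE p f y : dom p y -> smooth_at f y <-> smooth_chart p f y.
Proof.
by move=> py; split; apply: smooth_chart_change => //; exact: dom_refl.
Qed.

Lemma near_dom p y : dom p y -> \forall z \near y, dom p z.
Proof. by move=> py; apply: open_nbhs_nbhs; split=> //; exact: dom_open. Qed.

Lemma smooth_near f x : smooth_at f x -> \forall y \near x, smooth_at f y.
Proof.
move=> [U [oU Ux Cf]].
have H : \forall y \near x, U (chart x y).
  by apply: (chart_continuous (dom_refl x)); exact: open_nbhs_nbhs.
near=> y.
have xy : dom x y by near: y; apply: near_dom; exact: dom_refl.
apply/(smooth_atE f xy); exists U; split=> //; near: y; exact: H.
Unshelve. all: by end_near. Qed.

(** Smoothness and [dd] are computed in the chart, so agreement of germs on the manifold has to be
    carried over to the chart image. *)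
Lemma near_chinv f g x : {near x, f =1 g} ->
  {near chart x x, f \o chinv x =1 g \o chinv x}.
Proof.
move=> fg; have c : {for chart x x, continuous (chinv x)}.
  by apply: chinv_continuous; exists x => //; exact: dom_refl.
have : nbhs (chinv x (chart x x)) [set y | f y = g y].
  by rewrite chartK //; exact: dom_refl.
by move=> /c.
Qed.

Lemma smooth_congr f g x : {near x, f =1 g} -> smooth_at f x -> smooth_at g x.
Proof.
move=> /near_chinv fg.
have : nbhs (chart x x) [set z | (f \o chinv x) z = (g \o chinv x) z] := fg.
rewrite nbhsE => -[B [oB Bx] BE] [U [oU Ux Cf]].
exists (U `&` B); split=> //; first exact: openI.
move=> k; apply: (@Ck_congr _ _ k _ (f \o chinv x)).
- exact: openI.
- by move=> z [_ /BE].
- by apply: Ck_sub (Cf k) => z [].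
Qed.

Lemma smooth_cst (c : R) x : smooth_at (fun _ : N => c) x.
Proof. by exists setT; split=> //; [exact: openT|move=> k; exact: Ck_cst]. Qed.

Lemma smoothD f g x : smooth_at f x -> smooth_at g x ->
  smooth_at (fun y => f y + g y) x.
Proof.
move=> [U [oU Ux Cf]] [W [oW Wx Cg]]; exists (U `&` W); split=> //; first exact: openI.
move=> k; apply: (@CkD _ _ k _ (f \o chinv x) (g \o chinv x)); first exact: openI.
  by apply: Ck_sub (Cf k) => z [].
by apply: Ck_sub (Cg k) => z [].
Qed.

Lemma smoothM f g x : smooth_at f x -> smooth_at g x ->
  smooth_at (fun y => f y * g y) x.
Proof.
move=> [U [oU Ux Cf]] [W [oW Wx Cg]]; exists (U `&` W); split=> //; first exact: openI.
move=> k; apply: (@CkM _ _ k _ (f \o chinv x) (g \o chinv x)); first exact: openI.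
  by apply: Ck_sub (Cf k) => z [].
by apply: Ck_sub (Cg k) => z [].
Qed.

Lemma smoothN f x : smooth_at f x -> smooth_at (fun y => - f y) x.
Proof.
move=> sf; apply: smooth_congr (smoothM (smooth_cst (-1) x) sf).
by near=> y; rewrite mulN1r.
Unshelve. all: by end_near. Qed.

Lemma smooth_sum (I : Type) (r : seq I) (P : pred I) (F : I -> N -> R) x :
  (forall i, P i -> smooth_at (F i) x) ->
  smooth_at (fun y => \sum_(i <- r | P i) F i y) x.
Proof.
move=> sF; elim: r => [|i r IH].
  by apply: smooth_congr (smooth_cst 0 x); near=> y; rewrite big_nil.
case Pi: (P i); last first.
  by apply: smooth_congr IH; near=> y; rewrite big_cons Pi.
by apply: smooth_congr (smoothD (sF i Pi) IH); near=> y; rewrite big_cons Pi.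
Unshelve. all: by end_near. Qed.

Lemma smooth_prod (I : Type) (r : seq I) (P : pred I) (F : I -> N -> R) x :
  (forall i, P i -> smooth_at (F i) x) ->
  smooth_at (fun y => \prod_(i <- r | P i) F i y) x.
Proof.
move=> sF; elim: r => [|i r IH].
  by apply: smooth_congr (smooth_cst 1 x); near=> y; rewrite big_nil.
case Pi: (P i); last first.
  by apply: smooth_congr IH; near=> y; rewrite big_cons Pi.
by apply: smooth_congr (smoothM (sF i Pi) IH); near=> y; rewrite big_cons Pi.
Unshelve. all: by end_near. Qed.

Lemma smooth_continuous f x : smooth_at f x -> {for x, continuous f}.
Proof.
move=> [U [oU Ux Cf]].
have c : {for x, continuous ((f \o chinv x) \o chart x)}.
  apply: continuous_comp; first exact/chart_continuous/dom_refl.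
  exact: (Cf 0%N).1.
apply: near_eq_continuous c; near=> y; rewrite /= chartK //; near: y.
by apply: near_dom; exact: dom_refl.
Unshelve. all: by end_near. Qed.

Lemma smooth_neq0_near f x : smooth_at f x -> f x != 0 ->
  \forall y \near x, f y != 0.
Proof.
move=> /smooth_continuous cf fx0.
exact: (cvgr_neq0 _ cf fx0).
Qed.

Lemma smoothV f x : smooth_at f x -> f x != 0 -> smooth_at (fun y => (f y)^-1) x.
Proof.
move=> sf fx0; have := smooth_neq0_near sf fx0.
have [U [oU Ux Cf]] := sf.
have c : {for chart x x, continuous (chinv x)}.
  by apply: chinv_continuous; exists x => //; exact: dom_refl.
rewrite -{1}(chartK (dom_refl x)) => /c; rewrite /= => nb.
have := nb; rewrite nbhsE => -[B [oB Bx] BE].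
exists (U `&` B); split=> //; first exact: openI.
move=> k; apply: (@CkV _ _ k _ (f \o chinv x)); first exact: openI.
  by move=> z [_ /BE].
by apply: Ck_sub (Cf k) => z [].
Qed.

Lemma smooth_chart_coord p q i : dom p q -> smooth_at (fun y => chart p y ord0 i) q.
Proof.
move=> pq; apply/(smooth_atE _ pq).
exists (chart p @` dom p); split; [exact: chart_open|by exists q|move=> k].
apply: Ck_congr (Ck_coord k _ i); first exact: chart_open.
by move=> z /chart_image_inv [_ /= ->].
Qed.

Lemma smooth_differentiable f x p : dom p x -> smooth_at f x ->
  differentiable (f \o chinv p) (chart p x).
Proof.
by move=> px /(smooth_atE f px) [U [oU Ux Cf]]; exact: C1_differentiable (Cf 1%N).
Qed.

Lemma smooth_derivable f x p v : dom p x -> smooth_at f x ->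
  derivable (f \o chinv p) (chart p x) v.
Proof. by move=> px sf; apply: diff_derivable; exact: smooth_differentiable. Qed.

Lemma dd_congr f g x v : {near x, f =1 g} -> dd f x v = dd g x v.
Proof. by move=> fg; apply: near_eq_derive; exact: near_chinv. Qed.

Lemma dd_eq f g x v : f =1 g -> dd f x v = dd g x v.
Proof. by move=> fg; congr (dd _ x v); apply/funext. Qed.

Lemma dd_cst (c : R) x v : dd (fun _ => c) x v = 0.
Proof. by rewrite /dd; exact: derive_cst. Qed.

Lemma ddD f g x v : smooth_at f x -> smooth_at g x ->
  dd (fun y => f y + g y) x v = dd f x v + dd g x v.
Proof.
move=> sf sg; rewrite /dd -deriveD //; apply: smooth_derivable => //; exact: dom_refl.
Qed.

Lemma ddM f g x v : smooth_at f x -> smooth_at g x ->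
  dd (fun y => f y * g y) x v = f x * dd g x v + g x * dd f x v.
Proof.
move=> sf sg; rewrite /dd [LHS](@deriveM _ _ (f \o chinv x) (g \o chinv x)).
- by rewrite /= chartK //; exact: dom_refl.
- by apply: smooth_derivable => //; exact: dom_refl.
- by apply: smooth_derivable => //; exact: dom_refl.
Qed.

Lemma ddZ (c : R) f x v : smooth_at f x -> dd (fun y => c * f y) x v = c * dd f x v.
Proof. by move=> sf; rewrite (ddM _ (smooth_cst c x) sf) dd_cst mulr0 addr0. Qed.

Lemma ddN f x v : smooth_at f x -> dd (fun y => - f y) x v = - dd f x v.
Proof.
move=> sf; rewrite -mulN1r -ddZ //; apply: dd_eq => y; by rewrite mulN1r.
Qed.

Lemma dd_sum (I : Type) (r : seq I) (P : pred I) (F : I -> N -> R) x v :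
  (forall i, P i -> smooth_at (F i) x) ->
  dd (fun y => \sum_(i <- r | P i) F i y) x v = \sum_(i <- r | P i) dd (F i) x v.
Proof.
move=> sF; elim: r => [|i r IH].
  rewrite big_nil; transitivity (dd (fun _ : N => 0 : R) x v); last exact: dd_cst.
  by apply: dd_eq => y; rewrite big_nil.
rewrite big_cons; case: ifP => Pi.
  rewrite -IH -(ddD v (sF i Pi) (smooth_sum _ sF)).
  by apply: dd_eq => y; rewrite big_cons Pi.
by rewrite -IH; apply: dd_eq => y; rewrite big_cons Pi.
Qed.

Lemma dd_linear f x (a : R) (u v : TS x) : smooth_at f x ->
  dd f x (a *: u + v) = a * dd f x u + dd f x v.
Proof.
by move=> sf; apply: derive_linear; apply: smooth_differentiable => //; exact: dom_refl.
Qed.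

Lemma dd_coord f x (v : TS x) : smooth_at f x ->
  dd f x v = \sum_i (v : 'rV[R]_n) ord0 i * dd f x (delta_mx ord0 i).
Proof.
by move=> sf; apply: derive_sum_coord; apply: smooth_differentiable => //; exact: dom_refl.
Qed.

End ManifoldCalculus.

Section ChartDerivatives.
Context {R : realType} {n : nat} {N : manifold R n}.
Implicit Types (f g : N -> R) (p q x y : N).

Lemma differentiable_transition p q y i : dom p y -> dom q y ->
  differentiable (fun z => chart q (chinv p z) ord0 i) (chart p y).
Proof.
move=> py qy.
exact: (smooth_differentiable py (smooth_chart_coord i qy)).
Qed.

(** By definition [dd f y] uses the chart at [y], which changes with [y]; the chain rule for the
    transition moves the derivative to a chart [p] that stays fixed. *)
Lemma dd_in_chart p f y (v : TS y) : dom p y -> smooth_at f y ->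
  dd f y v = 'D_(chart_comp p v) (f \o chinv p) (chart p y).
Proof.
move=> py sf.
have D : is_derive (chart y y) (v : 'rV[R]_n) ((f \o chinv p) \o (chart p \o chinv y))
    ('D_(\row_i 'D_(v : 'rV[R]_n) (fun w => (chart p \o chinv y) w ord0 i) (chart y y))
       (f \o chinv p) ((chart p \o chinv y) (chart y y))).
  apply: is_derive_comp.
    by rewrite /= chartK //; exact: smooth_differentiable.
  move=> i; apply: diff_derivable; exact: differentiable_transition.
have E : 'D_v ((f \o chinv p) \o (chart p \o chinv y)) (chart y y) = dd f y v.
  apply: near_eq_derive.
  have c : {for chart y y, continuous (chinv y)}.
    by apply: chinv_continuous; exists y => //; exact: dom_refl.
  have : nbhs (chinv y (chart y y)) (dom p).
    by rewrite chartK //; exact: near_dom.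
  move=> nb; have nb' : \forall z \near chart y y, dom p (chinv y z) := c _ nb.
  by near=> z; rewrite /= chartK //; near: z.
rewrite -E; have [_ ->] := D.
by rewrite /= chartK.
Unshelve. all: by end_near. Qed.

(** The transition from [x] to [y] and back is the identity near [chart x y], so its differential
    returns [v]. *)
Lemma chart_comp_coordf x y (v : TS x) : dom x y -> chart_comp x (coordf x v y) = v.
Proof.
move=> xy; apply/rowP => i; rewrite mxE.
have D : is_derive (chart x y) (v : 'rV[R]_n)
   ((fun z => chart x (chinv y z) ord0 i) \o (chart y \o chinv x))
    ('D_(\row_j 'D_(v : 'rV[R]_n) (fun w => (chart y \o chinv x) w ord0 j) (chart x y))
       (fun z => chart x (chinv y z) ord0 i) ((chart y \o chinv x) (chart x y))).
  apply: is_derive_comp.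
    by rewrite /= chartK //; apply: differentiable_transition => //; exact: dom_refl.
  move=> j; apply: diff_derivable; exact: differentiable_transition.
rewrite -[dd _ _ _]/('D_(coordf x v y) (fun z => chart x (chinv y z) ord0 i) (chart y y)).
have [_] := D; rewrite /= chartK // -/(coordf x v y) => {D} <-.
have oW := @transition_open _ _ N x y.
have Wy : (chart x @` (dom x `&` dom y)) (chart x y).
  by exists y => //; split=> //; exact: dom_refl.
have [_ <-] := is_derive_coord i (chart x y) v.
apply: near_eq_derive; apply: (open_near_eq oW Wy) => _ [q [xq yq] <-].
by rewrite /= chartK // chartK.
Qed.

End ChartDerivatives.

(** * Vector fields, iterated derivatives and the bracket *)

Section VectorFields.
Context {R : realType} {n : nat} {N : manifold R n}.
Implicit Types (f g : N -> R) (p q x y : N).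

Lemma smooth_chart_deriv f p x v : dom p x -> smooth_at f x ->
  smooth_at (fun y => 'D_v (f \o chinv p) (chart p y)) x.
Proof.
move=> px /(smooth_atE f px) [U [oU Ux Cf]]; apply/(smooth_atE _ px).
exists (U `&` chart p @` dom p); split.
- by apply: openI => //; exact: chart_open.
- by split=> //; exists x.
move=> k; have := (Cf k.+1).2 v => -[_ Cv].
apply: (@Ck_congr _ _ k _ ('D_v (f \o chinv p))).
- by apply: openI => //; exact: chart_open.
- by move=> z [_ /chart_image_inv [_ /= ->]].
- by apply: Ck_sub Cv => z [].
Qed.

Lemma chart_comp_linear x y (a : R) (u v : TS y) : dom x y ->
  chart_comp x (a *: u + v) = a *: chart_comp x u + chart_comp x v.
Proof.
move=> xy; apply/rowP => i; rewrite !mxE; apply: dd_linear; exact: smooth_chart_coord.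
Qed.

Lemma coordf_linear x y (a : R) (u v : TS x) : dom x y ->
  coordf x (a *: u + v) y = a *: coordf x u y + coordf x v y.
Proof.
move=> xy; apply/rowP => i; rewrite !mxE; apply: derive_linear.
exact: differentiable_transition.
Qed.

Lemma chart_comp_id x (v : TS x) : chart_comp x v = v.
Proof.
apply/rowP => i; rewrite mxE.
have Wx : (chart x @` dom x) (chart x x) by exists x.
have [_ <-] := is_derive_coord i (chart x x) v.
apply: near_eq_derive; apply: (open_near_eq (@chart_open _ _ _ x) Wx) => _ [q xq <-].
by rewrite /= chartK.
Qed.

Lemma coordf_id x (v : TS x) : coordf x v x = v.
Proof. by rewrite -[RHS]chart_comp_id; apply/rowP => i; rewrite !mxE. Qed.

Lemma dd_in_chart_coord p f y (v : TS y) : dom p y -> smooth_at f y ->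
  dd f y v = \sum_i chart_comp p v ord0 i *
                    'D_(delta_mx ord0 i) (f \o chinv p) (chart p y).
Proof.
move=> py sf; rewrite (dd_in_chart v py sf); apply: derive_sum_coord.
exact: smooth_differentiable.
Qed.

(** Near [x] the function is a sum of components of [X] times partial derivatives of [f], all taken
    in the chart at [x]. *)
Lemma smooth_dd (X : vfield N) f x : vfield_smooth_at X x -> smooth_at f x ->
  smooth_at (fun y => dd f y (X y)) x.
Proof.
move=> sX sf; have nf := smooth_near sf.
apply: (@smooth_congr _ _ _ (fun y => \sum_i chart_comp x (X y) ord0 i *
                    'D_(delta_mx ord0 i) (f \o chinv x) (chart x y))).
  near=> y; rewrite -(dd_in_chart_coord (p := x)) //.
    by near: y; exact: near_dom.
  by near: y.
apply: smooth_sum => i _; apply: smoothM; first exact: sX.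
exact: smooth_chart_deriv.
Unshelve. all: by end_near. Qed.

Lemma dd_chart_deriv f x (u v : TS x) : smooth_at f x ->
  dd (fun y => 'D_v (f \o chinv x) (chart x y)) x u =
  'D_u ('D_v (f \o chinv x)) (chart x x).
Proof.
move=> sf; apply: near_eq_derive.
have Wx : (chart x @` dom x) (chart x x) by exists x.
apply: (open_near_eq (@chart_open _ _ _ x) Wx) => _ [q xq <-].
by rewrite /= chartK.
Qed.

(** The product rule in the chart at [x]: one term differentiates the components of [X], the other
    is a second derivative of [f] with [X] frozen at [x]. *)
Lemma dd_dd (X : vfield N) f x (u : TS x) : vfield_smooth_at X x -> smooth_at f x ->
  dd (fun y => dd f y (X y)) x u =
  dd f x (\row_i dd (fun y => chart_comp x (X y) ord0 i) x u)
  + 'D_u ('D_(X x) (f \o chinv x)) (chart x x).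
Proof.
move=> sX sf; have nf := smooth_near sf.
have -> : dd (fun y => dd f y (X y)) x u =
    dd (fun y => \sum_i chart_comp x (X y) ord0 i *
                    'D_(delta_mx ord0 i) (f \o chinv x) (chart x y)) x u.
  apply: dd_congr; near=> y; rewrite (dd_in_chart_coord (p := x)) //.
    by near: y; exact: near_dom.
  by near: y.
have si i : smooth_at (fun y => 'D_(delta_mx ord0 i) (f \o chinv x) (chart x y)) x.
  exact: smooth_chart_deriv.
rewrite dd_sum; last by move=> i _; apply: smoothM => //; exact: sX.
rewrite [X in _ = X + _]dd_coord // -[RHS]addrC.
have -> : 'D_u ('D_(X x) (f \o chinv x)) (chart x x) =
    \sum_i (X x : 'rV[R]_n) ord0 i * dd (fun y => 'D_(delta_mx ord0 i) (f \o chinv x) (chart x y)) x u.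
  rewrite -dd_chart_deriv //.
  have -> : dd (fun y => 'D_(X x) (f \o chinv x) (chart x y)) x u =
    dd (fun y => \sum_i (X x : 'rV[R]_n) ord0 i * 'D_(delta_mx ord0 i) (f \o chinv x) (chart x y)) x u.
    apply: dd_congr; near=> y; apply: derive_sum_coord.
    apply: smooth_differentiable; last by near: y.
    by near: y; exact: near_dom.
  rewrite dd_sum; last by move=> i _; apply: smoothM => //; exact: smooth_cst.
  by apply: eq_bigr => i _; rewrite ddZ.
rewrite -big_split /=; apply: eq_bigr => i _.
rewrite (ddM _ (sX i) (si i)).
by rewrite chart_comp_id mxE [X in _ + X]mulrC.
Unshelve. all: by end_near. Qed.

(** The second derivatives cancel by [Schwarz], and what remains is the component formula that
    defines the bracket. *)
Lemma dd_vfield_br (X Y : vfield N) f x :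
  vfield_smooth_at X x -> vfield_smooth_at Y x -> smooth_at f x ->
  dd f x (vfield_br X Y x) =
  dd (fun y => dd f y (Y y)) x (X x) - dd (fun y => dd f y (X y)) x (Y x).
Proof.
move=> sX sY sf; rewrite !dd_dd //.
have [U [oU Ux Cf]] := sf.
have E (a b c d : R) : c = d -> (a + c) - (b + d) = - 1 * b + a.
  by move=> ->; ring.
rewrite (E _ _ _ _ (Schwarz (X x) (Y x) oU Ux (Cf 2%N))) -dd_linear //.
congr (dd f x _).
apply/rowP => i; rewrite /vfield_br mxE [RHS]mxE [X in _ = X + _]mxE.
by rewrite [X in _ = _ + X]mxE [X in _ = _ * X + _]mxE mulN1r addrC.
Qed.

Lemma vfield_br_coordf (X : vfield N) x (v : TS x) :
  vfield_br X (coordf x v) x = - \row_i dd (fun y => chart_comp x (X y) ord0 i) x v.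
Proof.
apply/rowP => i; rewrite !mxE coordf_id.
have -> : dd (fun y => chart_comp x (coordf x v y) ord0 i) x (X x) = 0.
  rewrite -(dd_cst ((v : 'rV[R]_n) ord0 i) (X x)); apply: dd_congr; near=> y.
  by rewrite chart_comp_coordf //; near: y; exact: near_dom.
by rewrite sub0r.
Unshelve. all: by end_near. Qed.

(** The covariant derivative of [X] along [v] for the flat connection of the chart at [x]; the
    bracket is its antisymmetrization. *)
Definition vdiff (X : vfield N) x (v : TS x) : TS x :=
  \row_i dd (fun y => chart_comp x (X y : TS y) ord0 i) x v.

Lemma vdiff_linear (X : vfield N) x (c : R) (u v : TS x) : vfield_smooth_at X x ->
  vdiff X (c *: u + v) = c *: vdiff X u + vdiff X v.
Proof.
move=> sX; apply/rowP => i; rewrite [LHS]mxE (dd_linear _ _ _ (sX i)).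
by rewrite [RHS]mxE [X in _ = X + _]mxE [X in _ = _ * X + _]mxE [X in _ = _ + X]mxE.
Qed.

Lemma vfield_br_vdiff (X Y : vfield N) x :
  vfield_br X Y x = vdiff Y (X x) - vdiff X (Y x).
Proof.
by apply/rowP => i; rewrite [LHS]mxE [RHS]mxE [X in _ = X + _]mxE [X in _ = _ + X]mxE
  [X in _ = _ - X]mxE.
Qed.

End VectorFields.

(** * Bump functions *)

Section Bump.
Context {R : realType} {n : nat} {N : manifold R n}.

Lemma norm_le_sqr (w : 'rV[R]_n) (r : R) : 0 < r ->
  \sum_i (w ord0 i) ^+ 2 <= r ^+ 2 -> `|w| <= r.
Proof.
move=> r0 H; rewrite /Num.Def.normr /= mx_normrE; apply: bigmax_le; first exact: ltW.
move=> [i j] _ /=; rewrite ord1 -ler_sqr ?nnegrE ?(ltW r0) //.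
apply: le_trans H; rewrite real_normK ?num_real // (bigD1 j) //= lerDl.
by apply: sumr_ge0 => ? _; exact: sqr_ge0.
Qed.

(** Vanishing near every point outside [A], and not just at it, is what makes the product with a
    section that is smooth only over [A] smooth everywhere. *)
Lemma exists_bump (x : N) (A : set N) : nbhs x A -> exists f : N -> R,
  [/\ forall y, smooth_at f y, f x != 0 &
      forall y, ~ A y -> \forall z \near y, f z = 0].
Proof.
move=> xA; pose W := chart x @` dom x; pose z0 := chart x x.
have Wz0 : W z0 by exists x.
have oW : open W := @chart_open _ _ _ x.
have [r r0 rW] := open_ball_sub oW Wz0.
have c0 : {for z0, continuous (chinv x)} by apply: chinv_continuous.
have nA : nbhs z0 [set z | A (chinv x z)].
  by apply: c0; rewrite /z0 chartK.
have [r' /= r'0 r'A] := (nbhs_normP _ _).1 nA.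
(* Half of the smaller radius puts the closed ball inside both the chart image and the preimage of
   [A]. *)
pose s := Num.min r r' / 2.
have s0 : 0 < s by rewrite divr_gt0 // lt_min r0.
have sm : s < Num.min r r' by rewrite ltr_pdivrMr // ltr_pMr ?ltr1n // lt_min r0.
(* The squared Euclidean distance is polynomial, whereas the norm on row vectors is the sup norm and
   not smooth; [norm_le_sqr] compares the two. *)
pose G (z : 'rV[R]_n) : R := \sum_i (z ord0 i - z0 ord0 i) ^+ 2.
have CG k : Ck k setT G.
  apply: Ck_sum; first exact: openT.
  move=> i _.
  have E : Ck k setT (fun z : 'rV[R]_n => z ord0 i + (- z0 ord0 i)).
    by apply: CkD; [exact: openT|exact: Ck_coord|exact: Ck_cst].
  by apply: (Ck_ext _ (CkM openT E E)).
have Kball z : G z <= s ^+ 2 -> `|z - z0| <= s.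
  move=> Gz; apply: norm_le_sqr => //; apply: le_trans Gz.
  by apply: ler_sum => i _; rewrite !mxE.
pose K := [set z | G z <= s ^+ 2].
have KW z : K z -> W z /\ A (chinv x z).
  move=> /Kball Kz; have {}Kz : `|z - z0| < Num.min r r' by apply: le_lt_trans sm.
  move: Kz; rewrite lt_min => /andP[zr zr']; split.
    by rewrite -(subrK z0 z) addrC; exact: rW.
  by apply: r'A; rewrite /= distrC.
have cK : compact K.
  apply: bounded_closed_compact.
    exists (s + `|z0|); split; first exact: num_real.
    move=> M sM z /Kball Kz; rewrite -(subrK z0 z).
    by apply: le_trans (ler_normD _ _) _; apply: le_trans (ltW sM); rewrite lerD2r.
  have -> : K = G @^-1` [set t | t <= s ^+ 2] by [].
  apply: closed_comp; last exact: closed_le.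
  by move=> z _; exact: (CG 0%N).1.
(* [C] is closed in the manifold, being compact in a Hausdorff space; this allows the extension by 0
   beyond the chart domain. *)
pose C := chinv x @` K.
have clC : closed C.
  apply: compact_closed; first exact: manifold_hausdorff.
  apply: continuous_compact => //; apply: continuous_in_subspaceT => z /set_mem Kz.
  by apply: chinv_continuous; case: (KW z Kz).
pose f y := if `[<dom x y>] then flat 1 (s ^+ 2 - G (chart x y)) else 0.
have f0 y : ~ C y -> f y = 0.
  move=> nC; rewrite /f; case: asboolP => // xy; apply: flat_le0.
  rewrite subr_le0 leNgt; apply/negP => Gs; apply: nC.
  by exists (chart x y); [exact: ltW|exact: chartK].
have nf0 y : ~ C y -> \forall z \near y, f z = 0.
  move=> nC; have : nbhs y (~` C).
    by apply: open_nbhs_nbhs; split=> //; exact: closed_openC.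
  by apply: filterS => z; exact: f0.
exists f; split.
- move=> y; have [xy|nxy] := pselect (dom x y).
    apply/(smooth_atE _ xy); exists W; split=> //; first by exists y.
    move=> k; apply: (@Ck_congr _ _ k _ (flat 1 \o (fun z => s ^+ 2 + -1 * G z))) => //.
      move=> z /chart_image_inv [dz ez] /=.
      by rewrite /f asboolT // ez mulN1r.
    apply: Ck_flat => //; apply: CkD => //; first exact: Ck_cst.
    by apply: CkM => //; [exact: Ck_cst|apply: Ck_sub (CG k)].
  apply: (@smooth_congr _ _ _ (fun _ => 0)); last exact: smooth_cst.
  have nC : ~ C y.
    by move=> [z /KW [/chart_image_inv [dz _] _] zy]; apply: nxy; rewrite -zy.
  by near=> z; apply/esym; near: z; exact: nf0.
- rewrite /f asboolT //; apply: lt0r_neq0; apply: flat1_gt0.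
  by rewrite subr_gt0 /G big1 ?exprn_gt0 // => i _; rewrite subrr expr0n.
- by move=> y nA'; apply: nf0 => -[z /KW [_ Az] zy]; apply: nA'; rewrite -zy.
Unshelve. all: by end_near. Qed.

End Bump.

(** * Calculus on a product manifold *)

Section ProductCalculus.
Context {R : realType} {n1 n2 : nat}.
Context {N1 : manifold R n1} {N2 : manifold R n2}.
Local Notation N := (prod_manifold N1 N2).

Lemma smooth_fst (f : N1 -> R) (p : N) : smooth_at f p.1 ->
  smooth_at (fun q : N => f q.1) p.
Proof.
move=> [U [oU Ux Cf]]; exists (lsubmx @^-1` U); split.
- by apply: open_comp => // z _; exact: lsubmx_continuous.
- by rewrite /= row_mxKl.
- move=> k; apply: (Ck_proj _ _ _ (Cf k)) => //; last exact: lsubmx_continuous.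
  exact: linearP.
Qed.

Lemma smooth_snd (f : N2 -> R) (p : N) : smooth_at f p.2 ->
  smooth_at (fun q : N => f q.2) p.
Proof.
move=> [U [oU Ux Cf]]; exists (rsubmx @^-1` U); split.
- by apply: open_comp => // z _; exact: rsubmx_continuous.
- by rewrite /= row_mxKr.
- move=> k; apply: (Ck_proj _ _ _ (Cf k)) => //; last exact: rsubmx_continuous.
  exact: linearP.
Qed.

Lemma smooth_slice1 (f : N -> R) (x : N1) (y : N2) : smooth_at f ((x, y) : N) ->
  smooth_at (fun x' => f (x', y)) x.
Proof.
move=> [U [oU Ux Cf]].
pose F (z : 'rV[R]_n1) := row_mx z (chart y y).
have cF : continuous F.
  move=> z; apply: (@row_mx_continuous R n1 n2 _ id (fun=> chart y y) z).
    by move=> A.  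
  exact: cst_continuous.
have oFU : open (F @^-1` U) by apply: open_comp.
exists (F @^-1` U); split=> //.
move=> k; apply: (@Ck_ext _ _ _ _ ((f \o @chinv _ _ N (x, y)) \o F)).
  by apply/funext => z; rewrite /F /= row_mxKl row_mxKr chartK.
apply: (Ck_comp oFU oU) => // i; rewrite -(splitK i); case: (fintype.split i) => j /=.
  by apply: (Ck_ext _ (Ck_coord k _ j)); apply/funext => z; rewrite /F row_mxEl.
by apply: (Ck_ext _ (Ck_cst k _ (chart y y ord0 j))); apply/funext => z; rewrite /F row_mxEr.
Qed.

Lemma smooth_slice2 (f : N -> R) (x : N1) (y : N2) : smooth_at f ((x, y) : N) ->
  smooth_at (fun y' => f (x, y')) y.
Proof.
move=> [U [oU Ux Cf]].
pose F (z : 'rV[R]_n2) := row_mx (chart x x) z.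
have cF : continuous F.
  move=> z; apply: (@row_mx_continuous R n1 n2 _ (fun=> chart x x) id z).
    exact: cst_continuous.
  by move=> A.  
have oFU : open (F @^-1` U) by apply: open_comp.
exists (F @^-1` U); split=> //.
move=> k; apply: (@Ck_ext _ _ _ _ ((f \o @chinv _ _ N (x, y)) \o F)).
  by apply/funext => z; rewrite /F /= row_mxKl row_mxKr chartK.
apply: (Ck_comp oFU oU) => // i; rewrite -(splitK i); case: (fintype.split i) => j /=.
  by apply: (Ck_ext _ (Ck_cst k _ (chart x x ord0 j))); apply/funext => z; rewrite /F row_mxEl.
by apply: (Ck_ext _ (Ck_coord k _ j)); apply/funext => z; rewrite /F row_mxEr.
Qed.

(** [p] sends the line in direction [v] to a line in direction [w], so the difference quotients
    coincide term by term. *)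
Lemma derive_precomp m m' (g : 'rV[R]_m -> R) (p : 'rV[R]_m' -> 'rV[R]_m) z v w :
  (forall h : R, p (h *: v + z) = h *: w + p z) -> 'D_v (g \o p) z = 'D_w g (p z).
Proof.
move=> E; rewrite /derive.
have -> : (fun h : R => h^-1 *: ((g \o p \o shift z) (h *: v) - (g \o p) z))
        = (fun h : R => h^-1 *: ((g \o shift (p z)) (h *: w) - g (p z))).
  by apply/funext => h /=; rewrite E.
by [].
Qed.

Lemma dd_fst (f : N1 -> R) (p : N) (v : TS p) :
  dd (fun q : N => f q.1) p v = dd f p.1 (lsubmx (v : 'rV[R]_(n1 + n2))).
Proof.
rewrite /dd -[in RHS](row_mxKl (chart p.1 p.1) (chart p.2 p.2)).
by apply: derive_precomp => h; rewrite linearP.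
Qed.

Lemma dd_snd (f : N2 -> R) (p : N) (v : TS p) :
  dd (fun q : N => f q.2) p v = dd f p.2 (rsubmx (v : 'rV[R]_(n1 + n2))).
Proof.
rewrite /dd -[in RHS](row_mxKr (chart p.1 p.1) (chart p.2 p.2)).
by apply: derive_precomp => h; rewrite linearP.
Qed.

(** [v] is a sum of vectors tangent to the two factors. Smoothness enters through additivity in [v];
    each summand is then a derivative along a slice. *)
Lemma dd_prod (f : N -> R) (p : N) (v : TS p) : smooth_at f p ->
  dd f p v = dd (fun x => f (x, p.2)) p.1 (lsubmx (v : 'rV[R]_(n1 + n2)))
           + dd (fun y => f (p.1, y)) p.2 (rsubmx (v : 'rV[R]_(n1 + n2))).
Proof.
case: p v => x y v sf /=; set v1 := lsubmx _; set v2 := rsubmx _.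
have E : (v : 'rV[R]_(n1 + n2)) = 1 *: row_mx v1 0 + row_mx 0 v2.
  by rewrite scale1r add_row_mx addr0 add0r hsubmxK.
rewrite {1}E dd_linear // mul1r; congr (_ + _).
  rewrite /dd; have -> : ((fun x' => f (x', y)) \o chinv x) =
    (f \o @chinv _ _ N (x, y)) \o (fun z => row_mx z (chart y y)).
    by apply/funext => z /=; rewrite row_mxKl row_mxKr chartK.
  symmetry; apply: derive_precomp => h.
  by rewrite scale_row_mx add_row_mx scaler0 add0r.
rewrite /dd; have -> : ((fun y' => f (x, y')) \o chinv y) =
  (f \o @chinv _ _ N (x, y)) \o (fun z => row_mx (chart x x) z).
  by apply/funext => z /=; rewrite row_mxKl row_mxKr chartK.
symmetry; apply: derive_precomp => h.
by rewrite scale_row_mx add_row_mx scaler0 add0r.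
Qed.

Lemma chart_comp_prod (p q : N) (v : TS q) :
  chart_comp p v = row_mx (chart_comp p.1 (lsubmx (v : 'rV[R]_(n1 + n2)) : TS q.1))
                          (chart_comp p.2 (rsubmx (v : 'rV[R]_(n1 + n2)) : TS q.2)).
Proof.
apply/rowP => i; rewrite -(splitK i); case: (fintype.split i) => j /=.
  rewrite row_mxEl !mxE -dd_fst; apply: dd_eq => r.
  by rewrite -[chart p r]/(row_mx _ _) row_mxEl.
rewrite row_mxEr !mxE -dd_snd; apply: dd_eq => r.
by rewrite -[chart p r]/(row_mx _ _) row_mxEr.
Qed.

Lemma coordf_prod (p q : N) (v : TS p) :
  coordf p v q = row_mx (coordf p.1 (lsubmx (v : 'rV[R]_(n1 + n2)) : TS p.1) q.1)
                        (coordf p.2 (rsubmx (v : 'rV[R]_(n1 + n2)) : TS p.2) q.2).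
Proof.
apply/rowP => i; rewrite -(splitK i); case: (fintype.split i) => j /=.
  rewrite row_mxEl !mxE.
  rewrite -[in RHS](row_mxKl (chart p.1 q.1) (chart p.2 q.2)).
  have -> : (fun z => chart q (chinv p z) ord0 (unsplit (inl j))) =
     (fun z => chart q.1 (chinv p.1 z) ord0 j) \o lsubmx.
    by apply/funext => z; rewrite -[chart q _]/(row_mx _ _) row_mxEl.
  by apply: derive_precomp => h; rewrite linearP.
rewrite row_mxEr !mxE.
rewrite -[in RHS](row_mxKr (chart p.1 q.1) (chart p.2 q.2)).
have -> : (fun z => chart q (chinv p z) ord0 (unsplit (inr j))) =
   (fun z => chart q.2 (chinv p.2 z) ord0 j) \o rsubmx.
  by apply/funext => z; rewrite -[chart q _]/(row_mx _ _) row_mxEr.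
by apply: derive_precomp => h; rewrite linearP.
Qed.

End ProductCalculus.

(** * Smooth linear systems and vector-valued functions *)

Section SmoothMatrices.
Context {R : realType} {n : nat} {N : manifold R n}.

Definition smooth_mx r m (M : N -> 'M[R]_(r, m)) x : Prop :=
  forall i j, smooth_at (fun y => M y i j) x.

Lemma smooth_mulmx r m l (M : N -> 'M[R]_(r, m)) (M' : N -> 'M[R]_(m, l)) x :
  smooth_mx M x -> smooth_mx M' x -> smooth_mx (fun y => M y *m M' y) x.
Proof.
move=> sM sM' i j.
apply: (@smooth_congr _ _ _ (fun y => \sum_k M y i k * M' y k j)).
  by near=> y; rewrite mxE.
by apply: smooth_sum => k _; apply: smoothM.
Unshelve. all: by end_near. Qed.

Lemma smooth_cst_mx r m (M : 'M[R]_(r, m)) x : smooth_mx (fun=> M) x.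
Proof. by move=> i j; exact: smooth_cst. Qed.

Lemma smooth_det r (M : N -> 'M[R]_r) x : smooth_mx M x ->
  smooth_at (fun y => \det (M y)) x.
Proof.
move=> sM; apply: smooth_sum => s _; apply: smoothM; first exact: smooth_cst.
by apply: smooth_prod.
Qed.

(** Cramer's rule: cofactors over a determinant that stays nonzero near [x]. *)
Lemma smooth_invmx r (M : N -> 'M[R]_r) x : smooth_mx M x -> M x \in unitmx ->
  smooth_mx (fun y => invmx (M y)) x /\ \forall y \near x, M y \in unitmx.
Proof.
move=> sM uM; have d0 : \det (M x) != 0 by rewrite -unitfE.
have nd := smooth_neq0_near (smooth_det sM) d0.
have nu : \forall y \near x, M y \in unitmx.
  by near=> y; rewrite unitmxE unitfE; near: y.
split=> // i j.
apply: (@smooth_congr _ _ _ (fun y => (\det (M y))^-1 * (\adj (M y)) i j)).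
  near=> y; have uy : M y \in unitmx by near: y.
  by rewrite /invmx uy [RHS]mxE.
apply: smoothM; first by apply: smoothV => //; exact: smooth_det.
apply: (@smooth_congr _ _ _ (fun y => (-1) ^+ (j + i) * \det (row' j (col' i (M y))))).
  by near=> y; rewrite mxE.
apply: smoothM; first exact: smooth_cst.
apply: smooth_det => a b; apply: (@smooth_congr _ _ _ (fun y => M y (lift j a) (lift i b))).
  by near=> y; rewrite !mxE.
exact: sM.
Unshelve. all: by end_near. Qed.

(** A right inverse [K] of [M x] is kept constant: [M y *m K] is the identity at [x], hence
    invertible nearby, and [c] is recovered from [c *m M]. *)
Lemma smooth_solve r m (M : N -> 'M[R]_(r, m)) (c : N -> 'rV[R]_r) x :
  smooth_mx M x -> row_free (M x) -> smooth_mx (fun y => c y *m M y) x ->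
  smooth_mx c x.
Proof.
move=> sM /row_freeP [K MK] sb.
have sA : smooth_mx (fun y => M y *m K) x by apply: smooth_mulmx => //; exact: smooth_cst_mx.
have [sI nu] : smooth_mx (fun y => invmx (M y *m K)) x /\ \forall y \near x, M y *m K \in unitmx.
  by apply: smooth_invmx => //; rewrite MK unitmx1.
move=> i j; apply: (@smooth_congr _ _ _ (fun y => (c y *m M y *m K *m invmx (M y *m K)) i j)).
  near=> y; have uy : M y *m K \in unitmx by near: y.
  by rewrite -(mulmxA (c y)) mulmxK.
apply: smooth_mulmx => //; apply: smooth_mulmx => //; exact: smooth_cst_mx.
Unshelve. all: by end_near. Qed.

End SmoothMatrices.

Section VectorValued.
Context {R : realType} {n : nat} {N : manifold R n}.
Implicit Types V W : vectType R.

(** Functionals separate points; this reduces identities between vectors to scalar ones that [ring]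
    decides. *)
Lemma hom_ext V (u w : V) : (forall l : 'Hom(V, R^o), l u = l w) -> u = w.
Proof.
move=> H; rewrite (coord_vbasis (memvf u)) (coord_vbasis (memvf w)).
apply: eq_bigr => i _; congr (_ *: _).
have := H (linfun (coord (vbasis {:V}) i : V -> R^o)).
by rewrite !lfunE.
Qed.

Lemma smoothv_coordP V (f : N -> V) x :
  (forall i, smooth_at (fun y => coord (vbasis {:V}) i (f y)) x) <-> smoothv_at f x.
Proof.
split=> [sf l|sf i].
  apply: (@smooth_congr _ _ _ (fun y => \sum_i coord (vbasis {:V}) i (f y) * (l (vbasis {:V})`_i : R))).
    near=> y; rewrite {2}(coord_vbasis (memvf (f y))) linear_sum.
    by apply: eq_bigr => i _; rewrite linearZ.
  by apply: smooth_sum => i _; apply: smoothM; [exact: sf|exact: smooth_cst].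
have := sf (linfun (coord (vbasis {:V}) i : V -> R^o)).
by apply: smooth_congr; near=> y; rewrite lfunE.
Unshelve. all: by end_near. Qed.

(** [ddv] is defined through a chosen basis; together with [hom_ext] this characterizes it
    independently of the basis. *)
Lemma hom_ddv V (f : N -> V) x (v : TS x) (l : 'Hom(V, R^o)) : smoothv_at f x ->
  l (ddv f x v) = dd (fun y => l (f y)) x v.
Proof.
move=> sf; rewrite /ddv linear_sum.
transitivity (dd (fun y => \sum_(i < \dim {:V}) (l (vbasis {:V})`_i : R) * coord (vbasis {:V}) i (f y)) x v).
  have sc i : smooth_at (fun y => coord (vbasis {:V}) i (f y)) x.
    by apply/smoothv_coordP: i.
  rewrite dd_sum; last by move=> i _; apply: smoothM => //; exact: smooth_cst.
  by apply: eq_bigr => i _; rewrite linearZ /= ddZ // mulrC.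
apply: dd_eq => y; rewrite {2}(coord_vbasis (memvf (f y))) linear_sum.
by apply: eq_bigr => i _; rewrite linearZ /= mulrC.
Qed.

Lemma smoothv_hom V W (g : 'Hom(V, W)) (f : N -> V) x : smoothv_at f x ->
  smoothv_at (fun y => g (f y)) x.
Proof.
by move=> sf l; have := sf (l \o g)%VF; apply: smooth_congr; near=> y; rewrite comp_lfunE.
Unshelve. all: by end_near. Qed.

Lemma ddv_hom V W (g : 'Hom(V, W)) (f : N -> V) x (v : TS x) : smoothv_at f x ->
  g (ddv f x v) = ddv (fun y => g (f y)) x v.
Proof.
move=> sf; apply: hom_ext => l.
rewrite hom_ddv; last exact: smoothv_hom.
rewrite -comp_lfunE hom_ddv //; apply: dd_eq => y; by rewrite comp_lfunE.
Qed.

Lemma smoothvD V (f g : N -> V) x : smoothv_at f x -> smoothv_at g x ->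
  smoothv_at (fun y => f y + g y) x.
Proof.
move=> sf sg l; apply: smooth_congr (smoothD (sf l) (sg l)).
by near=> y; rewrite linearD.
Unshelve. all: by end_near. Qed.

Lemma smoothvZ V (a : N -> R) (f : N -> V) x : smooth_at a x -> smoothv_at f x ->
  smoothv_at (fun y => a y *: f y) x.
Proof.
move=> sa sf l; apply: smooth_congr (smoothM sa (sf l)).
by near=> y; rewrite linearZ.
Unshelve. all: by end_near. Qed.

Lemma smoothv_cst V (c : V) x : smoothv_at (fun _ : N => c) x.
Proof. by move=> l; exact: smooth_cst. Qed.

Lemma smoothv_sum V (I : Type) (r : seq I) (P : pred I) (F : I -> N -> V) x :
  (forall i, P i -> smoothv_at (F i) x) ->
  smoothv_at (fun y => \sum_(i <- r | P i) F i y) x.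
Proof.
move=> sF l; apply: (@smooth_congr _ _ _ (fun y => \sum_(i <- r | P i) (l (F i y) : R))).
  by near=> y; rewrite linear_sum.
by apply: smooth_sum => i Pi; exact: sF.
Unshelve. all: by end_near. Qed.

Lemma smoothv_congr V (f g : N -> V) x : {near x, f =1 g} -> smoothv_at f x ->
  smoothv_at g x.
Proof.
move=> fg sf l; apply: smooth_congr (sf l).
by near=> y; congr (l _); near: y.
Unshelve. all: by end_near. Qed.

Lemma ddv_eq V (f g : N -> V) x (v : TS x) : f =1 g -> ddv f x v = ddv g x v.
Proof. by move=> fg; congr (ddv _ x v); apply/funext. Qed.

Lemma ddvD V (f g : N -> V) x (v : TS x) : smoothv_at f x -> smoothv_at g x ->
  ddv (fun y => f y + g y) x v = ddv f x v + ddv g x v.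
Proof.
move=> sf sg; apply: hom_ext => l.
rewrite (hom_ddv _ _ (smoothvD sf sg)) linearD /= (hom_ddv _ _ sf) (hom_ddv _ _ sg).
transitivity (dd (fun y => l (f y) + l (g y)) x v); last exact: ddD (sf l) (sg l).
by apply: dd_eq => y; rewrite linearD.
Qed.

Lemma ddvZ V (a : N -> R) (f : N -> V) x (v : TS x) : smooth_at a x -> smoothv_at f x ->
  ddv (fun y => a y *: f y) x v = a x *: ddv f x v + dd a x v *: f x.
Proof.
move=> sa sf; apply: hom_ext => l.
rewrite (hom_ddv _ _ (smoothvZ sa sf)) linearD !linearZ /= (hom_ddv _ _ sf).
transitivity (dd (fun y => a y * l (f y)) x v).
  by apply: dd_eq => y; rewrite linearZ.
by rewrite [LHS](ddM v sa (sf l)) [X in _ + X]mulrC.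
Qed.

Lemma ddv_cst V (c : V) x (v : TS x) : ddv (fun _ : N => c) x v = 0.
Proof. by rewrite /ddv big1 // => i _; rewrite dd_cst scale0r. Qed.

Lemma ddv_linear V (f : N -> V) x (a : R) (u v : TS x) : smoothv_at f x ->
  ddv f x (a *: u + v) = a *: ddv f x u + ddv f x v.
Proof.
move=> sf; apply: hom_ext => l; rewrite (hom_ddv _ _ sf) linearP /= !(hom_ddv _ _ sf).
by rewrite dd_linear //; exact: sf.
Qed.

Lemma ddv0 V (f : N -> V) x : smoothv_at f x -> ddv f x 0 = 0.
Proof.
move=> sf; have := ddv_linear (-1) 0 0 sf.
by rewrite scaler0 addr0 scaleN1r addNr.
Qed.

End VectorValued.

(** * Vector bundles *)

Section Frames.
Context {R : realType} {n : nat} {N : manifold R n}.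
Variable B : bundle N.

Definition local_frame (U : set N) r (e : 'I_r -> sect B) : Prop :=
  [/\ open U, forall y, U y -> basis_of {:B y} (sec_frame e y)
    & forall (s : sect B) y, U y ->
          smooth_sec s y <->
          forall i, smooth_at (fun z => coord (sec_frame e z) i (s z)) y].

Lemma sec_frame_nth r (e : 'I_r -> sect B) y (i : 'I_r) : (sec_frame e y)`_i = e i y.
Proof. by rewrite -tnth_nth tnth_mktuple. Qed.

Lemma frame_basisP r (e : 'I_r -> sect B) y (D : {vspace B y}) :
  basis_of D (sec_frame e y) <->
  [/\ forall i, e i y \in D,
      forall k : 'I_r -> R, \sum_i k i *: e i y = 0 -> forall i, k i = 0
    & forall v, v \in D -> exists k : 'I_r -> R, v = \sum_i k i *: e i y].
Proof.
split=> [bD|[eD inde spane]].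
  have [sp fr] := andP bD; split.
  - by move=> i; rewrite -sec_frame_nth -(eqP sp) memv_span // mem_nth // size_tuple.
  - move=> k k0; apply: (elimT freeP fr k); rewrite -[RHS]k0.
    by apply: eq_bigr => i _; rewrite sec_frame_nth.
  - move=> v vD; exists (fun i => coord (sec_frame e y) i v).
    rewrite {1}(coord_basis bD vD).
    by apply: eq_bigr => i _; rewrite sec_frame_nth.
apply/andP; split.
  rewrite eqEsubv; apply/andP; split.
    by apply/span_subvP => v /mapP [i _ ->].
  apply/subvP => v /spane [k ->]; apply: memv_suml => i _; apply: memvZ.
  by rewrite -sec_frame_nth memv_span // mem_nth // size_tuple.
apply/freeP => k k0; apply: inde; rewrite -[RHS]k0.
by apply: eq_bigr => i _; rewrite sec_frame_nth.
Qed.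

Section OneFrame.
Variables (U : set N) (r : nat) (e : 'I_r -> sect B).
Hypothesis fr : local_frame U e.

Lemma frame_sum y (v : B y) : U y ->
  v = \sum_i coord (sec_frame e y) i v *: e i y.
Proof.
move=> Uy; have [_ /(_ y Uy) bU _] := fr.
rewrite {1}(coord_basis bU (memvf v)).
by apply: eq_bigr => i _; rewrite sec_frame_nth.
Qed.

Lemma frame_coord_sum y (k : 'I_r -> R) i : U y ->
  coord (sec_frame e y) i (\sum_j k j *: e j y) = k i.
Proof.
move=> Uy; have [_ /(_ y Uy) /andP [_ fre] _] := fr.
rewrite -[RHS](coord_sum_free k i fre); congr (coord _ _ _).
by apply: eq_bigr => j _; rewrite sec_frame_nth.
Qed.

Lemma near_frame y : U y -> \forall z \near y, U z.
Proof. by move=> Uy; have [oU _ _] := fr; apply: open_nbhs_nbhs. Qed.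

Lemma frame_smooth y i : U y -> smooth_sec (e i) y.
Proof.
move=> Uy; have [_ _ /(_ (e i) y Uy) H] := fr; apply/H => j.
apply: (@smooth_congr _ _ _ (fun _ => (i == j)%:R)); last exact: smooth_cst.
near=> z; have Uz : U z by near: z; exact: near_frame Uy.
rewrite -[e i z](_ : \sum_k (k == i)%:R *: e k z = _).
  by rewrite frame_coord_sum // eq_sym.
rewrite (bigD1 i) //= eqxx scale1r big1 ?addr0 // => k /negbTE ->.
by rewrite scale0r.
Unshelve. all: by end_near. Qed.

Lemma frame_smooth_sum (s : sect B) (c : 'I_r -> N -> R) y : U y ->
  (forall i, smooth_at (c i) y) ->
  (\forall z \near y, s z = \sum_i c i z *: e i z) -> smooth_sec s y.
Proof.
move=> Uy sc ns; have [_ _ /(_ s y Uy) H] := fr; apply/H => j.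
apply: smooth_congr (sc j); near=> z.
have Uz : U z by near: z; exact: near_frame Uy.
have -> : s z = \sum_i c i z *: e i z by near: z.
by rewrite frame_coord_sum.
Unshelve. all: by end_near. Qed.

End OneFrame.

Hypothesis hB : is_vector_bundle B.

Lemma exists_frame x : exists (U : set N) r (e : 'I_r -> sect B),
  local_frame U e /\ U x.
Proof. by have [U [r [e [oU Ux bU sU]]]] := hB x; exists U, r, e. Qed.

Lemma smooth_sec_congr (s t : sect B) x : (\forall y \near x, s y = t y) ->
  smooth_sec s x -> smooth_sec t x.
Proof.
move=> st ss; have [U [r [e [fr Ux]]]] := exists_frame x.
have [_ _ H] := fr; apply: (frame_smooth_sum fr Ux ((H s x Ux).1 ss)).
near=> y; have Uy : U y by near: y; exact: (near_frame fr Ux).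
by rewrite -(frame_sum fr (s y) Uy); apply/esym; near: y.
Unshelve. all: by end_near. Qed.

Lemma smooth_secD (s t : sect B) x : smooth_sec s x -> smooth_sec t x ->
  smooth_sec (fun y => s y + t y) x.
Proof.
move=> ss st; have [U [r [e [fr Ux]]]] := exists_frame x; have [_ _ H] := fr.
apply: (frame_smooth_sum fr Ux
  (fun i => smoothD ((H s x Ux).1 ss i) ((H t x Ux).1 st i))).
near=> y; have Uy : U y by near: y; exact: (near_frame fr Ux).
rewrite {1}(frame_sum fr (s y) Uy) {1}(frame_sum fr (t y) Uy) -big_split /=.
by apply: eq_bigr => i _; rewrite scalerDl.
Unshelve. all: by end_near. Qed.

Lemma smooth_secZ (f : N -> R) (s : sect B) x : smooth_at f x -> smooth_sec s x ->
  smooth_sec (fun y => f y *: s y) x.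
Proof.
move=> sf ss; have [U [r [e [fr Ux]]]] := exists_frame x; have [_ _ H] := fr.
apply: (frame_smooth_sum fr Ux (fun i => smoothM sf ((H s x Ux).1 ss i))).
near=> y; have Uy : U y by near: y; exact: (near_frame fr Ux).
rewrite {1}(frame_sum fr (s y) Uy) scaler_sumr.
by apply: eq_bigr => i _; rewrite scalerA.
Unshelve. all: by end_near. Qed.

Lemma smooth_sec0 x : smooth_sec (fun y => 0 : B y) x.
Proof.
have [U [r [e [fr Ux]]]] := exists_frame x.
apply: (frame_smooth_sum fr Ux (fun i => smooth_cst 0 x)).
by near=> y; rewrite big1 // => i _; rewrite scale0r.
Unshelve. all: by end_near. Qed.

Lemma smooth_sec_sum (I : Type) (r : seq I) (P : pred I) (F : I -> sect B) x :
  (forall i, P i -> smooth_sec (F i) x) ->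
  smooth_sec (fun y => \sum_(i <- r | P i) F i y) x.
Proof.
move=> sF; elim: r => [|i r IH].
  by apply: smooth_sec_congr (smooth_sec0 x); near=> y; rewrite big_nil.
case Pi: (P i); last first.
  by apply: smooth_sec_congr IH; near=> y; rewrite big_cons Pi.
by apply: smooth_sec_congr (smooth_secD (sF i Pi) IH); near=> y; rewrite big_cons Pi.
Unshelve. all: by end_near. Qed.

Lemma smooth_secB (s t : sect B) x : smooth_sec s x -> smooth_sec t x ->
  smooth_sec (fun y => s y - t y) x.
Proof.
move=> ss st; have := smooth_secD ss (smooth_secZ (smooth_cst (-1) x) st).
by apply: smooth_sec_congr; near=> y; rewrite scaleN1r.
Unshelve. all: by end_near. Qed.

(** The functionals are jointly injective on the fibre at [x], so the matrix of their values on a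
    frame has full row rank there, and the frame coordinates of [s] solve a smooth linear system. *)
Lemma smooth_lift m (l : 'I_m -> forall y, B y -> R) (s : sect B) x :
  (\forall y \near x, forall j (a : R) u v, l j y (a *: u + v) = a * l j y u + l j y v) ->
  (forall j t, smooth_sec t x -> smooth_at (fun y => l j y (t y)) x) ->
  (forall v : B x, (forall j, l j x v = 0) -> v = 0) ->
  (forall j, smooth_at (fun y => l j y (s y)) x) -> smooth_sec s x.
Proof.
move=> nl sl il ss; have [U [r [e [fr Ux]]]] := exists_frame x.
have [_ _ H] := fr; apply/(H s x Ux) => i.
have lsum y (ll : forall j (a : R) u v, l j y (a *: u + v) = a * l j y u + l j y v) j
    (k : 'I_r -> R) : l j y (\sum_i k i *: e i y) = \sum_i k i * l j y (e i y).
  elim/big_rec2: _ => [|a b c _ <-]; last by rewrite ll.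
  have := ll j (-1) 0 0; rewrite scaler0 addr0 mulN1r => E.
  by rewrite E addNr.
pose M y := \matrix_(i < r, j < m) l j y (e i y).
pose c y := \row_(i < r) coord (sec_frame e y) i (s y).
have sM : smooth_mx M x.
  move=> a b; apply: (@smooth_congr _ _ _ (fun y => l b y (e a y))).
    by near=> y; rewrite mxE.
  by apply: sl; exact: (frame_smooth fr _ Ux).
have fM : row_free (M x).
  apply: inj_row_free => v vM; apply/rowP => a; rewrite mxE.
  have : \sum_i v ord0 i *: e i x = 0.
    apply: il => j; rewrite (lsum x (nbhs_singleton nl)).
    have := congr1 (fun A : 'rV_m => A ord0 j) vM.
    rewrite !mxE => E; rewrite -[RHS]E; by apply: eq_bigr => b _; rewrite mxE.
  move=> /(congr1 (coord (sec_frame e x) a)).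
  rewrite (frame_coord_sum fr (fun i => v ord0 i)) // => ->.
  exact: linear0.
have sb : smooth_mx (fun y => c y *m M y) x.
  move=> a b; rewrite ord1; apply: smooth_congr (ss b); near=> y.
  have Uy : U y by near: y; exact: (near_frame fr Ux).
  rewrite {1}(frame_sum fr (s y) Uy) lsum; last by near: y.
  by rewrite mxE; apply: eq_bigr => d _; rewrite !mxE.
have := smooth_solve sM fM sb ord0 i.
by apply: smooth_congr; near=> y; rewrite mxE.
Unshelve. all: by end_near. Qed.

End Frames.

(** * Pullback bundles *)

Section Pullback.
Context {R : realType} {m n : nat} {M : manifold R m} {N : manifold R n}.
Variables (g : M -> N) (B : bundle N).
Hypothesis cg : continuous g.
Hypothesis sg : forall (f : N -> R) q, smooth_at f (g q) -> smooth_at (fun p => f (g p)) q.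
Hypothesis hB : is_vector_bundle B.

Lemma pullback_sec (s : sect B) q : smooth_sec s (g q) ->
  @smooth_sec R m M (pullback_bundle g B) (fun p => s (g p)) q.
Proof.
move=> ss; exists 1%N, (fun=> s), (fun _ _ => 1); split=> //.
  by move=> _; exact: smooth_cst.
by near=> p; rewrite big_ord1 scale1r.
Unshelve. all: by end_near. Qed.

Lemma pullback_functional (l : forall y, B y -> R) (s : sect (pullback_bundle g B)) q :
  (forall y (a : R) u v, l y (a *: u + v) = a * l y u + l y v) ->
  (forall t, smooth_sec t (g q) -> smooth_at (fun y => l y (t y)) (g q)) ->
  smooth_sec s q -> smooth_at (fun p => l (g p) (s p)) q.
Proof.
move=> ll sl [r [e [c [se sc E]]]].
have l0 y : l y 0 = 0.
  have := ll y (-1) 0 0; rewrite scaler0 addr0 mulN1r => E'.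
  by rewrite E' addNr.
apply: (@smooth_congr _ _ _ (fun p => \sum_i c i p * l (g p) (e i (g p)))).
  near=> p; have -> : s p = \sum_i c i p *: e i (g p) by near: p.
  elim/big_rec2: _ => [|a b d _ ->]; first by rewrite l0.
  by rewrite ll.
apply: smooth_sum => i _; apply: smoothM; first exact: sc.
apply: (@sg (fun y => l y (e i y))); exact: sl.
Unshelve. all: by end_near. Qed.

(** Functionals such as chart components are linear over a chart domain only. Replacing [l] by 0
    outside [U] makes it linear everywhere without changing its germ at [g q]. *)
Lemma pullback_functional_near (l : forall y, B y -> R) (U : set N)
    (s : sect (pullback_bundle g B)) q : open U -> U (g q) ->
  (forall y (a : R) u v, U y -> l y (a *: u + v) = a * l y u + l y v) ->
  (forall t, smooth_sec t (g q) -> smooth_at (fun y => l y (t y)) (g q)) ->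
  smooth_sec s q -> smooth_at (fun p => l (g p) (s p)) q.
Proof.
move=> oU Uq ll sl ss; pose l' y (u : B y) := if `[<U y>] then l y u else 0.
have nU : \forall y \near g q, U y by exact: open_nbhs_nbhs.
have nU' : \forall p \near q, U (g p) by exact: (cg nU).
apply: (@smooth_congr _ _ _ (fun p => l' (g p) (s p))).
  near=> p; rewrite /l' asboolT //; near: p; exact: nU'.
apply: pullback_functional => //.
- move=> y a u v; rewrite /l'; case: asboolP => Uy; first exact: ll.
  by rewrite mulr0 addr0.
- move=> t /sl; apply: smooth_congr; near=> y; rewrite /l' asboolT //.
  near: y; exact: nU.
Unshelve. all: by end_near. Qed.

Lemma pullback_frame U r (e : 'I_r -> sect B) : local_frame U e ->
  local_frame (B := pullback_bundle g B) (g @^-1` U) (fun i p => e i (g p)).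
Proof.
move=> fr; have [oU bU sU] := fr; split.
- by apply: open_comp.
- by move=> q Uq; exact: bU.
- move=> s q Uq; split=> [ss i|sc].
  + apply: (@pullback_functional_near (fun y u => coord (sec_frame e y) i u) U) => //.
    * by move=> y a u v _; rewrite linearP.
    * by move=> t st; exact: (sU t (g q) Uq).1.
  + exists r, e, (fun i p => coord (sec_frame e (g p)) i (s p)); split=> //.
      by move=> i; exact: (frame_smooth fr).
    have oU' : open (g @^-1` U) by apply: open_comp.
    near=> p; apply: (frame_sum fr (s p)).
    by near: p; apply: open_nbhs_nbhs.
Unshelve. all: by end_near. Qed.

Lemma pullback_vb : is_vector_bundle (pullback_bundle g B).
Proof.
move=> q; have [U [r [e [fr Ux]]]] := exists_frame hB (g q).
by have [? ? ?] := pullback_frame fr; exists (g @^-1` U), r, (fun i p => e i (g p)).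
Qed.

End Pullback.

(** * Direct sums of bundles *)

Section SumBundle.
Context {R : realType} {n : nat} {N : manifold R n}.
Variables B C : bundle N.

Definition sum_frame r1 r2 (e : 'I_r1 -> sect B) (f : 'I_r2 -> sect C)
    (i : 'I_(r1 + r2)) : sect (sum_bundle B C) :=
  match fintype.split i with
  | inl j => fun y => (e j y, 0)
  | inr j => fun y => (0, f j y)
  end.

Lemma sum_frame_sum r1 r2 (e : 'I_r1 -> sect B) (f : 'I_r2 -> sect C) k y :
  \sum_(i < r1 + r2) k i *: sum_frame e f i y =
  (\sum_(i < r1) k (lshift r2 i) *: e i y, \sum_(i < r2) k (rshift r1 i) *: f i y).
Proof.
rewrite big_split_ord /=.
have -> : \sum_(i < r1) k (lshift r2 i) *: sum_frame e f (lshift r2 i) y =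
    (\sum_(i < r1) k (lshift r2 i) *: e i y, 0).
  elim/big_rec2: _ => // i a b _ ->.
  rewrite /sum_frame (unsplitK (inl i)).
  by apply/eqP; rewrite xpair_eqE /= scaler0 addr0 !eqxx.
have -> : \sum_(i < r2) k (rshift r1 i) *: sum_frame e f (rshift r1 i) y =
    (0, \sum_(i < r2) k (rshift r1 i) *: f i y).
  elim/big_rec2: _ => // i a b _ ->.
  rewrite /sum_frame (unsplitK (inr i)).
  by apply/eqP; rewrite xpair_eqE /= scaler0 addr0 !eqxx.
by apply/eqP; rewrite xpair_eqE /= addr0 add0r !eqxx.
Qed.

Lemma sum_local_frame U W r1 r2 (e : 'I_r1 -> sect B) (f : 'I_r2 -> sect C) :
  local_frame U e -> local_frame W f -> local_frame (U `&` W) (sum_frame e f).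
Proof.
move=> fe ff; have [oU bU sU] := fe; have [oW bW sW] := ff.
have bas y : (U `&` W) y -> basis_of {:sum_bundle B C y} (sec_frame (sum_frame e f) y).
  move=> [Uy Wy]; have [_ ie se] := (frame_basisP _ _).1 (bU y Uy).
  have [_ iff_ sf] := (frame_basisP _ _).1 (bW y Wy).
  apply/frame_basisP; split=> [i|k|[u v] _]; first exact: memvf.
    rewrite sum_frame_sum => -[k1 k2] i; rewrite -(splitK i).
    case: (fintype.split i) => j /=.
      exact: (ie (fun j => k (lshift r2 j))).
    exact: (iff_ (fun j => k (rshift r1 j))).
  have [k1 ->] := se u (memvf u); have [k2 ->] := sf v (memvf v).
  exists (fun i => match fintype.split i with inl j => k1 j | inr j => k2 j end).
  rewrite sum_frame_sum; congr pair; apply: eq_bigr => i _.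
    by rewrite (unsplitK (inl i)).
  by rewrite (unsplitK (inr i)).
have cE y (u : sum_bundle B C y) : (U `&` W) y ->
    (forall i, coord (sec_frame (sum_frame e f) y) (lshift r2 i) u = coord (sec_frame e y) i u.1)
 /\ (forall i, coord (sec_frame (sum_frame e f) y) (rshift r1 i) u = coord (sec_frame f y) i u.2).
  move=> UWy; have fr' := bas y UWy; have /andP [_ free_] := fr'; case: UWy => Uy Wy.
  have E : u = \sum_(i < r1 + r2) coord (sec_frame (sum_frame e f) y) i u *: sum_frame e f i y.
    rewrite {1}(coord_basis fr' (memvf u)).
    by apply: eq_bigr => i _; rewrite sec_frame_nth.
  rewrite sum_frame_sum in E; split=> i; rewrite [in RHS]E /=.
    by rewrite (frame_coord_sum fe (fun i => coord _ (lshift r2 i) u)).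
  by rewrite (frame_coord_sum ff (fun i => coord _ (rshift r1 i) u)).
split=> //; first exact: openI.
move=> s y UWy; have [Uy Wy] := UWy.
have nUW : \forall z \near y, (U `&` W) z.
  by apply: open_nbhs_nbhs; split=> //; exact: openI.
split=> [[s1 s2] i|sc].
  rewrite -(splitK i); case: (fintype.split i) => j /=.
    apply: smooth_congr ((sU _ y Uy).1 s1 j); near=> z.
    by rewrite (cE z (s z) _).1 //; near: z.
  apply: smooth_congr ((sW _ y Wy).1 s2 j); near=> z.
  by rewrite (cE z (s z) _).2 //; near: z.
split.
  apply/(sU _ y Uy) => j; apply: smooth_congr (sc (lshift r2 j)); near=> z.
  by rewrite (cE z (s z) _).1 //; near: z.
apply/(sW _ y Wy) => j; apply: smooth_congr (sc (rshift r1 j)); near=> z.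
by rewrite (cE z (s z) _).2 //; near: z.
Unshelve. all: by end_near. Qed.

Lemma sum_vb : is_vector_bundle B -> is_vector_bundle C ->
  is_vector_bundle (sum_bundle B C).
Proof.
move=> hB hC x; have [U [r1 [e [fe Ux]]]] := exists_frame hB x.
have [W [r2 [f [ff Wx]]]] := exists_frame hC x.
by have [? ? ?] := sum_local_frame fe ff; exists (U `&` W), (r1 + r2)%N, (sum_frame e f).
Qed.

End SumBundle.

(** * Subbundles and kernels *)

Section SubBundles.
Context {R : realType} {n : nat} {N : manifold R n}.
Variable B : bundle N.
Hypothesis hB : is_vector_bundle B.

(** Independence at [x] gives the matrix of the [e i] in a frame full row rank there, as
    [smooth_solve] requires. *)
Lemma frame_coords_smooth r (e : 'I_r -> sect B) (c : 'I_r -> N -> R) x :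
  (forall i, smooth_sec (e i) x) ->
  (forall k : 'I_r -> R, \sum_i k i *: e i x = 0 -> forall i, k i = 0) ->
  smooth_sec (fun y => \sum_i c i y *: e i y) x -> forall i, smooth_at (c i) x.
Proof.
move=> se fe ss i; have [U [r' [f [fr Ux]]]] := exists_frame hB x.
have [_ _ H] := fr.
pose M y := \matrix_(a < r, b < r') coord (sec_frame f y) b (e a y).
pose C y := \row_(a < r) c a y.
have sM : smooth_mx M x.
  move=> a b; apply: smooth_congr ((H _ x Ux).1 (se a) b).
  by near=> y; rewrite mxE.
have fM : row_free (M x).
  apply: inj_row_free => v vM; apply/rowP => a; rewrite mxE.
  apply: (fe (fun a => v ord0 a)).
  rewrite (frame_sum fr (\sum_i v ord0 i *: e i x) Ux) big1 // => b _.
  rewrite linear_sum -[X in X *: _](_ : (v *m M x) ord0 b = _).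
    by rewrite vM mxE scale0r.
  by rewrite mxE; apply: eq_bigr => d _; rewrite mxE linearZ.
have sb : smooth_mx (fun y => C y *m M y) x.
  move=> a b; rewrite ord1; apply: smooth_congr ((H _ x Ux).1 ss b).
  near=> y; rewrite linear_sum [RHS]mxE; apply: eq_bigr => d _.
  by rewrite !mxE linearZ.
have := smooth_solve sM fM sb ord0 i.
by apply: smooth_congr; near=> y; rewrite mxE.
Unshelve. all: by end_near. Qed.

Variable D : forall x, {vspace B x}.

(** The local frame of [D] is independent in [B] but does not span it, so the smoothness of
    coordinates comes from [frame_coords_smooth] and not from the frames of [B]. *)
Lemma subbundle_vb : is_subbundle D -> is_vector_bundle (subbundle D).
Proof.
move=> hD x; have [U [r [e [oU Ux se bU]]]] := hD x.
exists U, r, (fun i y => vsproj (D y) (e i y)).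
have eP y : U y -> [/\ forall i, e i y \in D y,
      forall k : 'I_r -> R, \sum_i k i *: e i y = 0 -> forall i, k i = 0
    & forall v, v \in D y -> exists k : 'I_r -> R, v = \sum_i k i *: e i y].
  by move=> Uy; exact: (frame_basisP _ _).1 (bU y Uy).
have vE y i : U y -> vsval (vsproj (D y) (e i y)) = e i y.
  by move=> /eP [eD _ _]; rewrite vsprojK.
have vsumE y (k : 'I_r -> R) : U y ->
    vsval (\sum_i k i *: vsproj (D y) (e i y)) = \sum_i k i *: e i y.
  by move=> Uy; rewrite linear_sum; apply: eq_bigr => i _; rewrite linearZ /= vE.
have bas y : U y -> basis_of {:subbundle D y}
    (sec_frame (B := subbundle D) (fun i y => vsproj (D y) (e i y)) y).
  move=> Uy; have [eD ie spe] := eP y Uy.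
  apply/frame_basisP; split=> [i|k k0|v _]; first exact: memvf.
    apply: ie; rewrite -vsumE // k0; exact: linear0.
  have [k kE] := spe (vsval v) (subvsP v); exists k.
  by apply: subvs_inj; rewrite vsumE.
split=> // s y Uy.
pose c i z := coord (sec_frame (B := subbundle D) (fun i y => vsproj (D y) (e i y)) z) i (s z).
have nU : \forall z \near y, U z by exact: open_nbhs_nbhs.
have sE : \forall z \near y, vsval (s z) = \sum_i c i z *: e i z.
  near=> z; have Uz : U z by near: z; exact: nU.
  rewrite -vsumE //; congr vsval.
  rewrite {1}(coord_basis (bas z Uz) (memvf (s z))).
  by apply: eq_bigr => i _; rewrite sec_frame_nth.
have [eD ie spe] := eP y Uy; split=> [ss|sc].
  apply: (@frame_coords_smooth r e c) => //; first by move=> i; exact: se.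
  by apply: (smooth_sec_congr hB _ ss).
have := smooth_sec_sum hB (index_enum 'I_r) (fun i (_ : true) => smooth_secZ hB (sc i) (se y Uy i)).
apply: smooth_sec_congr => //.
by near=> z; apply/esym; near: z; exact: sE.
Unshelve. all: by end_near. Qed.

(** The functionals are jointly onto, so their matrix [M x] in a frame has rank [m]. Constant
    columns [K] complete it to a matrix [T] that is invertible near [x], and the last [d] rows of
    the inverse of [T] are a frame of the kernel. *)
Lemma kernel_subbundle m (l : 'I_m -> forall y, B y -> R) :
  (forall j y (a : R) u v, l j y (a *: u + v) = a * l j y u + l j y v) ->
  (forall j t x, smooth_sec t x -> smooth_at (fun y => l j y (t y)) x) ->
  (forall y (v : B y), v \in D y <-> forall j, l j y v = 0) ->
  (forall y (w : 'I_m -> R), exists v : B y, forall j, l j y v = w j) ->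
  is_subbundle D.
Proof.
move=> ll sl Dl ol x; have [U [r [e [fr Ux]]]] := exists_frame hB x.
have [oU _ H] := fr.
have l0 j y : l j y 0 = 0.
  have := ll j y (-1) 0 0; rewrite scaler0 addr0 mulN1r => E.
  by rewrite E addNr.
have lsum j y s (k : 'I_s -> R) (f : 'I_s -> B y) :
    l j y (\sum_i k i *: f i) = \sum_i k i * l j y (f i).
  elim/big_rec2: _ => [|a b c _ <-]; first exact: l0.
  by rewrite ll.
pose M y := \matrix_(i < r, j < m) l j y (e i y).
(* The columns of [K] span a complement of the column space of [M x], so only 0 is killed by both
   matrices. The equation on [r] is substituted below to make [T] square. *)
have [d [K [Er TK]]] : exists d (K : 'M[R]_(r, d)), r = (m + d)%N /\
    forall v : 'rV_r, v *m M x = 0 -> v *m K = 0 -> v = 0.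
  have rM : \rank (M x)^T = m.
    rewrite mxrank_tr; apply/eqP; apply/row_fullP.
    have /choice [v vP] : forall i : 'I_m, exists v : B x, forall j, l j x v = (i == j)%:R.
      by move=> i; exact: ol.
    exists (\matrix_(i, j) coord (sec_frame e x) j (v i)).
    apply/matrixP => i j; rewrite !mxE -vP {1}(frame_sum fr (v i) Ux) lsum.
    by apply: eq_bigr => a _; rewrite !mxE.
  pose C := ((M x)^T)^C%MS.
  exists (\rank C), (row_base C)^T; split.
    by rewrite /C mxrank_compl rM subnKC // -rM rank_leq_col.
  move=> v vM vC.
  have full := addsmx_compl_full ((M x)^T).
  have : (1%:M <= (M x)^T + C)%MS by exact: submx_full.
  move=> /sub_addsmxP [[w1 w2] /= E].
  suff : v^T = 0 by move=> /(congr1 trmx); rewrite trmxK trmx0.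
  have CV : C *m v^T = 0.
    have /submxP [w3 Cw] : (C <= row_base C)%MS by rewrite eq_row_base.
    rewrite Cw -(mulmxA w3) -[row_base C]trmxK -trmx_mul vC.
    by rewrite trmx0 mulmx0.
  rewrite -[v^T]mul1mx E mulmxDl -(mulmxA w1) -(mulmxA w2) CV -trmx_mul vM.
  by rewrite trmx0 !mulmx0 addr0.
subst r; pose T y := row_mx (M y) K.
have sT y : U y -> smooth_mx T y.
  move=> Uy i j; rewrite -(splitK j); case: (fintype.split j) => b /=.
    apply: smooth_congr (sl b (e i) y (frame_smooth fr i Uy)).
    by near=> z; rewrite row_mxEl mxE.
  apply: smooth_congr (smooth_cst (K i b) y).
  by near=> z; rewrite row_mxEr.
have uT : T x \in unitmx.
  rewrite -row_free_unit; apply: inj_row_free => v.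
  rewrite mul_mx_row => vT; apply: TK.
    by rewrite -[LHS](row_mxKl _ (v *m K)) vT linear0.
  by rewrite -[LHS](row_mxKr (v *m M x)) vT linear0.
have [_ nuT] := smooth_invmx (sT x Ux) uT.
have : nbhs x [set y | U y /\ T y \in unitmx].
  near=> y; split; last by near: y.
  by near: y; exact: open_nbhs_nbhs.
rewrite nbhsE => -[W [oW Wx] WU].
pose f (i : 'I_d) : sect B := fun y =>
  \sum_a invmx (T y) (rshift m i) a *: e a y.
exists W, d, f; split=> //.
  move=> y Wy i; have [Uy uy] := WU y Wy.
  have [sI _] := smooth_invmx (sT y Uy) uy.
  apply: (frame_smooth_sum fr (c := fun a y => invmx (T y) (rshift m i) a)) => //.
  by near=> z.
move=> y Wy; have [Uy uy] := WU y Wy; apply/frame_basisP; split.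
- move=> i; apply/Dl => j; rewrite lsum.
  have := congr1 (fun A : 'M[R]_(m + d) => A (rshift m i) (lshift d j)) (mulVmx uy).
  rewrite !mxE eq_rlshift => E; rewrite -[RHS]E; apply: eq_bigr => a _.
  by rewrite row_mxEl mxE.
- move=> k k0 i.
  pose w : 'rV[R]_(m + d) := row_mx 0 (\row_i k i).
  have wE b : (w *m invmx (T y)) ord0 b = \sum_i k i * invmx (T y) (rshift m i) b.
    rewrite mxE big_split_ord /= big1 ?add0r; last first.
      by move=> j _; rewrite /w row_mxEl mxE mul0r.
    by apply: eq_bigr => j _; rewrite /w row_mxEr mxE.
  have : w *m invmx (T y) = 0.
    apply/rowP => a; rewrite [RHS]mxE.
    have := congr1 (coord (sec_frame e y) a) k0; rewrite [RHS]linear0 => E.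
    rewrite -[RHS]E.
    have -> : \sum_i k i *: f i y = \sum_b (w *m invmx (T y)) ord0 b *: e b y.
      rewrite (eq_bigr (fun i => \sum_a (k i * invmx (T y) (rshift m i) a) *: e a y)).
        by rewrite exchange_big /=; apply: eq_bigr => b _; rewrite -scaler_suml wE.
      move=> j _; rewrite scaler_sumr; apply: eq_bigr => b _; by rewrite scalerA.
    by rewrite (frame_coord_sum fr).
  move=> /(congr1 (fun A => A *m T y)); rewrite mulmxKV // mul0mx => w0.
  have := congr1 (fun A : 'rV[R]_(m + d) => A ord0 (rshift m i)) w0.
  by rewrite /w row_mxEr !mxE.
- move=> v /Dl vD.
  pose c : 'rV[R]_(m + d) := \row_a coord (sec_frame e y) a v.
  (* The first [m] entries of [w] are the values [l j y v], which vanish; hence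
     [c = w *m invmx (T y)] involves only the rows that form the kernel frame. *)
  pose w := c *m T y.
  exists (fun i => w ord0 (rshift m i)).
  have wl j : w ord0 (lshift d j) = 0.
    rewrite -(vD j) {1}(frame_sum fr v Uy) lsum mxE; apply: eq_bigr => a _.
    by rewrite row_mxEl !mxE.
  have cE : c = w *m invmx (T y) by rewrite mulmxK.
  rewrite {1}(frame_sum fr v Uy).
  transitivity (\sum_a c ord0 a *: e a y); first by apply: eq_bigr => a _; rewrite mxE.
  rewrite (eq_bigr (fun a => \sum_i (w ord0 (rshift m i) * invmx (T y) (rshift m i) a) *: e a y)).
    rewrite exchange_big /=; apply: eq_bigr => i _; rewrite scaler_sumr.
    by apply: eq_bigr => a _; rewrite scalerA.
  move=> a _; rewrite {1}cE mxE -scaler_suml; congr (_ *: _).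
  by rewrite big_split_ord /= big1 ?add0r // => j _; rewrite wl mul0r.
Unshelve. all: by end_near. Qed.

End SubBundles.

(** * Lie algebroids *)

Section LieAlgebroids.
Context {R : realType} {n : nat} {N : manifold R n}.
Implicit Types A : algebroid_data N.

Lemma sect_ext (B : bundle N) (s t : sect B) : (forall x, s x = t x) -> s = t.
Proof. by move=> st; apply: functional_extensionality_dep. Qed.

(** Because [D] is closed under the bracket, [vsproj] loses nothing and the inclusion [V] carries
    the induced bracket to the ambient one. It is injective on fibres, so every axiom can be checked
    after inclusion. *)
Lemma sub_algebroid_lie A (D : forall x, {vspace A x}) : is_lie_algebroid A ->
  is_lie_subalgebroid D -> is_lie_algebroid (sub_algebroid D).
Proof.
move=> [vb [sa [cl [bil [ant [jac [lei anc]]]]]]] [sD brD].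
pose V (u : sect (sub_algebroid D)) : sect A := fun y => vsval (u y).
have VG u : Gamma u -> Gamma (V u) by [].
have VD u : in_sub D (V u) by move=> x; exact: subvsP.
have brE u v : Gamma u -> Gamma v -> V (abr u v) = abr (V u) (V v).
  by move=> Gu Gv; apply: sect_ext => x; rewrite /V /= vsprojK //; exact: (brD _ _ (VG u Gu) (VG v Gv) (VD u) (VD v)).
have aE u x : anchor x (u x) = anchor x (V u x).
  rewrite /= linfun_lin // => a y z.
  by rewrite !linearP.
have maE u : map_sect anchor u = map_sect anchor (V u) by apply: sect_ext => x; exact: aE.
have cl' (u v : sect (sub_algebroid D)) : Gamma u -> Gamma v -> Gamma (abr u v).
  move=> Gu Gv x; change (smooth_sec (V (abr u v)) x); rewrite brE //.
  by apply: cl; exact: VG.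
split; first exact: subbundle_vb.
split.
  move=> s x ss; rewrite -/(map_sect anchor s) maE.
  exact: (sa (V s) x ss).
split; first exact: cl'.
split.
  move=> c u u' v Gu Gu' Gv x; apply: subvs_inj; rewrite linearP.
  change (V (abr (fun y => c *: u y + u' y) v) x = c *: V (abr u v) x + V (abr u' v) x).
  have E : V (fun y => c *: u y + u' y) = fun y => c *: V u y + V u' y.
    by apply: sect_ext => y; rewrite /V linearP.
  rewrite !brE //; first by rewrite E; apply: bil; exact: VG.
  move=> y; change (smooth_sec (V (fun y => c *: u y + u' y)) y); rewrite E.
  apply: smooth_secD => //; last exact: VG.
  by apply: smooth_secZ => //; [exact: smooth_cst|exact: VG].
split.
  move=> u v Gu Gv x; apply: subvs_inj; rewrite linearN.
  change (V (abr u v) x = - V (abr v u) x).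
  by rewrite !brE //; apply: ant; exact: VG.
split.
  move=> u v w Gu Gv Gw x; apply: subvs_inj; rewrite !linearD linear0.
  change (V (abr u (abr v w)) x + V (abr v (abr w u)) x + V (abr w (abr u v)) x = 0).
  rewrite !brE //; try exact: cl'.
  by apply: jac; exact: VG.
split.
  move=> f u v sf Gu Gv x; apply: subvs_inj; rewrite linearD !linearZ.
  have E : V (fun y => f y *: v y) = fun y => f y *: V v y.
    by apply: sect_ext => y; rewrite /V linearZ.
  change (V (abr u (fun y => f y *: v y)) x =
    f x *: V (abr u v) x + dd f x (anchor x (u x)) *: V v x).
  rewrite !brE //.
    by rewrite aE E; apply: lei => //; exact: VG.
  move=> y; change (smooth_sec (V (fun y => f y *: v y)) y); rewrite E.
  by apply: smooth_secZ => //; exact: VG.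
by move=> u v Gu Gv x; rewrite aE brE // !maE; exact: anc.
Qed.

(** * Reduction of the algebroid axioms to spanning families *)

Section Spanning.
Variable A : algebroid_data N.
Hypothesis vb : is_vector_bundle A.

(** Generation of all sections up to a function that is nonzero at [x]. The multiplier and the
    coefficients are global because the Leibniz rule is stated for global functions. *)
Definition spans_at (x : N) m (E : 'I_m -> sect A) : Prop :=
  (forall i, Gamma (E i)) /\ exists f : N -> R,
  [/\ forall y, smooth_at f y, f x != 0 &
      forall s : sect A, Gamma s -> exists c : 'I_m -> N -> R,
        (forall i y, smooth_at (c i) y) /\
        forall y, f y *: s y = \sum_i c i y *: E i y].

(** Besides sums and multiples, the property must survive division by a function nonzero at [x],
    which removes the multiplier of [spans_at]. *)
Lemma spans_ind x m (E : 'I_m -> sect A) (P : sect A -> Prop) :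
  spans_at x E ->
  P (fun y => 0) ->
  (forall s t, Gamma s -> Gamma t -> P s -> P t -> P (fun y => s y + t y)) ->
  (forall f s, (forall y, smooth_at f y) -> Gamma s -> P s -> P (fun y => f y *: s y)) ->
  (forall f s, (forall y, smooth_at f y) -> f x != 0 -> Gamma s ->
     P (fun y => f y *: s y) -> P s) ->
  (forall i, P (E i)) -> forall s, Gamma s -> P s.
Proof.
move=> [GE [f [sf fx0 fE]]] P0 PD PZ Pdiv PE s Gs.
apply: (Pdiv f) => //; have [c [sc cE]] := fE s Gs.
rewrite (sect_ext cE).
suff : P (fun y => \sum_i c i y *: E i y) /\ Gamma (fun y => \sum_i c i y *: E i y) by case.
elim: (index_enum _) => [|i r [Pr Gr]].
  have -> : (fun y => \sum_(i <- [::]) c i y *: E i y) = (fun y => 0).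
    by apply: sect_ext => y; rewrite big_nil.
  by split=> // y; exact: smooth_sec0.
have -> : (fun y => \sum_(i <- i :: r) c i y *: E i y) =
    (fun y => c i y *: E i y + \sum_(i <- r) c i y *: E i y).
  by apply: sect_ext => y; rewrite big_cons.
have Gi : Gamma (fun y => c i y *: E i y) by move=> y; apply: smooth_secZ => //; exact: GE.
split; last by move=> y; exact: smooth_secD.
by apply: PD => //; apply: PZ => //; exact: GE.
Qed.

Hypothesis sa : bundle_map_smooth (@anchor R n N A).
Hypothesis bil : forall (c : R) (u u' v : sect A), Gamma u -> Gamma u' -> Gamma v ->
     forall x, abr (fun y => c *: u y + u' y) v x
               = c *: abr u v x + abr u' v x.
Hypothesis ant : forall u v : sect A, Gamma u -> Gamma v ->
     forall x, abr u v x = - abr v u x.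
Hypothesis lei : forall (f : N -> R) (u v : sect A), (forall x, smooth_at f x) ->
     Gamma u -> Gamma v ->
     forall x, abr u (fun y => f y *: v y) x
               = f x *: abr u v x + dd f x (anchor x (u x)) *: v x.

Lemma Gamma0 : Gamma (fun y => 0 : A y).
Proof. by move=> y; exact: smooth_sec0. Qed.

Lemma GammaD (s t : sect A) : Gamma s -> Gamma t -> Gamma (fun y => s y + t y).
Proof. by move=> Gs Gt y; apply: smooth_secD. Qed.

Lemma GammaZ f (s : sect A) : (forall y, smooth_at f y) -> Gamma s ->
  Gamma (fun y => f y *: s y).
Proof. by move=> sf Gs y; apply: smooth_secZ. Qed.

Lemma abrD2 (u s t : sect A) x : Gamma u -> Gamma s -> Gamma t ->
  abr u (fun y => s y + t y) x = abr u s x + abr u t x.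
Proof.
move=> Gu Gs Gt; rewrite ant //; last exact: GammaD.
have -> : (fun y => s y + t y) = (fun y => 1 *: s y + t y).
  by apply: sect_ext => y; rewrite scale1r.
by rewrite bil // scale1r opprD -!ant.
Qed.

Lemma abr02 (u : sect A) x : Gamma u -> abr u (fun y => 0) x = 0.
Proof.
move=> Gu; have := @abrD2 u (fun y => 0) (fun y => 0) x Gu Gamma0 Gamma0.
have -> : (fun y => 0 + 0 : A y) = (fun y => 0 : A y).
  by apply: sect_ext => y; rewrite addr0.
by move/eqP; rewrite -subr_eq0 opprD addNKr oppr_eq0 => /eqP.
Qed.

Lemma smooth_anchor_dd f (u : sect A) : (forall y, smooth_at f y) -> Gamma u ->
  forall x, smooth_at (fun y => dd f y (anchor y (u y))) x.
Proof. by move=> sf Gu x; apply: smooth_dd => //; exact: (sa (Gu x)). Qed.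

(** By the Leibniz rule, smoothness of the bracket at [x] meets the conditions of [spans_ind] in the
    second argument, and antisymmetry transfers this to the first. Division works because [f] is
    invertible near [x]. *)
Lemma smooth_br_of_span x m (E : 'I_m -> sect A) : spans_at x E ->
  (forall i j, smooth_sec (abr (E i) (E j)) x) ->
  forall s t : sect A, Gamma s -> Gamma t -> smooth_sec (abr s t) x.
Proof.
move=> sp sE; have GE := sp.1.
have main (u : sect A) : Gamma u -> (forall i, smooth_sec (abr u (E i)) x) ->
    forall s : sect A, Gamma s -> smooth_sec (abr u s) x.
  move=> Gu; apply: (spans_ind sp (P := fun s => smooth_sec (abr u s) x)).
  - rewrite (sect_ext (fun x => abr02 x Gu)); exact: smooth_sec0.
  - move=> s t Gs Gt ss st.
    by rewrite (sect_ext (fun x => abrD2 x Gu Gs Gt)); exact: smooth_secD.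
  - move=> f s sf Gs ss; rewrite (sect_ext (lei sf Gu Gs)).
    apply: smooth_secD => //; first exact: smooth_secZ.
    apply: smooth_secZ => //; exact: smooth_anchor_dd.
  - move=> f s sf fx0 Gs; rewrite (sect_ext (lei sf Gu Gs)) => H.
    have H1 : smooth_sec (fun y => dd f y (anchor y (u y)) *: s y) x.
      by apply: smooth_secZ => //; exact: smooth_anchor_dd.
    have := smooth_secZ vb (smoothV (sf x) fx0) (smooth_secB vb H H1).
    apply: smooth_sec_congr => //.
    have nf := smooth_neq0_near (sf x) fx0.
    near=> y; rewrite addrK scalerA mulVf ?scale1r //; near: y; exact: nf.
move=> s t Gs Gt; apply: (main) => // i.
rewrite (sect_ext (ant Gs (GE i))).
have := smooth_secZ vb (smooth_cst (-1) x) (main (E i) (GE i) (sE i) s Gs).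
by apply: smooth_sec_congr => //; near=> y; rewrite scaleN1r.
Unshelve. all: by end_near. Qed.

Hypothesis cl : forall u v : sect A, Gamma u -> Gamma v -> Gamma (abr u v).
Hypothesis anc : forall u v : sect A, Gamma u -> Gamma v ->
     forall x, anchor x (abr u v x)
               = vfield_br (map_sect anchor u) (map_sect anchor v) x.

(** The Jacobiator; being cyclic, it has to be shown linear over functions in its last slot only. *)
Let J (s t u : sect A) x := abr s (abr t u) x + abr t (abr u s) x + abr u (abr s t) x.

Lemma jacobiator_cycle s t u x : J s t u x = J t u s x.
Proof. by rewrite /J -addrA addrC. Qed.

Lemma jacobiatorD s t u v x : Gamma s -> Gamma t -> Gamma u -> Gamma v ->
  J s t (fun y => u y + v y) x = J s t u x + J s t v x.
Proof.
move=> Gs Gt Gu Gv; rewrite /J.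
rewrite (sect_ext (fun x => abrD2 x Gt Gu Gv)) abrD2 //; try exact: cl.
have E1 (w : sect A) : Gamma w -> abr (fun y => u y + v y) w = (fun y => abr u w y + abr v w y).
  move=> Gw; apply: sect_ext => y.
  have -> : (fun y => u y + v y) = (fun y => 1 *: u y + v y).
    by apply: sect_ext => z; rewrite scale1r.
  by rewrite bil // scale1r.
rewrite !E1 //; last exact: cl.
rewrite abrD2 //; try exact: cl.
have E (a a' b b' c c' : A x) : a + a' + (b + b') + (c + c') = a + b + c + (a' + b' + c').
  by rewrite (addrACA a) (addrACA (a + b)).
exact: E.
Qed.

(** The algebra behind [jacobiatorZ]: [xs] and [xt] are the derivatives of [f] along the anchors of
    [s] and [t], and [p], [q] its two iterated derivatives. *)
Let jacobiatorZ_abs (V : vectType R) (F xs xt p q : R) (stu tus ust tu us w : V) :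
  F *: stu + xs *: tu + (xt *: - us + p *: w) +
  (F *: tus + xt *: us + (- xs *: tu + - q *: w)) + (F *: ust + - (p - q) *: w)
  = F *: (stu + tus + ust).
Proof.
apply: hom_ext => l; rewrite !(linearD, linearZ, linearN) /=.
rewrite -![_ *: _ : R^o]/(_ * _ : R); ring.
Qed.

(** The iterated derivatives of [f] cancel because the anchor of [abr s t] acts on [f] as the
    bracket of the two anchors; hence the Jacobiator is tensorial. *)
Lemma jacobiatorZ s t u f x : (forall y, smooth_at f y) ->
  Gamma s -> Gamma t -> Gamma u -> J s t (fun y => f y *: u y) x = f x *: J s t u x.
Proof.
move=> sf Gs Gt Gu; rewrite /J.
pose X (w : sect A) y := dd f y (anchor y (w y)).
have sX (w : sect A) : Gamma w -> forall y, smooth_at (X w) y by move=> Gw; exact: smooth_anchor_dd.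
have E1 (w : sect A) : Gamma w -> abr (fun y => f y *: u y) w =
    (fun y => f y *: abr u w y + (- X w y) *: u y).
  move=> Gw; apply: sect_ext => y; rewrite ant //; last exact: GammaZ.
  by rewrite lei // opprD (ant Gw Gu) scalerN opprK scaleNr.
have sXN (w : sect A) : Gamma w -> forall y, smooth_at (fun y => - X w y) y.
  by move=> Gw y; apply: smoothN; exact: sX.
have e1 : abr s (abr t (fun y => f y *: u y)) x = f x *: abr s (abr t u) x
    + X s x *: abr t u x + (X t x *: abr s u x + dd (X t) x (anchor x (s x)) *: u x).
  have -> : abr t (fun y => f y *: u y) = (fun y => f y *: abr t u y + X t y *: u y).
    by apply: sect_ext => y; exact: lei.
  rewrite (abrD2 _ Gs (GammaZ sf (cl Gt Gu)) (GammaZ (sX t Gt) Gu)).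
  by rewrite (lei sf Gs (cl Gt Gu)) (lei (sX t Gt) Gs Gu).
have e2 : abr t (abr (fun y => f y *: u y) s) x = f x *: abr t (abr u s) x
    + X t x *: abr u s x + (- X s x *: abr t u x
       + - dd (X s) x (anchor x (t x)) *: u x).
  rewrite (E1 _ Gs) (abrD2 _ Gt (GammaZ sf (cl Gu Gs)) (GammaZ (sXN s Gs) Gu)).
  rewrite (lei sf Gt (cl Gu Gs)) (lei (sXN s Gs) Gt Gu) ddN //.
  exact: sX.
have e3 : abr (fun y => f y *: u y) (abr s t) x = f x *: abr u (abr s t) x
    + - (dd (X t) x (anchor x (s x)) - dd (X s) x (anchor x (t x))) *: u x.
  rewrite (E1 _ (cl Gs Gt)); congr (_ + - _ *: _).
  by rewrite /X anc // dd_vfield_br //; [exact: (sa (Gs x))|exact: (sa (Gt x))].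
rewrite e1 e2 e3 (ant Gs Gu); apply: jacobiatorZ_abs.
Qed.

Lemma jacobi_of_span x m (E : 'I_m -> sect A) : spans_at x E ->
  (forall i j k, J (E i) (E j) (E k) x = 0) ->
  forall s t u, Gamma s -> Gamma t -> Gamma u -> J s t u x = 0.
Proof.
move=> sp JE; have GE := sp.1.
have main s t : Gamma s -> Gamma t -> (forall i, J s t (E i) x = 0) ->
    forall u, Gamma u -> J s t u x = 0.
  move=> Gs Gt JsE; apply: (spans_ind sp (P := fun u => J s t u x = 0)) => //.
  - have -> : (fun y => 0 : A y) = (fun y => 0 *: s y).
      by apply: sect_ext => y; rewrite scale0r.
    by rewrite jacobiatorZ ?scale0r // => y; exact: smooth_cst.
  - by move=> u v Gu Gv Ju Jv; rewrite jacobiatorD // Ju Jv addr0.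
  - by move=> f u sf Gu Ju; rewrite jacobiatorZ // Ju scaler0.
  - move=> f u sf fx0 Gu; rewrite jacobiatorZ // => /eqP.
    by rewrite scaler_eq0 (negbTE fx0) => /eqP.
(* Each slot in turn is rotated into the last position and reduced to generators. *)
move=> s t u Gs Gt Gu; apply: (main) => // i.
rewrite -jacobiator_cycle; apply: (main) => // j.
rewrite -jacobiator_cycle; apply: (main) => // l.
Qed.

End Spanning.
End LieAlgebroids.

(** * The product Lie algebroid *)

Section HalfBracket.
Context {R : realType} {m n : nat} {M : manifold R m} {K : manifold R n}.
Variable A : algebroid_data M.
Hypothesis hA : is_lie_algebroid A.
Implicit Types S T : forall x : M, K -> A x.

(* One component of the bracket of a product algebroid: [S] and [T] are families
   of sections of [A] parametrized by [K], and [X], [Y] are the anchors of the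
   other components. *)
Definition half_br S T x y (X Y : TS y) : A x :=
  abr (fun x => S x y) (fun x => T x y) x + ddv (T x) y X - ddv (S x) y Y.

(** The two regularities that [half_br] calls on: the bracket of [A] acts in [x], and
    differentiation inside a fixed fibre acts in [y]. *)
Definition slice_smooth S : Prop :=
  (forall y, Gamma (fun x => S x y)) /\ (forall x y, smoothv_at (S x) y).

Let vb := hA.1.

Lemma half_br_linear (c : R) S S' T x y (X X' Y : TS y) :
  slice_smooth S -> slice_smooth S' -> slice_smooth T ->
  half_br (fun x y => c *: S x y + S' x y) T x (c *: X + X') Y =
  c *: half_br S T x X Y + half_br S' T x X' Y.
Proof.
move=> [S1 S2] [S1' S2'] [T1 T2]; have [_ [_ [_ [bil _]]]] := hA.
rewrite /half_br bil // ddv_linear //.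
have -> : ddv (fun y => c *: S x y + S' x y) y Y = c *: ddv (S x) y Y + ddv (S' x) y Y.
  rewrite ddvD //; last by apply: smoothvZ => //; exact: smooth_cst.
  by rewrite ddvZ ?dd_cst ?scale0r ?addr0 //; exact: smooth_cst.
rewrite !scalerDr scalerN opprD; apply: hom_ext => l.
by rewrite !(linearD, linearN, linearZ) /=; ring.
Qed.

Lemma half_br_anti S T x y (X Y : TS y) : slice_smooth S -> slice_smooth T ->
  half_br S T x X Y = - half_br T S x Y X.
Proof.
move=> [S1 _] [T1 _]; have [_ [_ [_ [_ [ant _]]]]] := hA.
rewrite /half_br ant // opprB [in RHS]opprD addrC addrA; apply: hom_ext => l.
by rewrite !(linearD, linearN, linearZ) /=; ring.
Qed.

(** [Y] is scaled as well, being the anchor of the other component of a section multiplied by [f].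
    The two derivatives of [f] add up to the one along the product anchor. *)
Lemma half_br_leibniz (f : M -> K -> R) S T x y (X Y : TS y) :
  (forall x y, smooth_at (fun x => f x y) x) -> (forall x y, smooth_at (f x) y) ->
  slice_smooth S -> slice_smooth T ->
  half_br S (fun x y => f x y *: T x y) x X (f x y *: Y) =
  f x y *: half_br S T x X Y
  + (dd (fun x => f x y) x (anchor x (S x y)) + dd (f x) y X) *: T x y.
Proof.
move=> f1 f2 [S1 S2] [T1 T2]; have [_ [_ [_ [_ [_ [_ [lei _]]]]]]] := hA.
rewrite /half_br lei // ddvZ //.
have -> : ddv (S x) y (f x y *: Y) = f x y *: ddv (S x) y Y.
  by have := ddv_linear (f x y) Y 0 (S2 x y); rewrite !addr0 ddv0 // addr0.
apply: hom_ext => l; rewrite !(linearD, linearN, linearZ, scalerDl) /=.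
rewrite -![_ *: _ : R^o]/(_ * _ : R); ring.
Qed.

Lemma half_br_morphism (k : quadratic_lie_algebra R)
    (phi : bundle_map A (trivial_bundle M k)) S T x y (X Y : TS y) :
  is_lie_morphism phi -> slice_smooth S -> slice_smooth T ->
  phi x (half_br S T x X Y) =
  (ddv (fun x => phi x (T x y)) x (anchor x (S x y)) + ddv (fun y => phi x (T x y)) y X)
  - (ddv (fun x => phi x (S x y)) x (anchor x (T x y)) + ddv (fun y => phi x (S x y)) y Y)
  + lbr (phi x (S x y)) (phi x (T x y)).
Proof.
move=> [sphi mor] [S1 S2] [T1 T2].
rewrite /half_br linearB linearD /= mor // !(ddv_hom (phi x)) //.
rewrite /map_sect; set a := ddv _ x _; set b := ddv _ x _; set c := lbr _ _.
by apply: hom_ext => l; rewrite !(linearD, linearN, linearZ) /=; ring.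
Qed.

Lemma half_br_anchor S T x y (X Y : TS y) : slice_smooth S -> slice_smooth T ->
  anchor x (half_br S T x X Y) =
  vfield_br (fun x => anchor x (S x y)) (fun x => anchor x (T x y)) x
  + ddv (fun y => anchor x (T x y)) y X - ddv (fun y => anchor x (S x y)) y Y.
Proof.
move=> [S1 S2] [T1 T2]; have [_ [_ [_ [_ [_ [_ [_ anc]]]]]]] := hA.
by rewrite /half_br linearB linearD /= anc // !(ddv_hom (anchor x)).
Qed.

End HalfBracket.

Section ProductAlgebroid.
Context {R : realType} {n1 n2 : nat}.
Context {N1 : manifold R n1} {N2 : manifold R n2}.
Local Notation N := (prod_manifold N1 N2).

Lemma continuous_fst : continuous (fst : N -> N1).
Proof. by move=> p; exact: cvg_fst. Qed.

Lemma continuous_snd : continuous (snd : N -> N2).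
Proof. by move=> p; exact: cvg_snd. Qed.

Lemma near_slice1 (P : N -> Prop) x y : (\forall p \near ((x, y) : N), P p) ->
  \forall x' \near x, P (x', y).
Proof.
have c : {for x, continuous ((fun x' => (x', y)) : N1 -> N)}.
  by apply: cvg_pair; [exact: cvg_id|exact: cvg_cst].
by move=> nP; exact: (c _ nP).
Qed.

Lemma near_slice2 (P : N -> Prop) x y : (\forall p \near ((x, y) : N), P p) ->
  \forall y' \near y, P (x, y').
Proof.
have c : {for y, continuous ((fun y' => (x, y')) : N2 -> N)}.
  by apply: cvg_pair; [exact: cvg_cst|exact: cvg_id].
by move=> nP; exact: (c _ nP).
Qed.

Section Slices.
Variables (B1 : bundle N1) (B2 : bundle N2).
Hypotheses (vb1 : is_vector_bundle B1) (vb2 : is_vector_bundle B2).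
Local Notation P1 := (@pullback_bundle R _ _ N N1 fst B1).
Local Notation P2 := (@pullback_bundle R _ _ N N2 snd B2).

Lemma pullback1_slice1 (s : sect P1) x y : smooth_sec s ((x, y) : N) ->
  smooth_sec (b := B1) (fun x' => s (x', y)) x.
Proof.
move=> [r [e [c [se sc E]]]].
apply: (smooth_sec_congr vb1 (s := fun x' => \sum_i c i (x', y) *: e i x')).
  by near=> x'; apply/esym; near: x'; exact: near_slice1 E.
apply: smooth_sec_sum => // i _; apply: smooth_secZ => //.
by apply: smooth_slice1; exact: sc.
Unshelve. all: by end_near. Qed.

Lemma pullback1_slice2 (s : sect P1) x y : smooth_sec s ((x, y) : N) ->
  smoothv_at (fun y' => s (x, y') : B1 x) y.
Proof.
move=> [r [e [c [se sc E]]]].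
apply: (smoothv_congr (f := fun y' => \sum_i c i (x, y') *: e i x)).
  by near=> y'; apply/esym; near: y'; exact: near_slice2 E.
apply: smoothv_sum => i _; apply: smoothvZ; last exact: smoothv_cst.
by apply: smooth_slice2; exact: sc.
Unshelve. all: by end_near. Qed.

Lemma pullback2_slice2 (s : sect P2) x y : smooth_sec s ((x, y) : N) ->
  smooth_sec (b := B2) (fun y' => s (x, y')) y.
Proof.
move=> [r [e [c [se sc E]]]].
apply: (smooth_sec_congr vb2 (s := fun y' => \sum_i c i (x, y') *: e i y')).
  by near=> y'; apply/esym; near: y'; exact: near_slice2 E.
apply: smooth_sec_sum => // i _; apply: smooth_secZ => //.
by apply: smooth_slice2; exact: sc.
Unshelve. all: by end_near. Qed.

Lemma pullback2_slice1 (s : sect P2) x y : smooth_sec s ((x, y) : N) ->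
  smoothv_at (fun x' => s (x', y) : B2 y) x.
Proof.
move=> [r [e [c [se sc E]]]].
apply: (smoothv_congr (f := fun x' => \sum_i c i (x', y) *: e i y)).
  by near=> x'; apply/esym; near: x'; exact: near_slice1 E.
apply: smoothv_sum => i _; apply: smoothvZ; last exact: smoothv_cst.
by apply: smooth_slice1; exact: sc.
Unshelve. all: by end_near. Qed.

Lemma pullback1_functional (l : forall x, B1 x -> R) (U : set N1) (s : sect P1) (p : N) :
  open U -> U p.1 ->
  (forall x (a : R) u v, U x -> l x (a *: u + v) = a * l x u + l x v) ->
  (forall t, smooth_sec t p.1 -> smooth_at (fun x => l x (t x)) p.1) ->
  smooth_sec s p -> smooth_at (fun q : N => l q.1 (s q)) p.
Proof.
move=> oU Up; apply: (pullback_functional_near continuous_fst _ oU Up).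
by move=> f q; exact: smooth_fst.
Qed.

Lemma pullback2_functional (l : forall x, B2 x -> R) (U : set N2) (s : sect P2) (p : N) :
  open U -> U p.2 ->
  (forall x (a : R) u v, U x -> l x (a *: u + v) = a * l x u + l x v) ->
  (forall t, smooth_sec t p.2 -> smooth_at (fun x => l x (t x)) p.2) ->
  smooth_sec s p -> smooth_at (fun q : N => l q.2 (s q)) p.
Proof.
move=> oU Up; apply: (pullback_functional_near continuous_snd _ oU Up).
by move=> f q; exact: smooth_snd.
Qed.

Lemma prod_vb : is_vector_bundle (prod_bundle B1 B2).
Proof.
apply: sum_vb; apply: pullback_vb => //.
- exact: continuous_fst.
- by move=> f p; exact: smooth_fst.
- exact: continuous_snd.
- by move=> f p; exact: smooth_snd.
Qed.

End Slices.

Variables (A1 : algebroid_data N1) (A2 : algebroid_data N2).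
Hypotheses (hA1 : is_lie_algebroid A1) (hA2 : is_lie_algebroid A2).
Local Notation A := (prod_algebroid A1 A2).

Definition fam1 (s : sect A) (x : N1) (y : N2) : A1 x := (s (x, y)).1.
Definition fam2 (s : sect A) (y : N2) (x : N1) : A2 y := (s (x, y)).2.

Lemma fam1_smooth (s : sect A) : Gamma s -> slice_smooth (fam1 s).
Proof.
move=> Gs; split=> [y x|x y]; have [s1 _] := Gs (x, y).
  exact: (pullback1_slice1 hA1.1 s1).
exact: (pullback1_slice2 s1).
Qed.

Lemma fam2_smooth (s : sect A) : Gamma s -> slice_smooth (fam2 s).
Proof.
move=> Gs; split=> [x y|y x]; have [_ s2] := Gs (x, y).
  exact: (pullback2_slice2 hA2.1 s2).
exact: (pullback2_slice1 s2).
Qed.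

Lemma prod_anchorE (p : N) (e : A p) : anchor p e =
  row_mx (anchor p.1 e.1 : 'rV[R]_n1) (anchor p.2 e.2 : 'rV[R]_n2).
Proof.
rewrite /= linfun_lin // => a u v.
by rewrite /= !linearP scale_row_mx add_row_mx.
Qed.

Lemma prod_brE (s t : sect A) p :
  abr s t p =
  (half_br (y := p.2) (fam1 s) (fam1 t) p.1 (anchor p.2 (s p).2) (anchor p.2 (t p).2),
   half_br (y := p.1) (fam2 s) (fam2 t) p.2 (anchor p.1 (s p).1) (anchor p.1 (t p).1)).
Proof. by case: p. Qed.

Lemma prod_anchor_smooth : bundle_map_smooth (@anchor R _ N A).
Proof.
have [_ [sa1 _]] := hA1; have [_ [sa2 _]] := hA2.
move=> s [x y] [s1 s2] i.
apply: (@smooth_congr _ _ _ (fun q : N =>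
  row_mx (chart_comp x (anchor q.1 (s q).1 : TS q.1)) (chart_comp y (anchor q.2 (s q).2 : TS q.2)) ord0 i)).
  by near=> q; rewrite /map_sect prod_anchorE chart_comp_prod row_mxKl row_mxKr.
rewrite -(splitK i); case: (fintype.split i) => j /=.
  apply: (@smooth_congr _ _ _ (fun q : N => chart_comp x (anchor q.1 (s q).1 : TS q.1) ord0 j)).
    by near=> q; rewrite row_mxEl.
  pose l : forall x', A1 x' -> R := fun x' u => chart_comp x (anchor x' u : TS x') ord0 j.
  have ll x' (a : R) u v : dom x x' -> l x' (a *: u + v) = a * l x' u + l x' v.
    by move=> xx'; rewrite /l linearP chart_comp_linear // !mxE.
  have sl (t : sect A1) : smooth_sec t x -> smooth_at (fun x' => l x' (t x')) x.
    by move=> st; exact: (sa1 t x st j).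
  exact: (pullback1_functional (p := (x, y) : N) (@dom_open _ _ N1 x) (dom_refl x) ll sl s1).
apply: (@smooth_congr _ _ _ (fun q : N => chart_comp y (anchor q.2 (s q).2 : TS q.2) ord0 j)).
  by near=> q; rewrite row_mxEr.
pose l : forall x', A2 x' -> R := fun x' u => chart_comp y (anchor x' u : TS x') ord0 j.
have ll x' (a : R) u v : dom y x' -> l x' (a *: u + v) = a * l x' u + l x' v.
  by move=> xx'; rewrite /l linearP chart_comp_linear // !mxE.
have sl (t : sect A2) : smooth_sec t y -> smooth_at (fun x' => l x' (t x')) y.
  by move=> st; exact: (sa2 t y st j).
exact: (pullback2_functional (p := (x, y) : N) (@dom_open _ _ N2 y) (dom_refl y) ll sl s2).
Unshelve. all: by end_near. Qed.

Lemma prod_br_linear (c : R) (u u' v : sect A) : Gamma u -> Gamma u' -> Gamma v ->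
  forall x, abr (fun y => c *: u y + u' y) v x = c *: abr u v x + abr u' v x.
Proof.
move=> Gu Gu' Gv p; rewrite !prod_brE.
have -> : (anchor p.2 (c *: u p + u' p).2) = c *: anchor p.2 (u p).2 + anchor p.2 (u' p).2.
  by rewrite linearP.
have -> : (anchor p.1 (c *: u p + u' p).1) = c *: anchor p.1 (u p).1 + anchor p.1 (u' p).1.
  by rewrite linearP.
rewrite (half_br_linear hA1 c p.1 _ _ _ (fam1_smooth Gu) (fam1_smooth Gu') (fam1_smooth Gv)).
by rewrite (half_br_linear hA2 c p.2 _ _ _ (fam2_smooth Gu) (fam2_smooth Gu') (fam2_smooth Gv)).
Qed.

Lemma prod_br_anti (u v : sect A) : Gamma u -> Gamma v ->
  forall x, abr u v x = - abr v u x.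
Proof.
move=> Gu Gv p; rewrite !prod_brE.
rewrite (half_br_anti hA1 p.1 _ _ (fam1_smooth Gu) (fam1_smooth Gv)).
by rewrite (half_br_anti hA2 p.2 _ _ (fam2_smooth Gu) (fam2_smooth Gv)).
Qed.

Lemma prod_br_leibniz (f : N -> R) (u v : sect A) : (forall x, smooth_at f x) ->
  Gamma u -> Gamma v -> forall x, abr u (fun y => f y *: v y) x
               = f x *: abr u v x + dd f x (anchor x (u x)) *: v x.
Proof.
move=> sf Gu Gv [x y]; rewrite !prod_brE dd_prod // prod_anchorE row_mxKl row_mxKr /=.
have -> : anchor y (f (x, y) *: (v (x, y)).2) = f (x, y) *: anchor y (v (x, y)).2.
  by rewrite linearZ.
have -> : anchor x (f (x, y) *: (v (x, y)).1) = f (x, y) *: anchor x (v (x, y)).1.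
  by rewrite linearZ.
have f1 x' y' : smooth_at (fun x => f (x, y')) x' by exact: smooth_slice1.
have f2 x' y' : smooth_at (fun y => f (x', y)) y' by exact: smooth_slice2.
rewrite (half_br_leibniz hA1 x _ _ f1 f2 (fam1_smooth Gu) (fam1_smooth Gv)).
rewrite (half_br_leibniz hA2 y _ _ (fun y x => f2 x y) (fun y x => f1 x y) (fam2_smooth Gu) (fam2_smooth Gv)).
by rewrite [X in X *: fam2 _ _ _]addrC.
Qed.

End ProductAlgebroid.

Section ProductLieAlgebroid.
Context {R : realType} {n1 n2 : nat}.
Context {N1 : manifold R n1} {N2 : manifold R n2}.
Local Notation N := (prod_manifold N1 N2).

Lemma ddv_prod (V : vectType R) (f : N -> V) (p : N) (v : TS p) : smoothv_at f p ->
  ddv f p v = ddv (fun x => f (x, p.2)) p.1 (lsubmx (v : 'rV[R]_(n1 + n2)))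
           + ddv (fun y => f (p.1, y)) p.2 (rsubmx (v : 'rV[R]_(n1 + n2))).
Proof.
case: p v => x y v sf; apply: hom_ext => l /=.
have s1 : smoothv_at (fun x => f (x, y)) x.
  by move=> l'; apply: (@smooth_slice1 _ _ _ _ _ (fun q => l' (f q))); exact: sf.
have s2 : smoothv_at (fun y => f (x, y)) y.
  by move=> l'; apply: (@smooth_slice2 _ _ _ _ _ (fun q => l' (f q))); exact: sf.
rewrite linearD /= (hom_ddv _ _ sf) (hom_ddv _ _ s1) (hom_ddv _ _ s2).
exact: (dd_prod v (sf l)).
Qed.

Lemma ddv_rV n (K : manifold R n) m (f : K -> 'rV[R]_m) x (v : TS x) j :
  smoothv_at f x -> (ddv f x v : 'rV[R]_m) ord0 j = dd (fun y => f y ord0 j) x v.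
Proof.
move=> sf; pose l : 'Hom('rV[R]_m, R^o) := linfun (fun w : 'rV[R]_m => w ord0 j : R^o).
have lE w : l w = w ord0 j by rewrite linfun_lin // => a u u'; rewrite !mxE.
rewrite -lE hom_ddv //; apply: dd_eq => y; exact: lE.
Qed.

Variables (A1 : algebroid_data N1) (A2 : algebroid_data N2).
Hypotheses (hA1 : is_lie_algebroid A1) (hA2 : is_lie_algebroid A2).
Local Notation A := (prod_algebroid A1 A2).

Lemma row_mx_split m1 m2 (u v : 'rV[R]_(m1 + m2)) :
  (forall j, u ord0 (lshift m2 j) = v ord0 (lshift m2 j)) ->
  (forall j, u ord0 (rshift m1 j) = v ord0 (rshift m1 j)) -> u = v.
Proof.
move=> H1 H2; apply/rowP => i; rewrite -(splitK i).
by case: (fintype.split i) => j /=.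
Qed.

(** Each block has a derivative within its own factor and one of the parametrized family along the
    other factor, matching the terms of [half_br_anchor]. *)
Lemma prod_anchor_vdiff (w : sect A) (x : N1) (y : N2) (z : TS ((x, y) : N)) :
  Gamma w -> vdiff (map_sect anchor w) z = row_mx
    (vdiff (fun x' => anchor x' (fam1 w x' y)) (lsubmx (z : 'rV[R]_(n1 + n2)) : TS x)
     + ddv (fun y' => anchor x (fam1 w x y')) y (rsubmx (z : 'rV[R]_(n1 + n2))))
    (vdiff (fun y' => anchor y' (fam2 w y' x)) (rsubmx (z : 'rV[R]_(n1 + n2)) : TS y)
     + ddv (fun x' => anchor y (fam2 w y x')) x (lsubmx (z : 'rV[R]_(n1 + n2)))).
Proof.
move=> Gw; have sw := prod_anchor_smooth hA1 hA2 (Gw (x, y)).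
have L1 (q : N) j : chart_comp ((x, y) : N) (map_sect anchor w q : TS q) ord0 (lshift n2 j)
   = chart_comp x (anchor q.1 (w q).1 : TS q.1) ord0 j.
  by rewrite /map_sect prod_anchorE chart_comp_prod row_mxEl row_mxKl.
have L2 (q : N) j : chart_comp ((x, y) : N) (map_sect anchor w q : TS q) ord0 (rshift n1 j)
   = chart_comp y (anchor q.2 (w q).2 : TS q.2) ord0 j.
  by rewrite /map_sect prod_anchorE chart_comp_prod row_mxEr row_mxKr.
apply: row_mx_split => j.
  rewrite row_mxEl [LHS]mxE [RHS]mxE [X in _ = X + _]mxE (dd_prod _ (sw _)) ddv_rV.
    congr (_ + _); apply: dd_eq => x'; rewrite L1 //=.
    by rewrite chart_comp_id.
  by apply: smoothv_hom; exact: (fam1_smooth hA1 Gw).2.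
rewrite row_mxEr [LHS]mxE [RHS]mxE [X in _ = X + _]mxE (dd_prod _ (sw _)) ddv_rV.
  rewrite addrC; congr (_ + _); apply: dd_eq => x'; rewrite L2 //=.
  by rewrite chart_comp_id.
by apply: smoothv_hom; exact: (fam2_smooth hA2 Gw).2.
Qed.

Lemma prod_br_anchor (u v : sect A) : Gamma u -> Gamma v ->
  forall x, anchor x (abr u v x) = vfield_br (map_sect anchor u) (map_sect anchor v) x.
Proof.
move=> Gu Gv [x y]; rewrite prod_anchorE prod_brE.
rewrite [X in row_mx X](half_br_anchor hA1 x _ _ (fam1_smooth hA1 Gu) (fam1_smooth hA1 Gv)).
rewrite [X in row_mx _ X](half_br_anchor hA2 y _ _ (fam2_smooth hA2 Gu) (fam2_smooth hA2 Gv)).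
rewrite [RHS]vfield_br_vdiff (prod_anchor_vdiff _ Gu) (prod_anchor_vdiff _ Gv).
have E m (a b c d : 'rV[R]_m) : a - b + c - d = (a + c) - (b + d).
  by rewrite opprD addrACA addrA.
rewrite -[RHS]/(row_mx _ _ - row_mx _ _) opp_row_mx add_row_mx.
rewrite /map_sect !prod_anchorE !row_mxKl !row_mxKr !vfield_br_vdiff -!E.
by [].
Qed.

End ProductLieAlgebroid.

(** * Pulled-back generators of the product algebroid *)

Section ProductSpan.
Context {R : realType} {n1 n2 : nat}.
Context {N1 : manifold R n1} {N2 : manifold R n2}.
Local Notation N := (prod_manifold N1 N2).
Variables (A1 : algebroid_data N1) (A2 : algebroid_data N2).
Hypotheses (hA1 : is_lie_algebroid A1) (hA2 : is_lie_algebroid A2).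
Local Notation A := (prod_algebroid A1 A2).

Definition ext (a : sect A1) (b : sect A2) : sect A := fun p => (a p.1, b p.2).

Lemma ext_Gamma a b : Gamma a -> Gamma b -> Gamma (ext a b).
Proof.
move=> Ga Gb p; split.
  by apply: (@pullback_sec R _ _ N N1 fst A1 a p); exact: Ga.
by apply: (@pullback_sec R _ _ N N2 snd A2 b p); exact: Gb.
Qed.

(** A pulled-back component is constant along the other factor, so the derivative terms of the
    product bracket vanish. *)
Lemma ext_br a b a' b' : Gamma a -> Gamma b -> Gamma a' -> Gamma b' ->
  abr (ext a b) (ext a' b') = ext (abr a a') (abr b b').
Proof.
move=> Ga Gb Ga' Gb'; apply: sect_ext => p; rewrite prod_brE /half_br /fam1 /fam2 /ext /=.
by rewrite !ddv_cst !subr0 !addr0.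
Qed.

Lemma cut_off_frame n (K : manifold R n) (B : bundle K) (vb : is_vector_bundle B) (z : K) :
  exists (f : K -> R) (U : set K) r (e : 'I_r -> sect B),
  [/\ forall w, smooth_at f w, f z != 0, local_frame U e,
      forall w, ~ U w -> \forall w' \near w, f w' = 0
    & forall i, Gamma (fun w => f w *: e i w)].
Proof.
have [U [r [e [fr Uz]]]] := exists_frame vb z.
have [oU _ _] := fr.
have [f [sf fz f0]] := exists_bump (open_nbhs_nbhs (conj oU Uz)).
exists f, U, r, e; split=> // i w.
have [Uw|nUw] := pselect (U w).
  by apply: smooth_secZ => //; exact: (frame_smooth fr).
apply: smooth_sec_congr (smooth_sec0 vb w) => //.
have nf := f0 w nUw.
near=> w'; have -> : f w' = 0 by near: w'; exact: nf.
by rewrite scale0r.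
Unshelve. all: by end_near. Qed.

Lemma prod_spans x y : exists m (E : 'I_m -> sect A), spans_at ((x, y) : N) E /\
  forall i, exists a b, [/\ Gamma a, Gamma b & E i = ext a b].
Proof.
have [f1 [U1 [r1 [e1 [sf1 f1x fr1 f10 Ge1]]]]] := cut_off_frame hA1.1 x.
have [f2 [U2 [r2 [e2 [sf2 f2y fr2 f20 Ge2]]]]] := cut_off_frame hA2.1 y.
pose F1 (i : 'I_r1) (p : N) : A1 p.1 := f1 p.1 *: e1 i p.1.
pose F2 (i : 'I_r2) (p : N) : A2 p.2 := f2 p.2 *: e2 i p.2.
pose E : 'I_(r1 + r2) -> sect A := sum_frame
  (B := @pullback_bundle R _ _ N N1 fst A1) (C := @pullback_bundle R _ _ N N2 snd A2) F1 F2.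
have G01 : Gamma (fun w => 0 : A1 w) by exact: (Gamma0 hA1.1).
have G02 : Gamma (fun w => 0 : A2 w) by exact: (Gamma0 hA2.1).
have EE i : exists a b, [/\ Gamma a, Gamma b & E i = ext a b].
  rewrite /E /sum_frame; case: (fintype.split i) => j.
    by exists (fun w => f1 w *: e1 j w), (fun w => 0); split.
  by exists (fun w => 0), (fun w => f2 w *: e2 j w); split.
exists (r1 + r2)%N, E; split=> //; split.
  by move=> i; have [a [b [Ga Gb ->]]] := EE i; exact: ext_Gamma.
have sg1 p : smooth_at (fun q : N => f1 q.1) p by exact: smooth_fst.
have sg2 p : smooth_at (fun q : N => f2 q.2) p by exact: smooth_snd.
(* One factor [f1] is absorbed by the generators [F1], the other makes the frame coordinate [c1]
   smooth everywhere; likewise for [f2]. A single multiplier has to serve both summands. *)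
exists (fun p => f1 p.1 * f1 p.1 * (f2 p.2 * f2 p.2)); split.
- by move=> p; apply: smoothM; exact: smoothM.
- by rewrite !mulf_neq0.
move=> s Gs.
pose c1 (i : 'I_r1) (p : N) := coord (sec_frame e1 p.1) i (s p).1.
pose c2 (i : 'I_r2) (p : N) := coord (sec_frame e2 p.2) i (s p).2.
have sc1 i p : smooth_at (fun q : N => f1 q.1 * c1 i q) p.
  have [U1p|nU1p] := pselect (U1 p.1).
    apply: smoothM => //.
    have fr' : local_frame (B := @pullback_bundle R _ _ N N1 fst A1)
        (fst @^-1` U1) (fun i p => e1 i p.1).
      apply: pullback_frame => //; first exact: continuous_fst.
      by move=> f q; exact: smooth_fst.
    have [_ _ H] := fr'.
    by have [s1 _] := Gs p; exact: (H (fun q => (s q).1) p U1p).1.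
  have nf : \forall q \near p, f1 q.1 = 0 by exact: (@continuous_fst _ _ _ _ _ p _ (f10 _ nU1p)).
  apply: smooth_congr (smooth_cst 0 p); near=> q.
  have -> : f1 q.1 = 0 by near: q; exact: nf.
  by rewrite mul0r.
have sc2 i p : smooth_at (fun q : N => f2 q.2 * c2 i q) p.
  have [U2p|nU2p] := pselect (U2 p.2).
    apply: smoothM => //.
    have fr' : local_frame (B := @pullback_bundle R _ _ N N2 snd A2)
        (snd @^-1` U2) (fun i p => e2 i p.2).
      apply: pullback_frame => //; first exact: continuous_snd.
      by move=> f q; exact: smooth_snd.
    have [_ _ H] := fr'.
    by have [_ s2] := Gs p; exact: (H (fun q => (s q).2) p U2p).1.
  have nf : \forall q \near p, f2 q.2 = 0 by exact: (@continuous_snd _ _ _ _ _ p _ (f20 _ nU2p)).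
  apply: smooth_congr (smooth_cst 0 p); near=> q.
  have -> : f2 q.2 = 0 by near: q; exact: nf.
  by rewrite mul0r.
exists (fun i => match fintype.split i with
  | inl j => fun p => f1 p.1 * c1 j p * (f2 p.2 * f2 p.2)
  | inr j => fun p => f2 p.2 * c2 j p * (f1 p.1 * f1 p.1) end).
split=> [i p|p].
  by case: (fintype.split i) => j; apply: smoothM => //; exact: smoothM.
rewrite sum_frame_sum.
rewrite [s p]surjective_pairing -[LHS]/(_ *: _, _ *: _) /=; congr pair.
  have [U1p|nU1p] := pselect (U1 p.1); last first.
    rewrite (nbhs_singleton (f10 _ nU1p)) !mul0r scale0r big1 // => i _.
    by rewrite /F1 (nbhs_singleton (f10 _ nU1p)) scale0r scaler0.
  rewrite {1}(frame_sum fr1 (s p).1 U1p) scaler_sumr; apply: eq_bigr => i _.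
  by rewrite (unsplitK (inl i)) /F1 !scalerA; congr (_ *: _); rewrite /c1; ring.
have [U2p|nU2p] := pselect (U2 p.2); last first.
  rewrite (nbhs_singleton (f20 _ nU2p)) !mul0r !mulr0 scale0r big1 // => i _.
  by rewrite /F2 (nbhs_singleton (f20 _ nU2p)) scale0r scaler0.
rewrite {1}(frame_sum fr2 (s p).2 U2p) scaler_sumr; apply: eq_bigr => i _.
by rewrite (unsplitK (inr i)) /F2 !scalerA; congr (_ *: _); rewrite /c2; ring.
Unshelve. all: by end_near. Qed.

(** Joint smoothness of the bracket and the Jacobi identity cannot be read off slice by slice. Both
    are tested on pulled-back generators, where the bracket is componentwise; smoothness comes
    first, since the Jacobi identity iterates the bracket. *)
Lemma prod_lie : is_lie_algebroid A.
Proof.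
have [vb1 [sa1 [cl1 [bil1 [ant1 [jac1 _]]]]]] := hA1.
have [vb2 [sa2 [cl2 [bil2 [ant2 [jac2 _]]]]]] := hA2.
have vb : is_vector_bundle A := prod_vb vb1 vb2.
have sa := prod_anchor_smooth hA1 hA2.
have bil := prod_br_linear hA1 hA2.
have ant := prod_br_anti hA1 hA2.
have lei := prod_br_leibniz hA1 hA2.
have anc := prod_br_anchor hA1 hA2.
have cl (u v : sect A) : Gamma u -> Gamma v -> Gamma (abr u v).
  move=> Gu Gv [x y]; have [m [E [sp EE]]] := prod_spans x y.
  apply: (smooth_br_of_span vb sa bil ant lei sp) => // i j.
  have [a [b [Ga Gb ->]]] := EE i; have [a' [b' [Ga' Gb' ->]]] := EE j.
  by rewrite ext_br //; apply: ext_Gamma; [exact: cl1|exact: cl2].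
split=> //; split=> //; split=> //; split=> //; split=> //; split; last by split.
move=> u v w Gu Gv Gw [x y]; have [m [E [sp EE]]] := prod_spans x y.
apply: (jacobi_of_span vb sa bil ant lei cl anc sp) => // i j l.
have [a [b [Ga Gb ->]]] := EE i; have [a' [b' [Ga' Gb' ->]]] := EE j.
have [a2 [b2 [Ga2 Gb2 ->]]] := EE l.
rewrite !ext_br //; try (by apply: cl1); try (by apply: cl2).
by rewrite /ext -[LHS]/(_ + _ + _, _ + _ + _) /= jac1 // jac2.
Qed.

End ProductSpan.

(** * The fibre product *)

Section Morphisms.
Context {R : realType}.

Section PairMaps.
Context {n : nat} {K : manifold R n}.
Variables (B : algebroid_data K) (k1 k2 : quadratic_lie_algebra R).
Variables (f : bundle_map B (trivial_bundle K k1)) (g : bundle_map B (trivial_bundle K k2)).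

Lemma pair_mapE x u : pair_map f g x u = (f x u, g x u).
Proof. by rewrite linfun_lin // => a u' v'; rewrite !linearP. Qed.

(** The projections are taken in ['Hom] so that [smoothv_hom] and [ddv_hom] apply to them. *)
Definition qpr1 : 'Hom(qla_prod k1 k2, k1) := linfun (fun w : (k1 * k2)%type => w.1).
Definition qpr2 : 'Hom(qla_prod k1 k2, k2) := linfun (fun w : (k1 * k2)%type => w.2).

Lemma qpr1E w : qpr1 w = w.1. Proof. exact: linfun_lin. Qed.
Lemma qpr2E w : qpr2 w = w.2. Proof. exact: linfun_lin. Qed.

Lemma lie_morphism_pair : is_lie_morphism (k := qla_prod k1 k2) (pair_map f g) ->
  is_lie_morphism f /\ is_lie_morphism g.
Proof.
move=> [sm mor].
have sm' s x : smooth_sec s x -> smoothv_at (V := qla_prod k1 k2) (map_sect (pair_map f g) s) x.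
  by move=> ss; exact: sm.
have m1 s : map_sect f s = (fun x => qpr1 (map_sect (pair_map f g) s x)).
  by apply/funext => x; rewrite qpr1E /map_sect pair_mapE.
have m2 s : map_sect g s = (fun x => qpr2 (map_sect (pair_map f g) s x)).
  by apply/funext => x; rewrite qpr2E /map_sect pair_mapE.
split; split.
- by move=> s x ss; rewrite m1; apply: smoothv_hom; exact: sm'.
- move=> u v Gu Gv x; have := congr1 qpr1 (mor u v Gu Gv x).
  rewrite qpr1E pair_mapE /= => ->; rewrite linearD linearB /=.
  rewrite (ddv_hom qpr1 _ (sm' v x (Gv x))) (ddv_hom qpr1 _ (sm' u x (Gu x))) -m1 -m1.
  by rewrite qpr1E !pair_mapE.
- by move=> s x ss; rewrite m2; apply: smoothv_hom; exact: sm'.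
- move=> u v Gu Gv x; have := congr1 qpr2 (mor u v Gu Gv x).
  rewrite qpr2E pair_mapE /= => ->; rewrite linearD linearB /=.
  rewrite (ddv_hom qpr2 _ (sm' v x (Gv x))) (ddv_hom qpr2 _ (sm' u x (Gu x))) -m2 -m2.
  by rewrite qpr2E !pair_mapE.
Qed.

Lemma qla_prod_ext (w w' : qla_prod k1 k2) : qpr1 w = qpr1 w' -> qpr2 w = qpr2 w' -> w = w'.
Proof. by case: w => a b; case: w' => a' b'; rewrite !qpr1E !qpr2E /= => -> ->. Qed.

Lemma smoothv_pair (h : K -> qla_prod k1 k2) x :
  smoothv_at (fun y => (h y).1) x -> smoothv_at (fun y => (h y).2) x ->
  smoothv_at (V := qla_prod k1 k2) h x.
Proof.
move=> s1 s2 l.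
pose i1 : 'Hom(k1, qla_prod k1 k2) := linfun (fun w : k1 => (w, 0) : (k1 * k2)%type).
pose i2 : 'Hom(k2, qla_prod k1 k2) := linfun (fun w : k2 => (0, w) : (k1 * k2)%type).
have e1 w : i1 w = (w, 0).
  rewrite linfun_lin // => a u v.
  by apply/eqP; rewrite xpair_eqE /= scaler0 addr0 !eqxx.
have e2 w : i2 w = (0, w).
  rewrite linfun_lin // => a u v.
  by apply/eqP; rewrite xpair_eqE /= scaler0 addr0 !eqxx.
have H := smoothvD (smoothv_hom i1 s1) (smoothv_hom i2 s2).
apply: smooth_congr (H l); near=> y; congr (l _).
by rewrite e1 e2; apply/eqP; rewrite [h y]surjective_pairing xpair_eqE /= addr0 add0r !eqxx.
Unshelve. all: by end_near. Qed.

End PairMaps.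

Section ProductMorphisms.
Context {n1 n2 : nat} {N1 : manifold R n1} {N2 : manifold R n2}.
Local Notation N := (prod_manifold N1 N2).
Variables (A1 : algebroid_data N1) (A2 : algebroid_data N2).
Hypotheses (hA1 : is_lie_algebroid A1) (hA2 : is_lie_algebroid A2).
Local Notation A := (prod_algebroid A1 A2).
Variable k : quadratic_lie_algebra R.
Variables (phi : bundle_map A1 (trivial_bundle N1 k))
  (psi : bundle_map A2 (trivial_bundle N2 k)).
Hypotheses (mphi : is_lie_morphism phi) (mpsi : is_lie_morphism psi).

Lemma smooth_phi1 (s : sect A) p : smooth_sec s p ->
  smoothv_at (fun q : N => phi q.1 (s q).1 : k) p.
Proof.
move=> [s1 _] l.
pose L : forall x, A1 x -> R := fun x u => l (phi x u).
apply: (pullback1_functional (U := setT) (l := L) openT I _ _ s1).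
  by move=> x a u v _; rewrite /L !linearP.
by move=> t st; exact: (mphi.1 t p.1 st l).
Qed.

Lemma smooth_psi2 (s : sect A) p : smooth_sec s p ->
  smoothv_at (fun q : N => psi q.2 (s q).2 : k) p.
Proof.
move=> [_ s2] l.
pose L : forall x, A2 x -> R := fun x u => l (psi x u).
apply: (pullback2_functional (U := setT) (l := L) openT I _ _ s2).
  by move=> x a u v _; rewrite /L !linearP.
by move=> t st; exact: (mpsi.1 t p.2 st l).
Qed.

(** [half_br_morphism] gives derivatives along the two slices, which [ddv_prod] assembles into one
    along the product anchor. *)
Lemma prod_morphism1 (u v : sect A) (p : N) : Gamma u -> Gamma v ->
  phi p.1 (abr u v p).1 =
  ddv (fun q : N => phi q.1 (v q).1 : k) p (anchor p (u p))
  - ddv (fun q : N => phi q.1 (u q).1 : k) p (anchor p (v p))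
  + lbr (phi p.1 (u p).1 : k) (phi p.1 (v p).1).
Proof.
case: p => x y Gu Gv; rewrite [(abr u v _).1](congr1 fst (prod_brE u v (x, y))).
rewrite [LHS](half_br_morphism x _ _ mphi (fam1_smooth hA1 Gu) (fam1_smooth hA1 Gv)).
rewrite [in RHS]ddv_prod; last exact: (smooth_phi1 (Gv (x, y))).
rewrite [X in _ = _ - X + _]ddv_prod; last exact: (smooth_phi1 (Gu (x, y))).
by rewrite !prod_anchorE !row_mxKl !row_mxKr.
Qed.

Lemma prod_morphism2 (u v : sect A) (p : N) : Gamma u -> Gamma v ->
  psi p.2 (abr u v p).2 =
  ddv (fun q : N => psi q.2 (v q).2 : k) p (anchor p (u p))
  - ddv (fun q : N => psi q.2 (u q).2 : k) p (anchor p (v p))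
  + lbr (psi p.2 (u p).2 : k) (psi p.2 (v p).2).
Proof.
case: p => x y Gu Gv; rewrite [(abr u v _).2](congr1 snd (prod_brE u v (x, y))).
rewrite [LHS](half_br_morphism y _ _ mpsi (fam2_smooth hA2 Gu) (fam2_smooth hA2 Gv)).
rewrite [in RHS]ddv_prod; last exact: (smooth_psi2 (Gv (x, y))).
rewrite [X in _ = _ - X + _]ddv_prod; last exact: (smooth_psi2 (Gu (x, y))).
rewrite !prod_anchorE !row_mxKl !row_mxKr.
by congr (_ - _ + _); exact: addrC.
Qed.

Let linear_diff (V : lmodType R) (a : R) (x y x' y' : V) :
  a *: x + y - (a *: x' + y') = a *: (x - x') + (y - y').
Proof. by rewrite scalerBr opprD addrACA. Qed.

Lemma mem_fibre_prod p (e : A p) :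
  e \in fibre_prod phi psi p <-> phi p.1 e.1 = psi p.2 e.2.
Proof.
rewrite memv_ker /diff_map linfun_lin; last first.
  move=> a u v; rewrite [phi _ _]linearP [psi _ _]linearP; exact: linear_diff.
rewrite subr_eq0; split=> [/eqP|/eqP] //.
Qed.

Hypothesis hsurj : forall (x : N1) (y : N2) (w : k),
       exists (u : A1 x) (v : A2 y), phi x u - psi y v = w.

(** The coordinates of [phi - psi] in a basis of [k] are smooth functionals, jointly onto by
    surjectivity, so [kernel_subbundle] applies. For sections of the kernel, [phi] and [psi] give
    the same function on the product, and the two morphism formulas then have equal right-hand
    sides. *)
Lemma fibre_prod_subalgebroid : is_lie_subalgebroid (A := A) (fibre_prod phi psi).
Proof.
split.
  pose l (j : 'I_(\dim {:k})) (p : N) (e : A p) : R :=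
    coord (vbasis {:k}) j (phi p.1 e.1 - psi p.2 e.2).
  apply: (kernel_subbundle (prod_vb hA1.1 hA2.1) (l := l)).
  - move=> j p a u v; rewrite /l [phi _ _]linearP [psi _ _]linearP.
    by rewrite [X in coord _ _ X]linear_diff linearP.
  - move=> j t p st; have H := smoothvD (smooth_phi1 st) (smoothvZ (smooth_cst (-1) p) (smooth_psi2 st)).
    have := (smoothv_coordP _ _).2 H j; apply: smooth_congr.
    by near=> q; rewrite scaleN1r.
  - move=> p e; rewrite mem_fibre_prod /l; split=> [-> j|H]; first by rewrite subrr linear0.
    apply/eqP; rewrite -subr_eq0; apply/eqP.
    rewrite (coord_vbasis (memvf (phi p.1 e.1 - psi p.2 e.2))) big1 // => j _.
    by rewrite H scale0r.
  - move=> [x y] w; have [u [v E]] := hsurj x y (\sum_j w j *: (vbasis {:k})`_j).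
    exists (u, v) => j; rewrite /l /= E; apply: coord_sum_free.
    exact: basis_free (vbasisP _).
move=> u v Gu Gv Du Dv p; apply/mem_fibre_prod.
rewrite prod_morphism1 // prod_morphism2 //.
have E (w : sect A) : in_sub (fibre_prod phi psi) w ->
    (fun q : N => phi q.1 (w q).1 : k) = (fun q : N => psi q.2 (w q).2 : k).
  by move=> Dw; apply/funext => q; apply/mem_fibre_prod; exact: Dw.
by rewrite (E u Du) (E v Dv) ((mem_fibre_prod _).1 (Du p)) ((mem_fibre_prod _).1 (Dv p)).
Unshelve. all: by end_near. Qed.

Lemma fibre_prod_lie : is_lie_algebroid (fibre_prod_algebroid phi psi).
Proof.
apply: sub_algebroid_lie; [exact: prod_lie|exact: fibre_prod_subalgebroid].
Qed.

End ProductMorphisms.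

End Morphisms.

(** * Isotropic and lagrangian structures *)

Section FibreProductMap.
Context {R : realType}.
Context {n1 n2 : nat} {N1 : manifold R n1} {N2 : manifold R n2}.
Local Notation N := (prod_manifold N1 N2).
Variables (A1 : algebroid_data N1) (A2 : algebroid_data N2).
Hypotheses (hA1 : is_lie_algebroid A1) (hA2 : is_lie_algebroid A2).
Variables (k k1 k2 : quadratic_lie_algebra R).
Variables (phi : bundle_map A1 (trivial_bundle N1 k))
  (psi : bundle_map A2 (trivial_bundle N2 k)).
Variables (phi1 : bundle_map A1 (trivial_bundle N1 k1))
  (psi2 : bundle_map A2 (trivial_bundle N2 k2)).
Local Notation A := (prod_algebroid A1 A2).
Local Notation D := (fibre_prod_algebroid phi psi).
Hypothesis brD : is_lie_subalgebroid (A := A) (fibre_prod phi psi).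

Definition fincl (u : sect D) : sect A := fun p => vsval (u p).

Lemma fincl_mem u p : phi p.1 (fincl u p).1 = psi p.2 (fincl u p).2.
Proof. by apply/mem_fibre_prod; exact: subvsP. Qed.

Lemma fincl_br (u v : sect D) (p : N) : Gamma u -> Gamma v ->
  vsval (abr u v p : D p) = abr (fincl u) (fincl v) p.
Proof.
move=> Gu Gv; rewrite /= vsprojK //; apply: brD.2 => //.
- by move=> q; exact: subvsP.
- by move=> q; exact: subvsP.
Qed.

Lemma fibre_anchorE p (e : D p) : anchor p e = anchor p (vsval e : A p).
Proof. by rewrite [LHS]linfun_lin // => a u v; rewrite !linearP. Qed.

Lemma fibre_prod_mapE p (e : D p) : fibre_prod_map phi psi phi1 psi2 p e =
  (phi1 p.1 (vsval e : A p).1, psi2 p.2 (vsval e : A p).2).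
Proof.
rewrite /fibre_prod_map linfun_lin // => a u v.
by rewrite !linearP.
Qed.

Hypotheses (mphi1 : is_lie_morphism phi1) (mpsi2 : is_lie_morphism psi2).

Lemma fibre_prod_map_smooth : bundle_map_smooth (fibre_prod_map phi psi phi1 psi2).
Proof.
move=> s p ss; apply: smoothv_pair.
  apply: smoothv_congr (smooth_phi1 mphi1 (ss : smooth_sec (fincl s) p)).
  by near=> q; rewrite /map_sect fibre_prod_mapE.
apply: smoothv_congr (smooth_psi2 mpsi2 (ss : smooth_sec (fincl s) p)).
by near=> q; rewrite /map_sect fibre_prod_mapE.
Unshelve. all: by end_near. Qed.

Lemma fibre_prod_morphism :
  is_lie_morphism (k := qla_prod k1 k2) (fibre_prod_map phi psi phi1 psi2).
Proof.
split; first exact: fibre_prod_map_smooth.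
move=> u v Gu Gv p.
have sm w : Gamma w ->
    smoothv_at (V := qla_prod k1 k2) (map_sect (fibre_prod_map phi psi phi1 psi2) w) p.
  by move=> Gw; exact: fibre_prod_map_smooth.
have su := sm u Gu; have sv := sm v Gv.
have E1 w : (fun q => qpr1 k1 k2 (map_sect (fibre_prod_map phi psi phi1 psi2) w q)) =
    fun q => phi1 q.1 (fincl w q).1.
  by apply/funext => q; rewrite qpr1E /map_sect fibre_prod_mapE.
have E2 w : (fun q => qpr2 k1 k2 (map_sect (fibre_prod_map phi psi phi1 psi2) w q)) =
    fun q => psi2 q.2 (fincl w q).2.
  by apply/funext => q; rewrite qpr2E /map_sect fibre_prod_mapE.
have L (V : vectType R) (l : 'Hom(qla_prod k1 k2, V)) a b c : l (a - b + c) = l a - l b + l c.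
  by rewrite linearD linearB.
rewrite !fibre_prod_mapE fincl_br // !fibre_anchorE; apply: qla_prod_ext.
  rewrite [LHS]qpr1E [RHS](L _ (qpr1 k1 k2)) [X in _ = _ + X]qpr1E.
  rewrite (ddv_hom (qpr1 k1 k2) _ sv) (ddv_hom (qpr1 k1 k2) _ su) !E1.
  exact: (prod_morphism1 hA1 mphi1).
rewrite [LHS]qpr2E [RHS](L _ (qpr2 k1 k2)) [X in _ = _ + X]qpr2E.
rewrite (ddv_hom (qpr2 k1 k2) _ sv) (ddv_hom (qpr2 k1 k2) _ su) !E2.
exact: (prod_morphism2 hA2 mpsi2).
Qed.

End FibreProductMap.

(** * The Courant form in chart derivatives *)

Section CourantForm.
Context {R : realType} {n : nat} {N : manifold R n}.
Variable k : quadratic_lie_algebra R.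

Lemma ipairDl (x y z : k) : ipair (x + y) z = ipair x z + ipair y z.
Proof. by have := ipair_linear 1 x y z; rewrite scale1r mul1r. Qed.

Lemma ipairZl (c : R) (x z : k) : ipair (c *: x) z = c * ipair x z.
Proof.
have := ipair_linear c x 0 z.
by rewrite addr0 [ipair 0 z]ipair_sym ipair0r addr0.
Qed.

Lemma coordf_dd_linear (a : form1 N) x (c : R) (u v w : TS x) : form1_smooth_at a x ->
  dd (fun y => a y (coordf x (c *: u + v) y)) x w =
  c * dd (fun y => a y (coordf x u y)) x w + dd (fun y => a y (coordf x v y)) x w.
Proof.
move=> sa; rewrite -ddZ; last exact: sa.
rewrite -ddD; [|by apply: smoothM; [exact: smooth_cst|exact: sa]|exact: sa].
apply: dd_congr; near=> y; rewrite coordf_linear ?linearP //.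
by near: y; exact: near_dom.
Unshelve. all: by end_near. Qed.

(** [linfun] returns the given function only when that function is linear, so linearity in [v] is
    checked term by term; [vdiff] makes it visible for the Lie derivative. *)
Lemma courant_formE (eta : form3 N) (X1 X2 : vfield N) (a1 a2 : form1 N) (w1 w2 : N -> k)
    x (v : TS x) : is_form3 eta ->
  vfield_smooth_at X1 x -> form1_smooth_at a1 x -> form1_smooth_at a2 x ->
  smoothv_at w1 x ->
  courant_form eta X1 a1 w1 X2 a2 w2 x v =
  dd (fun y => a2 y (coordf x v y)) x (X1 x) + (a2 x (vdiff X1 v) : R)
  - (dd (fun y => a1 y (coordf x v y)) x (X2 x)
     - dd (fun y => a1 y (coordf x (X2 x) y)) x v)
  + eta x (X1 x) (X2 x) v + ipair (ddv w1 x v) (w2 x).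
Proof.
move=> heta sX1 sa1 sa2 sw.
have lE u : lie_der1 X1 a2 x u = dd (fun y => a2 y (coordf x u y)) x (X1 x) + (a2 x (vdiff X1 u) : R).
  rewrite /lie_der1 vfield_br_coordf linearN opprK //.
have sum2L (c p q p' q' : R) : (c * p + q) + (c * p' + q') = c * (p + p') + (q + q').
  by ring.
have diff2L (c p q p' q' : R) : (c * p + q) - (c * p' + q') = c * (p - p') + (q - q').
  by ring.
have lL c u u' : lie_der1 X1 a2 x (c *: u + u') = c * lie_der1 X1 a2 x u + lie_der1 X1 a2 x u'.
  rewrite (lE (c *: u + u')) (coordf_dd_linear _ _ _ _ sa2) (vdiff_linear _ _ _ sX1).
  have aL (P Q : TS x) : (a2 x (c *: P + Q) : R) = c * (a2 x P : R) + (a2 x Q : R).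
    by rewrite linearP.
  by rewrite (lE u) (lE u') aL; exact: sum2L.
have eL c u u' : ext_d1 a1 x (X2 x) (c *: u + u') =
    c * ext_d1 a1 x (X2 x) u + ext_d1 a1 x (X2 x) u'.
  rewrite /ext_d1 (coordf_dd_linear _ _ _ _ sa1) (dd_linear _ _ _ (sa1 _)).
  exact: diff2L.
have wL c u u' : ipair (ddv w1 x (c *: u + u')) (w2 x) =
    c * ipair (ddv w1 x u) (w2 x) + ipair (ddv w1 x u') (w2 x).
  by rewrite ddv_linear // ipair_linear.
have [e1 e2 e3 _] := heta.
have eta3 c u u' : eta x (X1 x) (X2 x) (c *: u + u') =
    c * eta x (X1 x) (X2 x) u + eta x (X1 x) (X2 x) u'.
  have cyc a b U : eta x a b U = eta x U a b by rewrite [LHS]e3 [X in - X]e2 opprK.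
  by rewrite (cyc _ _ (c *: u + u')) e1 (cyc _ _ u) (cyc _ _ u').
have sumL (c l l' d d' e e' w w' : R) :
  (c * l + l') - (c * d + d') + (c * e + e') + (c * w + w') =
  c * (l - d + e + w) + (l' - d' + e' + w') by ring.
rewrite /courant_form linfun_lin; last first.
  by move=> c u u'; rewrite (lL c u u') (eL c u u') (eta3 c u u') (wL c u u'); exact: sumL.
by rewrite (lE v).
Qed.

End CourantForm.

Section HalfIsotropic.
Context {R : realType} {m n : nat} {M : manifold R m} {K : manifold R n}.
Variables (A : algebroid_data M) (k : quadratic_lie_algebra R).
Variables (Phi : bundle_map A (trivial_bundle M k))
  (lambda : bundle_map A (cotangent_bundle M)) (eta : form3 M).
Hypotheses (hA : is_lie_algebroid A) (sPhi : bundle_map_smooth Phi).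
Hypothesis iso : is_isotropic_structure Phi lambda eta.
Hypothesis ptiso : forall x (a b : A x),
  (lambda x a (anchor x b) : R) + (lambda x b (anchor x a) : R)
  + ipair (Phi x a : k) (Phi x b) = 0.
Implicit Types S T : forall x : M, K -> A x.

Let eval_hom x (w : TS x) : 'Hom(A x, R^o) :=
  linfun (fun a : A x => (lambda x a w : R^o)).

Let eval_homE x (w : TS x) a : eval_hom w a = lambda x a w.
Proof.
by rewrite /eval_hom linfun_lin // => c u v; rewrite linearP add_lfunE scale_lfunE.
Qed.

(** The contribution of one factor to the Courant form on the product: [w] is the part of the test
    vector in this factor and [W] the part in the other, along which the family [S] varies too. *)
Definition half_courant_form S T x y (X Y : TS y) (w : TS x) (W : TS y) : R :=
  dd (fun x' => lambda x' (T x' y) (coordf x w x')) x (anchor x (S x y))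
    + dd (fun y' => lambda x (T x y') w) y X
  + (lambda x (T x y) (vdiff (fun x' => anchor x' (S x' y)) w
                      + ddv (fun y' => anchor x (S x y') : TS x) y W) : R)
  - (dd (fun x' => lambda x' (S x' y) (coordf x w x')) x (anchor x (T x y))
      + dd (fun y' => lambda x (S x y') w) y Y
     - (dd (fun x' => lambda x' (S x' y) (coordf x (anchor x (T x y)) x')) x w
        + dd (fun y' => lambda x (S x y') (anchor x (T x y))) y W))
  + @eta x (anchor x (S x y)) (anchor x (T x y)) w
  + ipair (ddv (fun x' => Phi x' (S x' y) : k) x w
           + ddv (fun y' => Phi x (S x y') : k) y W) (Phi x (T x y)).

(* The terms along [W] add up to the pairing of [T] with the [W]-derivative of
   [S], which vanishes by isotropy. *)
Lemma half_br_isotropic S T x y (X Y : TS y) (w : TS x) (W : TS y) :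
  slice_smooth S -> slice_smooth T ->
  lambda x (half_br S T x X Y) w = half_courant_form S T X Y w W.
Proof.
move=> [S1 S2] [T1 T2].
have [sl heta _ br _] := iso; have [_ [sa _]] := hA.
have E : lambda x (half_br S T x X Y) w =
  (lambda x (abr (fun x => S x y) (fun x => T x y) x) w : R)
  + dd (fun y' => lambda x (T x y') w) y X - dd (fun y' => lambda x (S x y') w) y Y.
  rewrite -eval_homE /half_br linearB linearD /= !(hom_ddv _ (eval_hom w)) //.
  rewrite eval_homE; congr (_ + _ - _); apply: dd_eq => y'; exact: eval_homE.
rewrite E br // (courant_formE _ _ _ heta (sa _ _ (S1 y x)) (sl _ _ (S1 y x))
  (sl _ _ (T1 y x)) (sPhi (S1 y x))).
(* The derivative along [W] is a vector in the fibre over [x], so pointwise isotropy applies to it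
   directly. *)
have I := ptiso (ddv (S x) y W) (T x y).
rewrite -eval_homE (hom_ddv _ (eval_hom _)) // (ddv_hom (anchor x)) // (ddv_hom (Phi x)) // in I.
have lD (p q : TS x) : (lambda x (T x y) (p + q) : R) =
    (lambda x (T x y) p : R) + (lambda x (T x y) q : R) by rewrite linearD.
rewrite /half_courant_form ipairDl lD /map_sect.
have F : dd (fun y' => eval_hom (anchor x (T x y)) (S x y')) y W =
         dd (fun y' => lambda x (S x y') (anchor x (T x y))) y W.
  by apply: dd_eq => y'; exact: eval_homE.
rewrite F in I.
have abs (a b c d e f g h r s t : R) : r + s + t = 0 ->
  a + b - (c - d) + e + f + g - h =
  a + g + (b + s) - (c + h - (d + r)) + e + (f + t) by move=> H; lra.
exact: abs I.
Qed.

End HalfIsotropic.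

Section PointwiseIsotropy.
Context {R : realType} {n : nat} {N : manifold R n}.
Variables (A : algebroid_data N) (k : quadratic_lie_algebra R).
Variables (Phi : bundle_map A (trivial_bundle N k))
  (lambda : bundle_map A (cotangent_bundle N)) (eta : form3 N).

Lemma courant_mapE x a :
  courant_map Phi lambda x a = ((anchor x a, lambda x a), Phi x a).
Proof.
rewrite /courant_map linfun_lin // => c u v.
by rewrite !linearP.
Qed.

(** The isotropy clause speaks of values of global sections; the lagrangian image gives the relation
    for arbitrary vectors of a fibre without extending them. *)
Lemma lagrangian_isotropic : is_lagrangian_structure Phi lambda eta ->
  forall x (a b : A x), (lambda x a (anchor x b) : R) + (lambda x b (anchor x a) : R)
  + ipair (Phi x a : k) (Phi x b) = 0.
Proof.
move=> [_ _ [_ lag _]] x a b.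
have La : courant_map Phi lambda x a \in limg (courant_map Phi lambda x).
  by apply: memv_img; exact: memvf.
have Lb : courant_map Phi lambda x b \in limg (courant_map Phi lambda x).
  by apply: memv_img; exact: memvf.
by have := (lag x _).1 La _ Lb; rewrite !courant_mapE.
Qed.

End PointwiseIsotropy.

(** * The form and the pairing on the fibre product *)

Section FibreProductIsotropic.
Context {R : realType}.
Context {n1 n2 : nat} {N1 : manifold R n1} {N2 : manifold R n2}.
Local Notation N := (prod_manifold N1 N2).
Variables (A1 : algebroid_data N1) (A2 : algebroid_data N2).
Variables (k k1 k2 : quadratic_lie_algebra R).
Variables (phi1 : bundle_map A1 (trivial_bundle N1 k1))
  (phi : bundle_map A1 (trivial_bundle N1 k))
  (psi2 : bundle_map A2 (trivial_bundle N2 k2))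
  (psi : bundle_map A2 (trivial_bundle N2 k)).
Hypotheses (hphi : is_lie_morphism (k := qla_prod k1 k) (pair_map phi1 phi))
  (hpsi : is_lie_morphism (k := qla_prod k2 k) (pair_map psi2 psi)).
Variables (lambda1 : bundle_map A1 (cotangent_bundle N1)) (eta1 : form3 N1).
Variables (lambda2 : bundle_map A2 (cotangent_bundle N2)) (eta2 : form3 N2).
Hypotheses (h1 : is_lagrangian_structure (k := qla_prod k1 k)
            (pair_map phi1 phi) lambda1 eta1)
    (h2 : is_lagrangian_structure (k := qla_prod k2 (opposite k))
            (pair_map (k2 := opposite k) psi2 psi) lambda2 eta2).
Local Notation A := (prod_algebroid A1 A2).
Local Notation D := (fibre_prod_algebroid phi psi).
Local Notation lambda := (fibre_prod_form phi psi lambda1 lambda2).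
Local Notation Phi := (fibre_prod_map phi psi phi1 psi2).
Local Notation l1 := (fun z : 'rV[R]_(n1 + n2) => lsubmx z : 'rV[R]_n1).
Local Notation r2 := (fun z : 'rV[R]_(n1 + n2) => rsubmx z : 'rV[R]_n2).

Lemma dpr1E (p : N) (z : TS p) : dpr1 p z = lsubmx (z : 'rV[R]_(n1 + n2)).
Proof. by rewrite linfun_lin // => a u v; rewrite linearP. Qed.

Lemma dpr2E (p : N) (z : TS p) : dpr2 p z = rsubmx (z : 'rV[R]_(n1 + n2)).
Proof. by rewrite linfun_lin // => a u v; rewrite linearP. Qed.

Lemma fibre_formE (p : N) (e : D p) (z : TS p) : lambda p e z =
  (lambda1 p.1 (vsval e : A p).1 (l1 z) : R) + (lambda2 p.2 (vsval e : A p).2 (r2 z) : R).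
Proof.
rewrite /fibre_prod_form linfun_lin.
  by rewrite add_lfunE !comp_lfunE dpr1E dpr2E.
move=> a u v; apply/lfunP => w.
rewrite !(add_lfunE, scale_lfunE, comp_lfunE) !linearP.
rewrite !(add_lfunE, scale_lfunE, comp_lfunE) scalerDr addrACA.
by [].
Qed.

Let G1 (s : sect A) (x : N1) (w : TS x) (q : N) : R :=
  lambda1 q.1 (s q).1 (coordf x w q.1).
Let G2 (s : sect A) (y : N2) (w : TS y) (q : N) : R :=
  lambda2 q.2 (s q).2 (coordf y w q.2).

Lemma smooth_form1 (s : sect A) (p : N) (w : TS p.1) : smooth_sec s p ->
  smooth_at (G1 s w) p.
Proof.
move=> [s1 _]; have [[sl _ _ _ _] _ _] := h1.
pose l : forall x', A1 x' -> R := fun x' u => lambda1 x' u (coordf p.1 w x').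
apply: (pullback1_functional (p := p) (U := setT) (l := l) openT I _ _ s1).
  by move=> x' a u v _; rewrite /l linearP add_lfunE scale_lfunE.
by move=> t st; exact: (sl t p.1 st w).
Qed.

Lemma smooth_form2 (s : sect A) (p : N) (w : TS p.2) : smooth_sec s p ->
  smooth_at (G2 s w) p.
Proof.
move=> [_ s2]; have [[sl _ _ _ _] _ _] := h2.
pose l : forall x', A2 x' -> R := fun x' u => lambda2 x' u (coordf p.2 w x').
apply: (pullback2_functional (p := p) (U := setT) (l := l) openT I _ _ s2).
  by move=> x' a u v _; rewrite /l linearP add_lfunE scale_lfunE.
by move=> t st; exact: (sl t p.2 st w).
Qed.

Lemma fibre_form_coordf (s : sect D) (p q : N) (w : TS p) :
  lambda q (s q) (coordf p w q) =
  G1 (fincl s) (l1 w : TS p.1) q + G2 (fincl s) (r2 w : TS p.2) q.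
Proof. by rewrite fibre_formE coordf_prod row_mxKl row_mxKr. Qed.

Lemma fibre_form_smooth : bundle_map_smooth lambda.
Proof.
move=> s p ss w.
apply: smooth_congr (smoothD (smooth_form1 (l1 w : TS p.1) (ss : smooth_sec (fincl s) p))
  (smooth_form2 (r2 w : TS p.2) (ss : smooth_sec (fincl s) p))).
by near=> q; rewrite /map_sect fibre_form_coordf.
Unshelve. all: by end_near. Qed.

(** Along the other factor the base point of each [lambda] does not move, so the coordinate field
    keeps its value there and [coordf] disappears from the cross terms. *)
Lemma dd_fibre_form (s : sect D) (x : N1) (y : N2) (w z : TS ((x, y) : N)) : Gamma s ->
  dd (fun q : N => lambda q (s q) (coordf ((x, y) : N) w q)) (x, y) z =
  (dd (fun x' => lambda1 x' (fam1 (fincl s) x' y) (coordf x (l1 w) x')) x (l1 z)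
   + dd (fun y' => lambda1 x (fam1 (fincl s) x y') (l1 w)) y (r2 z))
  + (dd (fun y' => lambda2 y' (fam2 (fincl s) y' x) (coordf y (r2 w) y')) y (r2 z)
   + dd (fun x' => lambda2 y (fam2 (fincl s) y x') (r2 w)) x (l1 z)).
Proof.
move=> Gs; have ss : smooth_sec (fincl s) ((x, y) : N) := Gs (x, y).
have s1 := smooth_form1 (p := (x, y) : N) (l1 w : TS x) ss.
have s2 := smooth_form2 (p := (x, y) : N) (r2 w : TS y) ss.
rewrite (dd_eq _ (g := fun q => G1 (fincl s) (l1 w : TS x) q + G2 (fincl s) (r2 w : TS y) q)); last first.
  by move=> q; exact: fibre_form_coordf.
rewrite (ddD _ s1 s2) (dd_prod _ s1) (dd_prod _ s2).
congr (_ + _); last rewrite addrC; congr (_ + _); apply: dd_eq => q.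
  by rewrite /G1 /= coordf_id.
by rewrite /G2 /= coordf_id.
Qed.

Let mPhi1 : is_lie_morphism (k := qla_prod k1 k) (pair_map phi1 phi) := hphi.
(** The opposite changes the pairing only, while being a morphism involves the bracket only, so the
    hypothesis is reused by conversion. *)
Let mPhi2 : is_lie_morphism (k := qla_prod k2 (opposite k)) (pair_map (k2 := opposite k) psi2 psi) := hpsi.

Lemma ipair_ddv_pair n (K : manifold R n) (ka kb : quadratic_lie_algebra R)
    (F : K -> qla_prod ka kb) (z : K) (v : TS z) (w : qla_prod ka kb) :
  smoothv_at (V := qla_prod ka kb) F z ->
  ipair (ddv (V := qla_prod ka kb) F z v : qla_prod ka kb) w =
  ipair (ddv (fun q => (F q).1 : ka) z v) w.1 + ipair (ddv (fun q => (F q).2 : kb) z v) w.2.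
Proof.
move=> sF.
have e1 : (ddv (V := qla_prod ka kb) F z v).1 = ddv (fun q => (F q).1 : ka) z v.
  rewrite -(qpr1E (ddv (V := qla_prod ka kb) F z v)) (ddv_hom (qpr1 ka kb) _ sF).
  by apply: ddv_eq => q; rewrite qpr1E.
have e2 : (ddv (V := qla_prod ka kb) F z v).2 = ddv (fun q => (F q).2 : kb) z v.
  rewrite -(qpr2E (ddv (V := qla_prod ka kb) F z v)) (ddv_hom (qpr2 ka kb) _ sF).
  by apply: ddv_eq => q; rewrite qpr2E.
by rewrite -e1 -e2.
Qed.

(* On the fibre product the two [k]-components agree, and their contributions
   cancel because [k] and its opposite carry opposite pairings. *)
Lemma fibre_ipair (u v : sect D) (x : N1) (y : N2) (w : TS ((x, y) : N)) : Gamma u ->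
  ipair (ddv (fun x' => pair_map phi1 phi x' (fam1 (fincl u) x' y) : qla_prod k1 k) x (l1 w)
         + ddv (fun y' => pair_map phi1 phi x (fam1 (fincl u) x y') : qla_prod k1 k) y (r2 w)
         : qla_prod k1 k) (pair_map phi1 phi x (fam1 (fincl v) x y))
  + ipair (ddv (fun y' => pair_map (k2 := opposite k) psi2 psi y' (fam2 (fincl u) y' x)
                 : qla_prod k2 (opposite k)) y (r2 w)
         + ddv (fun x' => pair_map (k2 := opposite k) psi2 psi y (fam2 (fincl u) y x')
                 : qla_prod k2 (opposite k)) x (l1 w)
         : qla_prod k2 (opposite k))
      (pair_map (k2 := opposite k) psi2 psi y (fam2 (fincl v) y x))
  = ipair (ddv (fun q => map_sect Phi u q : qla_prod k1 k2) (x, y) w : qla_prod k1 k2)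
          (Phi (x, y) (v (x, y)) : qla_prod k1 k2).
Proof.
move=> Gu; have su : smooth_sec (fincl u) ((x, y) : N) := Gu (x, y).
have S1 := smooth_phi1 mPhi1 su; have S2 := smooth_psi2 mPhi2 su.
have [m1 _] := lie_morphism_pair hphi; have [m2 _] := lie_morphism_pair hpsi.
have S := fibre_prod_map_smooth m1 m2 (Gu (x, y)).
rewrite -[X in ipair X _ + _ = _](ddv_prod w S1).
rewrite [X in ipair X (pair_map _ _ y _)]addrC -[X in ipair X (pair_map _ _ y _)](ddv_prod w S2).
rewrite (ipair_ddv_pair _ _ S1) (ipair_ddv_pair _ _ S2) (ipair_ddv_pair _ _ S).
have F1 : (fun q : N => (pair_map phi1 phi q.1 (fincl u q).1).1) =
    (fun q => (map_sect Phi u q).1).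
  by apply/funext => q; rewrite pair_mapE /map_sect fibre_prod_mapE.
have F2 : (fun q : N => (pair_map phi1 phi q.1 (fincl u q).1).2) =
    (fun q => phi q.1 (fincl u q).1).
  by apply/funext => q; rewrite pair_mapE.
have F3 : (fun q : N => (pair_map (k2 := opposite k) psi2 psi q.2 (fincl u q).2).1) =
    (fun q => (map_sect Phi u q).2).
  by apply/funext => q; rewrite pair_mapE /map_sect fibre_prod_mapE.
have F4 : (fun q : N => (pair_map (k2 := opposite k) psi2 psi q.2 (fincl u q).2).2) =
    (fun q => phi q.1 (fincl u q).1).
  by apply/funext => q; rewrite pair_mapE fincl_mem.
rewrite F1 F2 F3 F4 !pair_mapE fibre_prod_mapE.
have E : psi y (fam2 (fincl v) y x) = phi x (fam1 (fincl v) x y).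
  by rewrite (fincl_mem v ((x, y) : N)).
have cancel_k (a b c : R) : a + b + (c + - b) = a + c by ring.
rewrite [LHS]/= E; exact: cancel_k.
Qed.

End FibreProductIsotropic.

(** * From pointwise orthogonality to a Dirac structure *)

Section LagrangianCriterion.
Context {R : realType} {n : nat} {N : manifold R n}.

Lemma image_subbundle (B C : bundle N) (F : bundle_map B C) : is_vector_bundle B ->
  bundle_map_smooth F -> (forall x, injective (F x)) -> is_subbundle (fun x => limg (F x)).
Proof.
move=> vb sF iF x; have [U [r [e [fr Ux]]]] := exists_frame vb x.
have [oU bU _] := fr.
exists U, r, (fun i => map_sect F (e i)); split=> //.
  by move=> y Uy i; apply: sF; exact: (frame_smooth fr).
have Fsum y (k : 'I_r -> R) : \sum_i k i *: map_sect F (e i) y = F y (\sum_i k i *: e i y).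
  by rewrite linear_sum; apply: eq_bigr => i _; rewrite linearZ.
move=> y Uy; have [_ ie se] := (frame_basisP _ _).1 (bU y Uy); apply/frame_basisP; split.
- by move=> i; apply: memv_img; exact: memvf.
- move=> k; rewrite Fsum => k0; apply: ie; apply: (iF y); rewrite k0.
  by rewrite linear0.
- move=> _ /memv_imgP [v _ ->]; have [k ->] := se v (memvf v).
  by exists k; rewrite Fsum.
Qed.

Variables (A : algebroid_data N) (k : quadratic_lie_algebra R).
Variables (Phi : bundle_map A (trivial_bundle N k))
  (lambda : bundle_map A (cotangent_bundle N)) (eta : form3 N).
Hypotheses (hA : is_lie_algebroid A) (mPhi : is_lie_morphism Phi).
Hypothesis iso : is_isotropic_structure Phi lambda eta.
Hypothesis inj : forall x, injective (courant_map Phi lambda x).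

Lemma courant_map_smooth : bundle_map_smooth (courant_map Phi lambda).
Proof.
have [_ [sa _]] := hA; have [sl _ _ _ _] := iso.
move=> s x ss.
have E : map_sect (courant_map Phi lambda) s =
    fun y => ((anchor y (s y), lambda y (s y)), Phi y (s y)).
  by apply: sect_ext => y; rewrite /map_sect courant_mapE.
rewrite E; split; last exact: (mPhi.1 s x ss).
by split; [exact: (sa s x ss)|exact: (sl s x ss)].
Qed.

(** The Dirac condition quantifies over smooth sections of the image. Their fibrewise preimages are
    smooth by [smooth_lift], the components of the anchor, the form and the morphism being jointly
    injective functionals. *)
Lemma courant_map_lift (s : sect (courant_bundle k)) : Gamma s ->
  in_sub (fun x => limg (courant_map Phi lambda x)) s ->
  exists2 u : sect A, Gamma u & s = fun x => courant_map Phi lambda x (u x).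
Proof.
move=> Gs Ls; have [vb [sa _]] := hA; have [sl _ _ _ _] := iso.
pose u : sect A := fun x => ((courant_map Phi lambda x)^-1)%VF (s x).
have su x : s x = courant_map Phi lambda x (u x).
  by rewrite /u limg_lfunVK //; exact: Ls.
exists u; last exact: sect_ext.
move=> x; pose d := \dim {:k}.
(* All components are packed in one row, giving [smooth_lift] a single family of functionals;
   everything is read in the chart at the fixed point [x]. *)
pose L y (a : A y) : 'rV[R]_(n + (n + d)) := row_mx (chart_comp x (anchor y a : TS y))
  (row_mx (\row_i (lambda y a (coordf x (delta_mx ord0 i : 'rV[R]_n) y) : R))
          (\row_i coord (vbasis {:k}) i (Phi y a))).
have rowE (J : 'I_(n + (n + d)) -> Prop) :
    (forall i, J (lshift _ i)) -> (forall i, J (rshift n (lshift d i))) ->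
    (forall i, J (rshift n (rshift n i))) -> forall j, J j.
  move=> J1 J2 J3 j; rewrite -(splitK j); case: (fintype.split j) => a //=.
  by rewrite -(splitK a); case: (fintype.split a) => b /=.
have L1 y a i : L y a ord0 (lshift _ i) = chart_comp x (anchor y a : TS y) ord0 i.
  by rewrite row_mxEl.
have L2 y a i : L y a ord0 (rshift n (lshift d i)) =
    lambda y a (coordf x (delta_mx ord0 i : 'rV[R]_n) y).
  by rewrite row_mxEr row_mxEl mxE.
have L3 y a i : L y a ord0 (rshift n (rshift n i)) = coord (vbasis {:k}) i (Phi y a).
  by rewrite row_mxEr row_mxEr mxE.
apply: (smooth_lift vb (l := fun j y a => L y a ord0 j)).
- near=> y; apply: rowE => i c a b.
  + rewrite !L1 linearP chart_comp_linear; last by near: y; exact: near_dom.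
    by rewrite [LHS]mxE [X in X + _]mxE.
  + by rewrite !L2 linearP add_lfunE scale_lfunE.
  + by rewrite !L3 !linearP.
- apply: rowE => i t st.
  + apply: smooth_congr (sa t x st i); near=> y; by rewrite L1.
  + apply: smooth_congr (sl t x st (delta_mx ord0 i : 'rV[R]_n)).
    by near=> y; rewrite L2.
  + apply: smooth_congr ((smoothv_coordP _ _).2 (mPhi.1 t x st) i).
    by near=> y; rewrite L3.
- move=> a La; apply: (@inj x); rewrite linear0 courant_mapE.
  have a0 : anchor x a = 0.
    rewrite -[LHS](chart_comp_id (anchor x a : TS x)); apply/rowP => i.
    by rewrite -L1 La mxE.
  have l0 : lambda x a = 0.
    apply/lfunP => w; rewrite -[w]sum_delta_mx lfunE /= linear_sum big1 // => i _.
    rewrite linearZ /= -[X in _ *: X](_ : L x a ord0 (rshift n (lshift d i)) = _).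
      by rewrite La scaler0.
    by rewrite L2 coordf_id.
  have p0 : Phi x a = 0.
    rewrite (coord_vbasis (memvf (Phi x a))) big1 // => i _.
    by rewrite -L3 La scale0r.
  by rewrite a0 l0 p0.
- have [sX sF] := Gs x; have [sT sC] := sX.
  have sE y : [/\ anchor y (u y) = (s y).1.1, lambda y (u y) = (s y).1.2 & Phi y (u y) = (s y).2].
    by rewrite su courant_mapE.
  apply: rowE => i.
  + apply: smooth_congr (sT i); near=> y; rewrite L1.
    by have [-> _ _] := sE y.
  + apply: smooth_congr (sC (delta_mx ord0 i : 'rV[R]_n)); near=> y; rewrite L2.
    by have [_ -> _] := sE y.
  + apply: smooth_congr ((smoothv_coordP _ _).2 sF i); near=> y; rewrite L3.
    by have [_ _ ->] := sE y.
Unshelve. all: by end_near. Qed.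

(** Once sections of the image are lifted, the three components of their Courant bracket are the
    anchor, form and morphism identities for the bracket of the lifts. *)
Lemma lagrangian_of_isotropic :
  (forall x (e : courant_bundle k x), e \in limg (courant_map Phi lambda x) <->
    (forall e', e' \in limg (courant_map Phi lambda x) -> courant_pair e e' = 0)) ->
  is_lagrangian_structure Phi lambda eta.
Proof.
move=> lag; have [vb [_ [cl [_ [_ [_ [_ anc]]]]]]] := hA.
split=> //; split=> //.
  by apply: image_subbundle => //; exact: courant_map_smooth.
move=> s1 s2 Gs1 Gs2 Ls1 Ls2 x.
have [u Gu ->] := courant_map_lift Gs1 Ls1; have [v Gv ->] := courant_map_lift Gs2 Ls2.
apply/memv_imgP; exists (abr u v x); first exact: memvf.
have [_ _ _ br _] := iso.
rewrite courant_mapE anc // br // mPhi.2 //.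
have E (w : sect A) : (fun y => courant_map Phi lambda y (w y)) =
    (fun y => ((anchor y (w y), lambda y (w y)), Phi y (w y))).
  by apply: sect_ext => y; rewrite courant_mapE.
by rewrite (E u) (E v).
Qed.

End LagrangianCriterion.

Section SumForms.
Context {R : realType}.
Context {n1 n2 : nat} {N1 : manifold R n1} {N2 : manifold R n2}.
Local Notation N := (prod_manifold N1 N2).

Lemma dpr1_coordf (p q : N) (u : TS p) :
  dpr1 q (coordf p u q) = coordf p.1 (dpr1 p u) q.1.
Proof. by rewrite [LHS]dpr1E coordf_prod row_mxKl (dpr1E u). Qed.

Lemma dpr2_coordf (p q : N) (u : TS p) :
  dpr2 q (coordf p u q) = coordf p.2 (dpr2 p u) q.2.
Proof. by rewrite [LHS]dpr2E coordf_prod row_mxKr (dpr2E u). Qed.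

Lemma form3_sum_coordf (h1 : form3 N1) (h2 : form3 N2) (p q : N) (u v w : TS p) :
  @form3_sum _ _ _ _ _ h1 h2 q (coordf p u q) (coordf p v q) (coordf p w q) =
  h1 q.1 (coordf p.1 (dpr1 p u) q.1) (coordf p.1 (dpr1 p v) q.1) (coordf p.1 (dpr1 p w) q.1)
  + h2 q.2 (coordf p.2 (dpr2 p u) q.2) (coordf p.2 (dpr2 p v) q.2) (coordf p.2 (dpr2 p w) q.2).
Proof. by congr (h1 _ _ _ _ + h2 _ _ _ _); (exact: dpr1_coordf || exact: dpr2_coordf). Qed.

Lemma form3_sum_is_form3 (h1 : form3 N1) (h2 : form3 N2) : is_form3 h1 -> is_form3 h2 ->
  is_form3 (form3_sum h1 h2).
Proof.
move=> [a1 b1 c1 d1] [a2 b2 c2 d2]; split.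
- move=> p c u u' v w; rewrite /form3_sum !linearP a1 a2.
  have abs (x y z t : R) : c * x + y + (c * z + t) = c * (x + z) + (y + t) by ring.
  exact: abs.
- by move=> p u v w; rewrite /form3_sum b1 b2 opprD.
- by move=> p u v w; rewrite /form3_sum c1 c2 opprD.
- move=> p u v w.
  have s1 := d1 p.1 (dpr1 p u) (dpr1 p v) (dpr1 p w).
  have s2 := d2 p.2 (dpr2 p u) (dpr2 p v) (dpr2 p w).
  apply: smooth_congr (smoothD (smooth_fst s1) (smooth_snd s2)); near=> q.
  by rewrite form3_sum_coordf.
Unshelve. all: by end_near. Qed.

(** Coordinate fields of a product chart project to coordinate fields of the factors, so each of the
    four terms is the sum of its analogues. *)
Lemma form3_sum_closed (h1 : form3 N1) (h2 : form3 N2) : is_form3 h1 -> is_form3 h2 ->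
  closed3 h1 -> closed3 h2 -> closed3 (form3_sum h1 h2).
Proof.
move=> [_ _ _ d1] [_ _ _ d2] cl1 cl2 p v0 v1 v2 v3.
pose F (u v w z : TS p) : R :=
  dd (fun q => @form3_sum _ _ _ _ _ h1 h2 q (coordf p u q) (coordf p v q) (coordf p w q)) p z.
pose F1 (u v w z : TS p.1) : R :=
  dd (fun x => h1 x (coordf p.1 u x) (coordf p.1 v x) (coordf p.1 w x)) p.1 z.
pose F2 (u v w z : TS p.2) : R :=
  dd (fun y => h2 y (coordf p.2 u y) (coordf p.2 v y) (coordf p.2 w y)) p.2 z.
change (F v1 v2 v3 v0 - F v0 v2 v3 v1 + F v0 v1 v3 v2 - F v0 v1 v2 v3 = 0).
have E (u v w z : TS p) : F u v w z =
    F1 (dpr1 p u) (dpr1 p v) (dpr1 p w) (dpr1 p z)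
    + F2 (dpr2 p u) (dpr2 p v) (dpr2 p w) (dpr2 p z).
  have s1 := d1 p.1 (dpr1 p u) (dpr1 p v) (dpr1 p w).
  have s2 := d2 p.2 (dpr2 p u) (dpr2 p v) (dpr2 p w).
  rewrite /F /F1 /F2 (dpr1E z) (dpr2E z) -dd_fst -dd_snd -(ddD _ (smooth_fst s1) (smooth_snd s2)).
  by apply: dd_eq => q; exact: form3_sum_coordf.
have C1 (a0 a1 a2 a3 : TS p.1) : F1 a1 a2 a3 a0 - F1 a0 a2 a3 a1 + F1 a0 a1 a3 a2
  - F1 a0 a1 a2 a3 = 0 := cl1 p.1 a0 a1 a2 a3.
have C2 (a0 a1 a2 a3 : TS p.2) : F2 a1 a2 a3 a0 - F2 a0 a2 a3 a1 + F2 a0 a1 a3 a2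
  - F2 a0 a1 a2 a3 = 0 := cl2 p.2 a0 a1 a2 a3.
(* With the derivatives opaque, only linear arithmetic remains. *)
clearbody F F1 F2; rewrite !E.
have := C1 (dpr1 p v0) (dpr1 p v1) (dpr1 p v2) (dpr1 p v3).
have := C2 (dpr2 p v0) (dpr2 p v1) (dpr2 p v2) (dpr2 p v3).
have abs (x1 x2 x3 x4 y1 y2 y3 y4 : R) :
  y1 - y2 + y3 - y4 = 0 -> x1 - x2 + x3 - x4 = 0 ->
  x1 + y1 - (x2 + y2) + (x3 + y3) - (x4 + y4) = 0 by move=> H1 H2; lra.
exact: abs.
Qed.

End SumForms.

(** * Representing functionals by the pairing *)

Section Representation.
Context {R : realType}.
Variable k : quadratic_lie_algebra R.

Lemma ipairNl (x y : k) : ipair (- x) y = - ipair x y.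
Proof. by rewrite -scaleN1r ipairZl mulN1r. Qed.

Lemma ipair_linear_r (x : k) (c : R) (y z : k) :
  ipair x (c *: y + z) = c * ipair x y + ipair x z.
Proof. by rewrite !(ipair_sym x) ipair_linear. Qed.

Lemma ipairBr (x y z : k) : ipair x (y - z) = ipair x y - ipair x z.
Proof. by rewrite !(ipair_sym x) ipairDl ipairNl. Qed.

(** Nondegeneracy makes the map from [k] to its dual injective, and equality of dimensions makes it
    onto. *)
Lemma ipair_represent (l : 'Hom(k, R^o)) : exists w : k, forall z, ipair w z = l z.
Proof.
pose G w : 'Hom(k, R^o) := linfun (fun z : k => ipair w z : R^o).
have GE w z : G w z = ipair w z.
  by rewrite /G linfun_lin // => c u v; exact: ipair_linear_r.
pose F : 'Hom(k, 'Hom(k, R^o)) := linfun G.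
have FE w : F w = G w.
  rewrite /F linfun_lin // => c u v; apply/lfunP => z.
  by rewrite add_lfunE scale_lfunE !GE ipair_linear.
have F0 : ({:k} :&: lker F)%VS = 0%VS.
  apply/eqP; rewrite -subv0; apply/subvP => w; rewrite memv_cap memv_ker memvf /=.
  move=> /eqP Fw; rewrite memv0; apply/eqP/ipair_nondegenerate => z.
  by rewrite -GE -FE Fw lfunE.
have FT : limg F = fullv.
  apply/eqP; rewrite eqEdim subvf /= (limg_dim_eq F0) !dimvf.
  by rewrite /dim /= muln1.
have : l \in limg F by rewrite FT memvf.
by move=> /memv_imgP [w _ lE]; exists w => z; rewrite lE FE GE.
Qed.

(** [e] and the preimage of [g e] chosen by [g^-1] differ by an element of the kernel of [g], where
    [f] vanishes; so [f] descends to [k] and is represented there. *)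
Lemma ipair_factor (E : vectType R) (f : 'Hom(E, R^o)) (g : 'Hom(E, k)) :
  (forall w, exists e, g e = w) -> (forall e, g e = 0 -> f e = 0) ->
  exists w : k, forall e, f e = ipair w (g e).
Proof.
move=> gs fg; have [w wE] := ipair_represent (f \o g^-1)%VF.
exists w => e; rewrite wE comp_lfunE.
have K : g ((g^-1)%VF (g e)) = g e.
  by apply: limg_lfunVK; apply: memv_img; exact: memvf.
apply/eqP; rewrite -subr_eq0 -(linearB f); apply/eqP/fg.
apply: (etrans (linearB g _ _)); apply/eqP; rewrite subr_eq0; apply/eqP.
exact/esym/K.
Qed.

End Representation.

(** [T1] to [T6] are the terms of the Courant form on the product, [X1] and [X2] the halves from the
    two factors. Stating it over variables lets [ring] run without meeting the derivatives. *)
Lemma courant_sum_comb (R : comRingType) (T1 T2 T3 T4 T5 T6 X1 X2 : R)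
    (a1 b1 c1 d1 e1 f1 l1 g1 i1 a2 b2 c2 d2 e2 f2 l2 g2 i2 : R) :
  T1 = a1 + b1 + (a2 + b2) -> T2 = l1 + l2 -> T3 = c1 + d1 + (c2 + d2) ->
  T4 = e1 + f1 + (e2 + f2) -> T5 = g1 + g2 -> i1 + i2 = T6 ->
  X1 = a1 + b1 + l1 - (c1 + d1 - (e1 + f1)) + g1 + i1 ->
  X2 = a2 + b2 + l2 - (c2 + d2 - (e2 + f2)) + g2 + i2 ->
  X1 + X2 = T1 + T2 - (T3 - T4) + T5 + T6.
Proof. by move=> -> -> -> -> -> <- -> ->; ring. Qed.

(** * The lagrangian structure on the fibre product *)

Section FibreProductLagrangian.
Context {R : realType}.
Context {n1 n2 : nat} {N1 : manifold R n1} {N2 : manifold R n2}.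
Local Notation N := (prod_manifold N1 N2).
Variables (A1 : algebroid_data N1) (A2 : algebroid_data N2).
Hypotheses (hA1 : is_lie_algebroid A1) (hA2 : is_lie_algebroid A2).
Variables (k k1 k2 : quadratic_lie_algebra R).
Variables (phi1 : bundle_map A1 (trivial_bundle N1 k1))
  (phi : bundle_map A1 (trivial_bundle N1 k))
  (psi2 : bundle_map A2 (trivial_bundle N2 k2))
  (psi : bundle_map A2 (trivial_bundle N2 k)).
Hypotheses (hphi : is_lie_morphism (k := qla_prod k1 k) (pair_map phi1 phi))
  (hpsi : is_lie_morphism (k := qla_prod k2 k) (pair_map psi2 psi)).
Variables (lambda1 : bundle_map A1 (cotangent_bundle N1)) (eta1 : form3 N1).
Variables (lambda2 : bundle_map A2 (cotangent_bundle N2)) (eta2 : form3 N2).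
Hypotheses (h1 : is_lagrangian_structure (k := qla_prod k1 k)
            (pair_map phi1 phi) lambda1 eta1)
    (h2 : is_lagrangian_structure (k := qla_prod k2 (opposite k))
            (pair_map (k2 := opposite k) psi2 psi) lambda2 eta2).
Hypothesis hsurj : forall (x : N1) (y : N2) (w : k),
       exists (u : A1 x) (v : A2 y), phi x u - psi y v = w.
Local Notation A := (prod_algebroid A1 A2).
Local Notation D := (fibre_prod_algebroid phi psi).
Local Notation lambda := (fibre_prod_form phi psi lambda1 lambda2).
Local Notation Phi := (fibre_prod_map phi psi phi1 psi2).
Local Notation eta := (form3_sum eta1 eta2).

Let mPhi1 : is_lie_morphism (k := qla_prod k1 k) (pair_map phi1 phi) := hphi.
Let mPhi2 : is_lie_morphism (k := qla_prod k2 (opposite k)) (pair_map (k2 := opposite k) psi2 psi) := hpsi.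

Let iso1 x (a b : A1 x) : (lambda1 x a (anchor x b) : R) + (lambda1 x b (anchor x a) : R)
  + (ipair (phi1 x a : k1) (phi1 x b) + ipair (phi x a : k) (phi x b)) = 0.
Proof. by have := lagrangian_isotropic h1 a b; rewrite !pair_mapE. Qed.

Let iso2 x (a b : A2 x) : (lambda2 x a (anchor x b) : R) + (lambda2 x b (anchor x a) : R)
  + (ipair (psi2 x a : k2) (psi2 x b) - ipair (psi x a : k) (psi x b)) = 0.
Proof. by have := lagrangian_isotropic h2 a b; rewrite !pair_mapE. Qed.

Let dfibre p (e : D p) : phi p.1 (vsval e : A p).1 = psi p.2 (vsval e : A p).2.
Proof. by apply/mem_fibre_prod; exact: subvsP. Qed.

Lemma fibre_pointwise_isotropic (p : N) (a b : D p) :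
  (lambda p a (anchor p b) : R) + (lambda p b (anchor p a) : R)
  + ipair (Phi p a : qla_prod k1 k2) (Phi p b) = 0.
Proof.
rewrite !fibre_formE !fibre_anchorE !prod_anchorE !row_mxKl !row_mxKr !fibre_prod_mapE.
have I1 := iso1 (vsval a : A p).1 (vsval b : A p).1.
have I2 := iso2 (vsval a : A p).2 (vsval b : A p).2.
rewrite -!dfibre in I2.
have abs (x1 y1 x2 y2 r s t : R) : x1 + y1 + (r + t) = 0 -> x2 + y2 + (s - t) = 0 ->
  x1 + x2 + (y1 + y2) + (r + s) = 0 by move=> H1 H2; lra.
exact: abs I1 I2.
Qed.

Lemma fibre_isotropic : is_isotropic_structure Phi lambda eta.
Proof.
have brD := fibre_prod_subalgebroid hA1 hA2 (lie_morphism_pair hphi).2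
  (lie_morphism_pair hpsi).2 hsurj.
have lieD := sub_algebroid_lie (prod_lie hA1 hA2) brD.
have [_ [sa _]] := lieD.
have [i1 _ _] := h1; have [i2 _ _] := h2.
have [_ f1 cl1 _ _] := i1; have [_ f2 cl2 _ _] := i2.
have feta := form3_sum_is_form3 f1 f2.
have sl := fibre_form_smooth h1 h2.
have sm : bundle_map_smooth Phi := fibre_prod_map_smooth (lie_morphism_pair hphi).1 (lie_morphism_pair hpsi).1.
split=> //.
- exact: form3_sum_closed.
- move=> u v Gu Gv [x y]; apply/lfunP => w.
  rewrite fibre_formE fincl_br // prod_brE.
  have GU : Gamma (fincl u) := Gu; have GV : Gamma (fincl v) := Gv.
  rewrite (courant_formE _ _ _ feta (sa _ _ (Gu (x, y))) (sl u _ (Gu (x, y)))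
    (sl v _ (Gv (x, y))) (sm u _ (Gu (x, y)))).
  have mE : map_sect anchor u = map_sect anchor (fincl u).
    by apply: sect_ext => q; rewrite /map_sect fibre_anchorE.
  (* For the first factor the left half of [w] is the test vector and the right half the transverse
     one; [H2] exchanges the roles. *)
  have H1 := half_br_isotropic hA1 mPhi1.1 i1 (lagrangian_isotropic h1)
    (anchor y (fincl u (x, y)).2) (anchor y (fincl v (x, y)).2)
    (lsubmx (w : 'rV[R]_(n1 + n2)) : TS x) (rsubmx (w : 'rV[R]_(n1 + n2)) : TS y)
    (fam1_smooth hA1 GU) (fam1_smooth hA1 GV).
  have H2 := half_br_isotropic hA2 mPhi2.1 i2 (lagrangian_isotropic h2)
    (anchor x (fincl u (x, y)).1) (anchor x (fincl v (x, y)).1)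
    (rsubmx (w : 'rV[R]_(n1 + n2)) : TS y) (lsubmx (w : 'rV[R]_(n1 + n2)) : TS x)
    (fam2_smooth hA2 GU) (fam2_smooth hA2 GV).
  have zE (s : sect D) : map_sect anchor s ((x, y) : N) =
      row_mx (anchor x (fincl s (x, y)).1 : 'rV[R]_n1) (anchor y (fincl s (x, y)).2 : 'rV[R]_n2).
    by rewrite /map_sect fibre_anchorE prod_anchorE.
  have R1 := dd_fibre_form h1 h2 w (map_sect anchor (fincl u) ((x, y) : N)) Gv.
  have R3 := dd_fibre_form h1 h2 w (map_sect anchor v ((x, y) : N)) Gu.
  have R4 := dd_fibre_form h1 h2 (map_sect anchor v ((x, y) : N)) w Gu.
  have R6 := fibre_ipair hphi hpsi v w Gu.
  have R2 := fibre_formE lambda1 lambda2 (v (x, y)) (vdiff (map_sect anchor (fincl u)) w).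
  rewrite (prod_anchor_vdiff hA1 hA2 w GU) row_mxKl row_mxKr in R2.
  rewrite -(prod_anchor_vdiff hA1 hA2 w GU) -mE in R2.
  rewrite -mE zE row_mxKl row_mxKr -zE in R1; rewrite zE row_mxKl row_mxKr -zE in R3.
  rewrite {2}zE zE row_mxKl row_mxKr -zE in R4.
  have R5 : @form3_sum _ _ _ _ _ eta1 eta2 ((x, y) : N) (map_sect anchor u (x, y)) (map_sect anchor v (x, y)) w =
     @eta1 x (anchor x (fincl u (x, y)).1) (anchor x (fincl v (x, y)).1) (lsubmx (w : 'rV[R]_(n1 + n2)) : TS x)
     + @eta2 y (anchor y (fincl u (x, y)).2) (anchor y (fincl v (x, y)).2) (rsubmx (w : 'rV[R]_(n1 + n2)) : TS y).
    by rewrite /form3_sum !dpr1E !dpr2E !zE !row_mxKl !row_mxKr.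
  have K := courant_sum_comb R1 R2 R3 R4 R5 R6 H1 H2.
  exact: K.
- move=> u v Gu Gv x; have := fibre_pointwise_isotropic (u x) (v x) => /eqP.
  by rewrite addr_eq0 => /eqP <-; rewrite addrC.
Qed.

Let ipair0l (q : quadratic_lie_algebra R) (w : q) : ipair 0 w = 0.
Proof. by rewrite ipair_sym ipair0r. Qed.

Lemma fibre_courant_map_injective p : injective (courant_map Phi lambda p).
Proof.
move=> c d cd; apply/eqP; rewrite -subr_eq0; apply/eqP.
have: courant_map Phi lambda p (c - d) = 0.
  by apply: (etrans (linearB (courant_map Phi lambda p) _ _)); rewrite /= cd; exact: subrr.
move: (c - d) => {c d cd} e; case: p e => x y e.
rewrite courant_mapE fibre_prod_mapE => -[ae le p1 p2].
have vE : (vsval e : A (x, y)).1 = 0 /\ (vsval e : A (x, y)).2 = 0.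
  have [a1 a2] : anchor x (vsval e : A (x, y)).1 = 0 /\ anchor y (vsval e : A (x, y)).2 = 0.
    have ae' := etrans (esym (etrans (fibre_anchorE e) (prod_anchorE (vsval e : A (x, y))))) ae.
    have := congr1 (fun z : 'rV[R]_(n1 + n2) => lsubmx z) ae'.
    have := congr1 (fun z : 'rV[R]_(n1 + n2) => rsubmx z) ae'.
    by rewrite row_mxKl row_mxKr !linear0.
  have l1 : lambda1 x (vsval e : A (x, y)).1 = 0.
    apply/lfunP => w; have := fibre_formE lambda1 lambda2 e (row_mx (w : 'rV[R]_n1) 0).
    by rewrite row_mxKl row_mxKr le !linear0 !lfunE /= addr0.
  have l2 : lambda2 y (vsval e : A (x, y)).2 = 0.
    apply/lfunP => w; have := fibre_formE lambda1 lambda2 e (row_mx 0 (w : 'rV[R]_n2)).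
    by rewrite row_mxKl row_mxKr le !linear0 !lfunE /= add0r.
  have k0 : phi x (vsval e : A (x, y)).1 = 0.
    (* Isotropy in each factor, against arbitrary [u] and [v], makes the common value of [phi] and
       [psi] pair to 0 with [phi x u - psi y v], hence with all of [k]. *)
    apply: ipair_nondegenerate => w.
    have [u [v <-]] := hsurj x y w.
    have := iso2 (vsval e : A (x, y)).2 v; have := iso1 (vsval e : A (x, y)).1 u.
    rewrite a1 a2 l1 l2 p1 p2 -(dfibre e) !linear0 !lfunE /= !ipair0l !add0r.
    move=> eu /eqP; rewrite oppr_eq0 => /eqP ev.
    have sub0 (r t : R) : r = 0 -> t = 0 -> r - t = 0 by move=> -> ->; rewrite subrr.
    exact: (etrans (ipairBr _ _ _) (sub0 _ _ eu ev)).
  have k0' : psi y (vsval e : A (x, y)).2 = 0 by rewrite -(dfibre e).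
  have [_ inj1 _] := h1; have [_ inj2 _] := h2.
  split; [apply: (@inj1 x)|apply: (@inj2 y)]; rewrite linear0 courant_mapE pair_mapE.
    by rewrite a1 l1 p1 k0.
  by rewrite a2 l2 p2 k0'.
apply: val_inj; rewrite linear0 [LHS]surjective_pairing.
by have [-> ->] := vE.
Qed.

Lemma fibre_lagrangian p (e : courant_bundle (qla_prod k1 k2) p) :
  e \in limg (courant_map Phi lambda p) <->
  (forall e', e' \in limg (courant_map Phi lambda p) -> courant_pair e e' = 0).
Proof.
split.
  move=> /memv_imgP [a _ ->] _ /memv_imgP [b _ ->]; rewrite !courant_mapE.
  exact: fibre_pointwise_isotropic.
case: p e => x y [[X al] [w1 w2]] eL.
pose X1 : TS x := lsubmx (X : 'rV[R]_(n1 + n2)).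
pose X2 : TS y := rsubmx (X : 'rV[R]_(n1 + n2)).
pose f0 (c : A (x, y)) : R := (al (anchor ((x, y) : N) c : TS ((x, y) : N)) : R)
  + ((lambda1 x c.1 X1 : R) + (lambda2 y c.2 X2 : R))
  + (ipair w1 (phi1 x c.1) + ipair w2 (psi2 y c.2)).
have f0L : linear (f0 : A (x, y) -> R^o).
  move=> a u v; rewrite /f0.
  have e1 : (al (anchor ((x, y) : N) (a *: u + v)) : R) =
      a * al (anchor ((x, y) : N) u) + al (anchor ((x, y) : N) v) by rewrite !linearP.
  have e2 : (lambda1 x (a *: u + v).1 X1 : R) = a * lambda1 x u.1 X1 + lambda1 x v.1 X1.
    by rewrite linearP add_lfunE scale_lfunE.
  have e3 : (lambda2 y (a *: u + v).2 X2 : R) = a * lambda2 y u.2 X2 + lambda2 y v.2 X2.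
    by rewrite linearP add_lfunE scale_lfunE.
  have e4 : ipair w1 (phi1 x (a *: u + v).1) = a * ipair w1 (phi1 x u.1) + ipair w1 (phi1 x v.1).
    by rewrite -ipair_linear_r linearP.
  have e5 : ipair w2 (psi2 y (a *: u + v).2) = a * ipair w2 (psi2 y u.2) + ipair w2 (psi2 y v.2).
    by rewrite -ipair_linear_r linearP.
  have abs (r r' s s' t t' p p' q q' : R) :
    (a * r + r') + ((a * s + s') + (a * t + t')) + ((a * p + p') + (a * q + q')) =
    a * (r + (s + t) + (p + q)) + (r' + (s' + t') + (p' + q')) by ring.
  by rewrite e1 e2 e3 e4 e5; exact: abs.
pose f : 'Hom(A (x, y), R^o) := linfun (f0 : A (x, y) -> R^o).
have fE c : f c = f0 c by rewrite /f linfun_lin.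
have gE c : diff_map phi psi (x, y) c = phi x c.1 - psi y c.2.
  rewrite /diff_map linfun_lin // => a u v.
  have q1 : phi x (a *: u + v).1 = a *: (phi x u.1 : k) + (phi x v.1 : k).
    exact: (linearP (phi x)).
  have q2 : psi y (a *: u + v).2 = a *: (psi y u.2 : k) + (psi y v.2 : k).
    exact: (linearP (psi y)).
  rewrite q1 q2.
  have abs (V : lmodType R) (r r' s s' : V) :
    (a *: r + r') - (a *: s + s') = a *: (r - s) + (r' - s').
    by rewrite scalerBr opprD addrACA.
  exact: (abs k).
have [||kap fk] := @ipair_factor _ k _ f (diff_map phi psi (x, y)).
- move=> w; have [u [v <-]] := hsurj x y w.
  by exists ((u, v) : A (x, y)); rewrite gE.
- move=> c c0; rewrite fE.
  have cD : c \in fibre_prod phi psi ((x, y) : N) by rewrite memv_ker c0.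
  pose d : D ((x, y) : N) := vsproj (fibre_prod phi psi ((x, y) : N)) c.
  have dc : (vsval d : A (x, y)) = c by rewrite vsprojK.
  have := eL _ (memv_img (courant_map Phi lambda (x, y)) (memvf d)).
  rewrite courant_mapE => H.
  have {H} : (al (anchor ((x, y) : N) d) : R) + (lambda (x, y) d X : R)
    + (ipair w1 (Phi (x, y) d).1 + ipair w2 (Phi (x, y) d).2) = 0 := H.
  by rewrite fibre_anchorE fibre_formE fibre_prod_mapE dc.
(* Testing on each summand splits the relation between the factors; the sign in front of [psi] is
   absorbed below by the opposite pairing, so the same [- kap] serves both. *)
have kL a : f0 (a, 0) = ipair kap (phi x a).
  by rewrite -fE fk gE /= linear0 subr0.
have kR b : f0 (0, b) = - ipair kap (psi y b).
  by rewrite -fE fk gE /= linear0 sub0r ipair_sym ipairNl ipair_sym.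
pose al1 : 'Hom(TS x, R^o) :=
  linfun (fun z : TS x => al (row_mx (z : 'rV[R]_n1) (0 : 'rV[R]_n2) : TS ((x, y) : N))).
pose al2 : 'Hom(TS y, R^o) :=
  linfun (fun z : TS y => al (row_mx (0 : 'rV[R]_n1) (z : 'rV[R]_n2) : TS ((x, y) : N))).
have al1E z : al1 z = al (row_mx (z : 'rV[R]_n1) (0 : 'rV[R]_n2) : TS ((x, y) : N)).
  rewrite /al1 linfun_lin // => a u v.
  have -> : row_mx (a *: u + v : 'rV[R]_n1) 0 = a *: row_mx (u : 'rV[R]_n1) 0 + row_mx (v : 'rV[R]_n1) 0
    :> 'rV[R]_(n1 + n2) by rewrite scale_row_mx add_row_mx scaler0 addr0.
  exact: (linearP al).
have al2E z : al2 z = al (row_mx (0 : 'rV[R]_n1) (z : 'rV[R]_n2) : TS ((x, y) : N)).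
  rewrite /al2 linfun_lin // => a u v.
  have -> : row_mx 0 (a *: u + v : 'rV[R]_n2) = a *: row_mx 0 (u : 'rV[R]_n2) + row_mx 0 (v : 'rV[R]_n2)
    :> 'rV[R]_(n1 + n2) by rewrite scale_row_mx add_row_mx scaler0 addr0.
  exact: (linearP al).
have [_ _ [_ lag1 _]] := h1; have [_ _ [_ lag2 _]] := h2.
have cancel3 (r t c : R) : r + t + (c - (r + t + c)) = 0 by ring.
have : (((X1, al1), (w1, - kap)) : courant_bundle (qla_prod k1 k) x) \in
    limg (courant_map (pair_map phi1 phi) lambda1 x).
  apply/lag1 => _ /memv_imgP [a _ ->]; rewrite courant_mapE pair_mapE.
  have : (al1 (anchor x a) : R) + (lambda1 x a X1 : R) +
     (ipair w1 (phi1 x a) + ipair (- kap) (phi x a)) = 0; last by [].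
  rewrite al1E ipairNl -kL /f0 prod_anchorE !linear0 !lfunE /= ipair0r !addr0.
  exact: cancel3.
move=> /memv_imgP [u _]; rewrite courant_mapE pair_mapE => -[X1E alu w1E ku].
have : (((X2, al2), (w2, - kap)) : courant_bundle (qla_prod k2 (opposite k)) y) \in
    limg (courant_map (pair_map (k2 := opposite k) psi2 psi) lambda2 y).
  apply/lag2 => _ /memv_imgP [b _ ->]; rewrite courant_mapE pair_mapE.
  have : (al2 (anchor y b) : R) + (lambda2 y b X2 : R) +
     (ipair w2 (psi2 y b) - ipair (- kap) (psi y b)) = 0; last by [].
  rewrite al2E ipairNl -kR /f0 prod_anchorE !linear0 !lfunE /= ipair0r !add0r.
  exact: cancel3.
move=> /memv_imgP [v _]; rewrite courant_mapE pair_mapE => -[X2E alv w2E kv].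
pose c : A (x, y) := (u, v).
have cD : c \in fibre_prod phi psi ((x, y) : N).
  by apply/mem_fibre_prod; rewrite /= -ku -kv.
pose d : D ((x, y) : N) := vsproj (fibre_prod phi psi ((x, y) : N)) c.
have dc : (vsval d : A (x, y)) = c by rewrite vsprojK.
apply/memv_imgP; exists d; first exact: memvf.
have aE : anchor ((x, y) : N) d = X.
  rewrite fibre_anchorE dc prod_anchorE -X1E -X2E; exact: hsubmxK.
have lE : lambda (x, y) d = al.
  apply/lfunP => z; rewrite fibre_formE dc -alu -alv al1E al2E.
  have lD (p q : TS ((x, y) : N)) : (al p : R) + (al q : R) = al (p + q) by rewrite linearD.
  by rewrite lD add_row_mx addr0 add0r hsubmxK.
have pE : Phi (x, y) d = (w1, w2) by rewrite fibre_prod_mapE dc -w1E -w2E.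
by rewrite courant_mapE aE lE pE.
Qed.

End FibreProductLagrangian.

Theorem theorem3p22 (R : realType) (n1 n2 : nat)
    (N1 : manifold R n1) (N2 : manifold R n2)
    (k k1 k2 : quadratic_lie_algebra R)
    (A1 : algebroid_data N1) (hA1 : is_lie_algebroid A1)
    (A2 : algebroid_data N2) (hA2 : is_lie_algebroid A2)
    (phi1 : bundle_map A1 (trivial_bundle N1 k1))
    (phi : bundle_map A1 (trivial_bundle N1 k))
    (hphi : is_lie_morphism (k := qla_prod k1 k) (pair_map phi1 phi))
    (psi2 : bundle_map A2 (trivial_bundle N2 k2))
    (psi : bundle_map A2 (trivial_bundle N2 k))
    (hpsi : is_lie_morphism (k := qla_prod k2 k) (pair_map psi2 psi))
    (lambda1 : bundle_map A1 (cotangent_bundle N1)) (eta1 : form3 N1)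
    (h1 : is_lagrangian_structure (k := qla_prod k1 k)
            (pair_map phi1 phi) lambda1 eta1)
    (lambda2 : bundle_map A2 (cotangent_bundle N2)) (eta2 : form3 N2)
    (h2 : is_lagrangian_structure (k := qla_prod k2 (opposite k))
            (pair_map (k2 := opposite k) psi2 psi) lambda2 eta2)
    (hsurj : forall (x : N1) (y : N2) (w : k),
       exists (u : A1 x) (v : A2 y), phi x u - psi y v = w) :
  [/\ is_lie_subalgebroid (A := prod_algebroid A1 A2) (fibre_prod phi psi),
      is_lie_algebroid (fibre_prod_algebroid phi psi),
      is_lie_morphism (k := qla_prod k1 k2)
        (fibre_prod_map phi psi phi1 psi2)
    & is_lagrangian_structure (k := qla_prod k1 k2)
        (fibre_prod_map phi psi phi1 psi2)
        (fibre_prod_form phi psi lambda1 lambda2)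
        (form3_sum eta1 eta2)].
Proof.
have [mphi1 mphi] := lie_morphism_pair hphi.
have [mpsi2 mpsi] := lie_morphism_pair hpsi.
have brD := fibre_prod_subalgebroid hA1 hA2 mphi mpsi hsurj.
have lieD := fibre_prod_lie hA1 hA2 mphi mpsi hsurj.
have mor := fibre_prod_morphism hA1 hA2 brD mphi1 mpsi2.
split=> //; apply: (lagrangian_of_isotropic lieD mor).
- exact: (fibre_isotropic hA1 hA2 hphi hpsi h1 h2 hsurj).
- exact: (fibre_courant_map_injective h1 h2 hsurj).
- exact: (fibre_lagrangian h1 h2 hsurj).
Qed.
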